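(* Let $T\ge2$, $\mathcal{T}=\{1,\dots,T\}$, consider the special model described in the context, and fix $i\in\mathcal{T}$ with $i\ge2$. Let $$A^{\alpha}_1=\alpha^{-1/2}\operatorname{E}\bigg[C^{\alpha}_{i,T}-C^{\alpha}_{i,T-i+1}\prod_{s=T-i+1}^{T-1}f_s\,\Big|\,\mathcal{D}^{\alpha}\bigg],\qquad A^{\alpha}_2=\alpha^{1/2}\bigg(\prod_{s=T-i+1}^{T-1}f_s-\prod_{s=T-i+1}^{T-1}\widehat{f}_s\bigg).$$ Then $(A^{\alpha}_1)_{\alpha\ge0}$ and $(A^{\alpha}_2)_{\alpha\ge0}$ are independent and each converges in distribution, as $\alpha\to\infty$, to a normally distributed random variable with zero mean. In particular, $(A^{\alpha}_1A^{\alpha}_2)_{\alpha\ge0}$ converges in distribution to a random variable with zero mean.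
   Context: Special model. Fix an integer $T\ge2$, $\mathcal{T}=\{1,\dots,T\}$. For each $i\in\mathcal{T}$, $(M^{\alpha}_i)_{\alpha\ge0}$ is a homogeneous Poisson process with intensity $\lambda_i\in(0,\infty)$, and $(D_{i,k},Z_{i,k})_{k\ge1}$ is an i.i.d. sequence of pairs with $D_{i,k}\in\mathcal{T}$, with common distribution that of a generic pair $(D,Z)$ not depending on $i$, where $D$ and $Z$ are independent, $\operatorname{E}[Z^2]<\infty$ and $\operatorname{E}[ZI\{D=t\}]>0$ for all $t\in\mathcal{T}$. For each $i$, $(D_{i,k},Z_{i,k})_k$ is independent of $(M^\alpha_i)_\alpha$, and the families $\{(M^{\alpha}_i)_\alpha,(D_{i,k},Z_{i,k})_k\}$, $i=1,\dots,T$, are independent. Define $C^{\alpha}_{i,t}=\sum_{k=1}^{M^{\alpha}_i}Z_{i,k}I\{D_{i,k}\le t\}$. $\mathcal{D}^{\alpha}$ is the $\sigma$-algebra generated by $\{C^{\alpha}_{j,t}:j,t\in\mathcal{T},\ j+t\le T+1\}$. For $t\le T-1$: $\widehat{f}_t=\sum_{j=1}^{T-t}C^{\alpha}_{j,t+1}/\sum_{j=1}^{T-t}C^{\alpha}_{j,t}$ and $f_t=\operatorname{E}[ZI\{D\le t+1\}]/\operatorname{E}[ZI\{D\le t\}]$. *)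

(* Defs.v *)
From HB Require Import structures.
From mathcomp Require Import all_boot all_order all_algebra.
From mathcomp Require Import all_classical all_reals all_analysis.
Set Implicit Arguments.
Unset Strict Implicit.
Unset Printing Implicit Defensive.
Import Order.TTheory GRing.Theory Num.Def Num.Theory.
Import numFieldTopology.Exports.

Local Open Scope classical_set_scope.
Local Open Scope ring_scope.

Section defs.
Context {R : realType} {d : measure_display} {Omega : measurableType d}
  (P : probability Omega R).

(** Events determined by a nat-valued / real-valued random variable
    (they generate sigma(X)). *)
Definition events_nat (X : Omega -> nat) : set (set Omega) :=
  [set X @^-1` [set n] | n in [set: nat]].
Definition events_real (X : Omega -> R) : set (set Omega) :=
  [set X @^-1` B | B in measurable].

Definition sigma_real (I : Type) (S : set I) (X : I -> Omega -> R)
  : set (set Omega) :=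
  <<s \bigcup_(a in S) events_real (X a) >>.

Definition mutually_independent (I : Type) (F : I -> set (set Omega)) :=
  forall (n : nat) (j : 'I_n -> I), injective j ->
  forall A : 'I_n -> set Omega, (forall k, F (j k) (A k)) ->
  P (\big[setI/setT]_(k < n) A k) = (\prod_(k < n) P (A k))%E.

Definition independent (F G : set (set Omega)) :=
  forall A B, F A -> G B -> P (A `&` B) = (P A * P B)%E.

Definition cond_exp_version (G : set (set Omega)) (X Y : Omega -> R) :=
  (forall B, measurable B -> G (Y @^-1` B)) /\
  P.-integrable setT (EFin \o Y) /\
  (forall A, G A ->
     (\int[P]_(w in A) (Y w)%:E = \int[P]_(w in A) (X w)%:E)%E).

Definition cvg_in_law (X : R -> Omega -> R) (mu : probability (measurableTypeR R) R) :=
  forall f : R -> R, continuous f -> (exists K : R, forall x, `|f x| <= K) ->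
  (fun a : R => (\int[P]_w (f (X a w))%:E)%E) @ +oo --> (\int[mu]_x (f x)%:E)%E.

Definition poisson_process (N : R -> Omega -> nat) (lam : R) :=
  (forall t n, 0 <= t -> measurable (N t @^-1` [set n])) /\
  P [set w | N 0 w = 0%N] = 1%E /\
  (forall s t (n : nat), 0 <= s < t ->
     P [set w | (N t w)%:R - (N s w)%:R = n%:R :> R]
     = (poisson_pmf (lam * (t - s)) n)%:E) /\
  (forall n (t : 'I_n.+1 -> R), 0 <= t ord0 ->
     (forall k : 'I_n, t (widen_ord (leqnSn n) k) < t (lift ord0 k)) ->
     mutually_independent
       (fun k : 'I_n => events_real (fun w =>
          (N (t (lift ord0 k)) w)%:R - (N (t (widen_ord (leqnSn n) k)) w)%:R))).

End defs.

Section model.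
Context {R : realType} {d : measure_display} {Omega : measurableType d}.
Variables (M : nat -> R -> Omega -> nat) (D : nat -> nat -> Omega -> nat)
  (Z : nat -> nat -> Omega -> R).

Definition claims (j t : nat) (a : R) (w : Omega) : R :=
  \sum_(1 <= k < (M j a w).+1) Z j k w * (D j k w <= t)%:R.

Definition obs_sigma (T : nat) (a : R) : set (set Omega) :=
  <<s \bigcup_(jt in [set jt : nat * nat |
         [&& (1 <= jt.1)%N, (1 <= jt.2)%N & (jt.1 + jt.2 <= T.+1)%N]])
        events_real (claims jt.1 jt.2 a) >>.

(** chain-ladder estimator (with the convention x / 0 = 0) *)
Definition fhat (T t : nat) (a : R) (w : Omega) : R :=
  (\sum_(1 <= j < (T - t).+1) claims j t.+1 a w) /
  (\sum_(1 <= j < (T - t).+1) claims j t a w).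
End model.

Definition dev_factor {R : realType} {d : measure_display}
  {Omega : measurableType d} (P : probability Omega R)
  (D0 : Omega -> nat) (Z0 : Omega -> R) (t : nat) : R :=
  fine ('E_P[fun w => Z0 w * (D0 w <= t.+1)%:R]) /
  fine ('E_P[fun w => Z0 w * (D0 w <= t)%:R]).

(* Main.v *)
(** A sum of marks over a Poisson number of claims is characterised by Mecke's
    identity: weighting an expectation by the sum amounts to adding one extra,
    independent mark, [E (\sum_k r_k) G(C) = lam a E r_0 G(C + x_0)].
    - For linear statistics of the claims the identity is the equation needed
      by Stein's method, which yields tightness and asymptotic normality.
    - The chain-ladder error is, by a Slutsky argument factor by factor,
      equivalent to a centred linear statistic of the years [1, ..., i - 1].
    - Applied to the claims of year [i] reported after [T - i + 1], whose marks
      do not touch the observed claims, the identity evaluates the conditional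
      expectation: up to a null set the first term is a centred multiple of
      [C_{i,T-i+1}], hence a linear statistic of year [i] alone.
    Independence of the years then gives independence of the two terms, and the
    product converges in law to the product of two independent normals. *)
Require Import Defs.
From HB Require Import structures.
From mathcomp Require Import all_boot all_order all_algebra.
From mathcomp Require Import all_classical all_reals all_analysis.
From mathcomp Require Import measurable_realfun ring lra zify.
Import Order.TTheory GRing.Theory Num.Def Num.Theory.
Import numFieldTopology.Exports.
Local Open Scope classical_set_scope.
Local Open Scope ring_scope.

(** Once the Poisson recursion has been used, the probabilistic facts about the random sums come
    from Mecke's identity tested on a functional [G] of a whole family of linear statistics. The
    index type of the family is what varies: a single statistic for Stein's method, all observed
    pairs for the conditional expectation. The integrals are first taken in the extended nonnegative
    reals, so integrability of the sums is itself a consequence of the identity.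

    Two obstacles shape the rest. The first term is an arbitrary version of a conditional
    expectation, chosen separately for each of uncountably many [a], so no common null set can be
    discarded; independence is therefore transported through the sigma-algebra of events that agree,
    up to a null set, with an event of year [i]. And nondegenerate normal limits need positive
    limiting variances: delay [T] in year 1 provides one for the second term, the delays up to
    [T - i + 1] in year [i] for the first, both by E[Z 1{D = t}] > 0. *)

Section real_expectation.
Context {R : realType} {d : measure_display} {Omega : measurableType d}
  (P : probability Omega R).
Implicit Types f g : Omega -> R.

Local Notation rint f := (P.-integrable setT (EFin \o f)).

Lemma rint_measurable f : rint f -> measurable_fun setT f.
Proof. by move=> /integrableP[/measurable_EFinP]. Qed.

Lemma rint_le f g : measurable_fun setT f -> (forall x, `|f x| <= g x) -> rint g -> rint f.
Proof.
move=> mf fg; apply: le_integrable => //; first exact/measurable_EFinP.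
by move=> x _; rewrite /= lee_fin (le_trans (fg x))// ler_norm.
Qed.

Lemma rint_cst (k : R) : rint (fun=> k).
Proof. exact: finite_measure_integrable_cst. Qed.

Lemma rint_bounded f (K : R) : measurable_fun setT f -> (forall x, `|f x| <= K) -> rint f.
Proof. by move=> mf fK; exact: (rint_le _ _ mf fK (rint_cst K)). Qed.

Lemma rint_norm f : rint f -> rint (fun x => `|f x|).
Proof. exact: integrable_norm. Qed.

Lemma rintZl (k : R) f : rint f -> rint (fun x => k * f x).
Proof.
by move=> fi; have := integrableZl measurableT k fi; apply: eq_integrable.
Qed.

Lemma rintM f g (K : R) : rint f -> measurable_fun setT g -> (forall x, `|g x| <= K) ->
  rint (fun x => f x * g x).
Proof.
move=> fi mg gK; apply: (@rint_le _ (fun x => K * `|f x|)).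
- by apply: measurable_funM => //; exact: rint_measurable.
- by move=> x; rewrite normrM mulrC ler_wpM2r.
- exact/rintZl/rint_norm.
Qed.

Lemma rintD f g : rint f -> rint g -> rint (fun x => f x + g x).
Proof. by move=> fi gi; have := integrableD measurableT fi gi; apply: eq_integrable. Qed.

Lemma rintB f g : rint f -> rint g -> rint (fun x => f x - g x).
Proof. by move=> fi gi; have := integrableB measurableT fi gi; apply: eq_integrable. Qed.

Lemma Rintegral_cstT (k : R) : \int[P]_x k = k.
Proof.
transitivity (k * fine (P setT)); first exact: Rintegral_cst.
by rewrite probability_setT mulr1.
Qed.

Lemma rint_sum (J : Type) (s : seq J) (f : J -> Omega -> R) :
  (forall j, rint (f j)) -> rint (fun x => \sum_(j <- s) f j x).
Proof.
move=> fi; elim: s => [|j s IH].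
  by apply: eq_integrable (rint_cst 0) => // x _; rewrite /= big_nil.
by apply: eq_integrable (rintD _ _ (fi j) IH) => // x _; rewrite /= big_cons.
Qed.

Lemma Rintegral_sum (J : Type) (s : seq J) (f : J -> Omega -> R) :
  (forall j, rint (f j)) ->
  \int[P]_x (\sum_(j <- s) f j x) = \sum_(j <- s) \int[P]_x f j x.
Proof.
move=> fi; elim: s => [|j s IH].
  rewrite big_nil; under eq_Rintegral do rewrite big_nil.
  by rewrite Rintegral_cstT.
rewrite big_cons -IH -RintegralD//; last exact: rint_sum.
by apply: eq_Rintegral => x _; rewrite big_cons.
Qed.

Lemma EFin_Rintegral f : rint f -> (\int[P]_x f x)%:E = (\int[P]_x (f x)%:E)%E.
Proof. by move=> fi; rewrite fineK//; exact: integrable_fin_num. Qed.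

Lemma norm_Rintegral_le f g : rint f -> rint g -> (forall x, `|f x| <= g x) ->
  `|\int[P]_x f x| <= \int[P]_x g x.
Proof.
move=> fi gi fg; apply: (le_trans (le_normr_Rintegral _ fi)) => //.
by apply: le_Rintegral => //; exact: integrable_norm.
Qed.

Lemma norm_Rintegral_bounded f (K : R) : measurable_fun setT f ->
  (forall x, `|f x| <= K) -> `|\int[P]_x f x| <= K.
Proof.
move=> mf fK; rewrite -[leRHS](Rintegral_cstT K).
by apply: norm_Rintegral_le => //; [exact: rint_bounded fK|exact: rint_cst].
Qed.

End real_expectation.

(** * Independence of generated sigma-algebras and decoupling *)

Section independence.
Context {R : realType} {d : measure_display} {Omega : measurableType d}
  (P : probability Omega R).
Local Open Scope ereal_scope.

Lemma independentC (F G : set (set Omega)) :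
  independent P F G -> independent P G F.
Proof. by move=> FG A B GA FB; rewrite setIC FG// muleC. Qed.

Lemma g_sigma_measurable (F : set (set Omega)) :
  F `<=` measurable -> <<s F >> `<=` measurable.
Proof.
by move=> Fm; apply: smallest_sub => //; exact: sigma_algebra_measurable.
Qed.

(** Pi-lambda argument: for fixed [B] the measurable sets independent of [B] form a Dynkin system
    [H] that contains the pi-system [F]. *)
Lemma independent_g_sigma (F G : set (set Omega)) :
  F `<=` measurable -> G `<=` measurable -> setI_closed F ->
  independent P F G -> independent P <<s F >> G.
Proof.
move=> Fm Gm FI FG A B sFA GB.
pose H := [set A | measurable A /\ P (A `&` B) = P A * P B].
suff: <<s F >> `<=` H by move=> /(_ _ sFA)[].
have mB := Gm _ GB.
apply: lambda_system_subset => //; last first.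
  by move=> C FC; split; [exact: Fm|exact: FG].
apply/dynkin_lambda_system; split.
- by split; [exact: measurableT|rewrite setTI probability_setT mul1e].
- move=> C [mC PC]; split; first exact: measurableC.
  rewrite setIC -setDE measureD//; last by rewrite ltey_eq fin_num_measure.
  rewrite [X in _ - X](_ : _ = P C * P B); last by rewrite setIC; exact: PC.
  by rewrite probability_setC// muleBl ?mul1e// fin_num_measure.
- move=> C tC HC; split; first by apply: bigcup_measurable => k _; have [] := HC k.
  rewrite setI_bigcupl !measure_bigcup//; last 3 first.
  + by move=> k _; have [] := HC k.
  + by move=> k _; apply: measurableI => //; have [] := HC k.
  + by apply: trivIset_setIr.
  rewrite muleC -[P B]fineK ?fin_num_measure// -nneseriesZl//.
  by apply: eq_eseriesr => k _; rewrite muleC fineK ?fin_num_measure//; exact: (HC k).2.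
Qed.

(** Finite intersections of events with indices different from [i] form a pi-system [H] that
    generates the sigma-algebra of all the others. On [H], the product formula for the index list
    [i :: s] factors off the event of index [i]. *)
Lemma mutually_independent_others (I : choiceType) (F : I -> set (set Omega)) (i : I) :
  (forall j, F j `<=` measurable) -> (forall j, F j setT) ->
  (forall j, setI_closed (F j)) -> mutually_independent P F ->
  independent P (F i) <<s \bigcup_(j in [set j | j != i]) F j >>.
Proof.
move=> Fm FT FI indF.
pose H : set (set Omega) := [set A | exists s : seq I, exists B : I -> set Omega,
  [/\ i \notin s, uniq s, forall j, F j (B j) & A = \big[setI/setT]_(j <- s) B j]].
have Hm : H `<=` measurable.
  move=> _ [s [B [_ _ FB ->]]]; apply: bigsetI_measurable => j _; exact/Fm.
have prodE (s : seq I) (B : I -> set Omega) : uniq s -> (forall j, F j (B j)) ->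
    P (\big[setI/setT]_(j <- s) B j) = \prod_(j <- s) P (B j).
  move=> us FB; rewrite (big_nth i) big_mkord [RHS](big_nth i) big_mkord.
  apply: (indF (size s) (fun k : 'I_(size s) => nth i s k)) => // k l /eqP.
  by rewrite nth_uniq// => /eqP /val_inj.
have HI : setI_closed H.
  move=> _ _ [s [B [is_ us FB ->]]] [t [C [it ut FC ->]]].
  (* On the merged index list, an event missing from one of the two intersections is read as
     [setT]. *)
  exists (undup (s ++ t)), (fun j => (if j \in s then B j else setT) `&`
     (if j \in t then C j else setT)); split.
  - by rewrite mem_undup mem_cat negb_or is_.
  - exact: undup_uniq.
  - by move=> j; apply: FI; case: ifP.
  - rewrite -!bigcap_seq; apply/seteqP; split => [w [sw tw] j _|w stw].
      by split; case: ifPn => // js; [exact: sw|exact: tw].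
    split=> j /= js; have /= := stw j; rewrite mem_undup mem_cat js ?orbT.
      by move=> /(_ isT)[].
    by move=> /(_ isT)[].
have : independent P <<s H >> (F i).
  apply: independent_g_sigma => // _ A [s [B [is_ us FB ->]]] FA.
  pose C j := if j == i then A else B j.
  have := prodE (i :: s) C; rewrite /= is_ us => /(_ isT).
  rewrite !big_cons /C eqxx => prod_is.
  rewrite setIC muleC; transitivity (P (A `&` \big[setI/setT]_(j <- s) C j)).
    congr (P (_ `&` _)); rewrite big_seq [RHS]big_seq; apply: eq_bigr => j js.
    by rewrite /C; case: eqP => // ji; rewrite -ji js in is_.
  rewrite prod_is; last by move=> j; case: eqP => // ->.
  rewrite prodE//; congr (_ * _); rewrite big_seq [RHS]big_seq; apply: eq_bigr => j js.
  by rewrite /C; case: eqP => // ji; rewrite -ji js in is_.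
move=> /independentC indH A B FA sB; apply: indH => //.
move: sB; apply: smallest_sub; first exact: smallest_sigma_algebra.
move=> C [j/= ji FC]; apply: sub_sigma_algebra.
exists [:: j], (fun k => if k == j then C else setT); split => //.
- by rewrite inE eq_sym.
- by move=> k; case: eqP => // ->.
- by rewrite big_seq1 eqxx.
Qed.

(** By independence, the law of the diagonal map into the product of the two generated
    sigma-algebras is the product of its marginals, so Tonelli separates the two arguments. The type
    of [f] records which argument is measurable for which sigma-algebra. *)
Lemma decoupling (A B : set (set Omega)) :
  A `<=` measurable -> B `<=` measurable -> independent P <<s A >> <<s B >> ->
  forall f : g_sigma_algebraType A * g_sigma_algebraType B -> \bar R,
  measurable_fun setT f -> (forall x, 0 <= f x) ->
  \int[P]_w f (w, w) = \int[P]_w \int[P]_w' f (w, w').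
Proof.
move=> Am Bm indAB f mf f0.
have mA : measurable_fun setT (id : Omega -> g_sigma_algebraType A).
  by move=> _ C mC; rewrite setTI; exact: g_sigma_measurable mC.
have mB : measurable_fun setT (id : Omega -> g_sigma_algebraType B).
  by move=> _ C mC; rewrite setTI; exact: g_sigma_measurable mC.
pose PA := distribution P (mfun_Sub (mem_set mA)).
pose PB := distribution P (mfun_Sub (mem_set mB)).
have mdiag : measurable_fun setT
    (fun w : Omega => (w : g_sigma_algebraType A, w : g_sigma_algebraType B)).
  by apply/measurable_fun_pair.
pose PAB := distribution P (mfun_Sub (mem_set mdiag)).
transitivity (\int[PAB]_z f z); first by rewrite ge0_integral_distribution.
transitivity (\int[PA \x PB]_z f z).
  apply: eq_measure_integral => C mC _; apply/esym.
  by apply: product_measure_unique => // D E mD mE; exact: indAB.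
rewrite fubini_tonelli1// ge0_integral_distribution//=; last 2 first.
- exact: measurable_fun_fubini_tonelli_F.
- by move=> w; apply: integral_ge0.
apply: eq_integral => w _ /=.
rewrite /fubini_F ge0_integral_distribution//.
by apply: measurableT_comp => //; exact: measurable_pair1.
Qed.

End independence.

(* Measurability for the product sigma-algebra on [I -> R], tested against
   measurable families so that no such structure on [I -> R] is needed. *)
Definition product_measurable {R : realType} {I : Type} (G : (I -> R) -> R) :=
  forall d (T : measurableType d) (u : I -> T -> R),
    (forall i, measurable_fun setT (u i)) ->
    measurable_fun setT (fun x => G (u ^~ x)).

Lemma product_measurable_shift {R : realType} {I : Type} (G : (I -> R) -> R) (v : I -> R) :
  product_measurable G -> product_measurable (fun u => G (fun i => u i + v i)).
Proof.
by move=> mG d T u mu; apply: mG => i; apply: measurable_funD.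
Qed.

Lemma measurable_fun_g_sigma {d d'} {T : measurableType d} {U : measurableType d'}
    (F : set (set T)) (f : T -> U) : F `<=` measurable ->
  measurable_fun setT (f : g_sigma_algebraType F -> U) -> measurable_fun setT f.
Proof.
by move=> Fm mf _ B mB; apply: g_sigma_measurable Fm _ _; exact: mf.
Qed.

Lemma measurable_fun_g_sigma_sub {T : pointedType} {d'} {U : measurableType d'}
    (F F' : set (set T)) (f : T -> U) : F `<=` <<s F' >> ->
  measurable_fun setT (f : g_sigma_algebraType F -> U) ->
  measurable_fun setT (f : g_sigma_algebraType F' -> U).
Proof.
move=> FF' mf _ B mB; have := mf measurableT B mB.
by apply: smallest_sub => //; exact: smallest_sigma_algebra.
Qed.

Lemma measurable_fun_fst {d1 d2 d'} {T1 : measurableType d1} {T2 : measurableType d2}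
    {U : measurableType d'} (f : T1 -> U) : measurable_fun setT f ->
  measurable_fun setT (fun x : T1 * T2 => f x.1).
Proof. by move=> mf; exact: (measurableT_comp mf measurable_fst). Qed.

Lemma measurable_fun_snd {d1 d2 d'} {T1 : measurableType d1} {T2 : measurableType d2}
    {U : measurableType d'} (f : T2 -> U) : measurable_fun setT f ->
  measurable_fun setT (fun x : T1 * T2 => f x.2).
Proof. by move=> mf; exact: (measurableT_comp mf measurable_snd). Qed.

(** * Mecke's identity *)

Section marks.
Context {R : realType} {d : measure_display} {Omega : measurableType d}
  (P : probability Omega R) {e : measure_display} {E : measurableType e}
  (xi : nat -> Omega -> E) (xi0 : Omega -> E) (F : nat -> set (set Omega)).
Hypothesis Fm : forall k, F k `<=` measurable.
Hypothesis xim : forall k, measurable_fun setT (xi k : g_sigma_algebraType (F k) -> E).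
Hypothesis Find : forall k,
  independent P <<s F k >> <<s \bigcup_(j in [set j | j != k]) <<s F j >> >>.
Hypothesis xi0m : measurable_fun setT xi0.
Hypothesis xi_law : forall k (f : E -> \bar R), measurable_fun setT f ->
  (forall x, 0 <= f x)%E -> (\int[P]_w f (xi k w) = \int[P]_w f (xi0 w))%E.
Context {I : Type} (h : I -> E -> R) (rho : E -> R).
Hypothesis hm : forall i, measurable_fun setT (h i).
Hypothesis rhom : measurable_fun setT rho.
Hypothesis rho_ge0 : forall x, 0 <= rho x.

Let others k := \bigcup_(j in [set j | j != k]) <<s F j >>.

Let othersm k : others k `<=` measurable.
Proof. by move=> A [j _]; apply: g_sigma_measurable. Qed.

Definition mark_sum (f : E -> R) n w : R := \sum_(k < n) f (xi k w).

Lemma mark_sumS f n w : mark_sum f n.+1 w = mark_sum f n w + f (xi n w).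
Proof. exact: big_ord_recr. Qed.

Lemma measurable_mark_sum_others f n : measurable_fun setT f ->
  measurable_fun setT (mark_sum f n : g_sigma_algebraType (others n) -> R).
Proof.
move=> fm; apply: measurable_sum => k; apply: measurableT_comp => //.
apply: measurable_fun_g_sigma_sub (xim k) => A FA.
apply: sub_sigma_algebra; exists (k : nat); first by rewrite /= ltn_eqF.
exact: sub_sigma_algebra.
Qed.

Lemma measurable_mark_sum_all f n : measurable_fun setT f ->
  measurable_fun setT (mark_sum f n : g_sigma_algebraType (\bigcup_k F k) -> R).
Proof.
move=> fm; apply: measurable_sum => k; apply: measurableT_comp => //.
apply: measurable_fun_g_sigma_sub (xim k) => A FA.
by apply: sub_sigma_algebra; exists (k : nat).
Qed.

Lemma measurable_mark_sum f n : measurable_fun setT f ->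
  measurable_fun setT (mark_sum f n).
Proof.
by move=> /(measurable_mark_sum_all _ n); apply: measurable_fun_g_sigma => A [k _ /Fm].
Qed.

(** Mark [n] is independent of all the others, so it can be integrated out separately and replaced
    by the generic mark, whatever [f] reads from the other marks. *)
Lemma fresh_mark n (f : g_sigma_algebraType (others n) * E -> \bar R) :
  measurable_fun setT f -> (forall x, 0 <= f x)%E ->
  (\int[P]_w f (w, xi n w) = \int[P]_w \int[P]_w' f (w, xi0 w'))%E.
Proof.
move=> mf f0.
pose g (x : g_sigma_algebraType (others n) * g_sigma_algebraType (F n)) :=
  f (x.1, xi n x.2).
have -> : (\int[P]_w f (w, xi n w) = \int[P]_w g (w, w))%E by [].
rewrite (decoupling P (others n) (F n))//; last 3 first.
- exact/independentC/Find.
- apply: (measurableT_comp mf); apply: measurable_fun_pair => //.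
  by apply: (measurableT_comp (xim n)).
- by move=> x; exact: f0.
apply: eq_integral => w _; rewrite /g /= (xi_law n (fun x => f (w, x)))//.
exact: (measurableT_comp mf (pair1_measurable _)).
Qed.

Let V n w : I -> R := fun i => mark_sum (h i) n w.
Let h0 w : I -> R := fun i => h i (xi0 w).

Let tonelli (f : Omega * Omega -> R) : measurable_fun setT f -> (forall x, 0 <= f x) ->
  (\int[P]_x \int[P]_y (f (x, y))%:E = \int[P]_y \int[P]_x (f (x, y))%:E)%E.
Proof.
move=> mf f0; rewrite (fubini_tonelli (fun z => (f z)%:E))//.
exact/measurable_EFinP.
Qed.

(** Each of the [n.+1] summands contributes the same amount, its own mark being replaced by a
    generic copy. The induction peels off the last mark: the sum without it is treated by the
    induction hypothesis for a shifted [G], and the weight of the last mark gives the missing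
    copy. *)
Lemma mecke_fixed n (G : (I -> R) -> R) : product_measurable G ->
  (forall v, 0 <= G v) ->
  (\int[P]_w (mark_sum rho n.+1 w * G (V n.+1 w))%:E =
   n.+1%:R%:E * \int[P]_w' \int[P]_w
     (rho (xi0 w') * G (fun i => V n w i + h0 w' i))%:E)%E.
Proof.
have mh0 i : measurable_fun setT (fun w => h0 w i) by exact: measurableT_comp.
have mr0 : measurable_fun setT (rho \o xi0) by exact: measurableT_comp.
have mV m i : measurable_fun setT (fun w => V m w i) by exact: measurable_mark_sum.
have ms m : measurable_fun setT (mark_sum rho m) by exact: measurable_mark_sum.
have s0 m w : 0 <= mark_sum rho m w by exact: sumr_ge0.
(* [K] receives the running sum, the vector of statistics and the new mark. Its measurability is
   tested along measurable families, as in [product_measurable], because the vector lives in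
   [I -> R]. *)
have step m (K : R -> (I -> R) -> E -> R) :
    (forall r v x, 0 <= r -> 0 <= K r v x) ->
    (forall d' (T : measurableType d') (r : T -> R) (u : I -> T -> R) (x : T -> E),
       measurable_fun setT r -> (forall i, measurable_fun setT (u i)) ->
       measurable_fun setT x -> measurable_fun setT (fun t => K (r t) (u ^~ t) (x t))) ->
    (\int[P]_w (K (mark_sum rho m w) (V m w) (xi m w))%:E =
     \int[P]_w \int[P]_w' (K (mark_sum rho m w) (V m w) (xi0 w'))%:E)%E.
  move=> K0 Km.
  pose f (x : g_sigma_algebraType (others m) * E) :=
    (K (mark_sum rho m x.1) (V m x.1) x.2)%:E.
  have := fresh_mark m f; apply => [|x]; last by rewrite lee_fin K0// s0.
  apply/measurable_EFinP; apply: Km => [|i|//].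
    exact: (measurableT_comp (measurable_mark_sum_others _ m rhom)).
  exact: (measurableT_comp (measurable_mark_sum_others _ m (hm i))).
elim: n G => [|n IH] G mG G0.
  rewrite mul1e.
  under eq_integral => w _.
    rewrite mark_sumS /mark_sum big_ord0 add0r.
    rewrite (_ : V 1 w = fun i => V 0 w i + h i (xi 0 w)); last first.
      by apply/funext => i; rewrite /V mark_sumS.
    over.
  rewrite (step 0 (fun r v x => rho x * G (fun i => v i + h i x))).
  - rewrite (tonelli (fun x => rho (xi0 x.2) * G (fun i => V 0 x.1 i + h0 x.2 i)))//.
    + apply: measurable_funM; first exact: (measurable_fun_snd (rho \o xi0)).
      apply: mG => i; apply: measurable_funD; first exact: (measurable_fun_fst (V 0 ^~ i)).
      exact: (measurable_fun_snd (h0 ^~ i)).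
    + by move=> x; exact: mulr_ge0.
  - by move=> r v x r0; exact: mulr_ge0.
  - move=> d' T r u x mr mu mx; apply: measurable_funM; first exact: measurableT_comp.
    by apply: mG => i; apply: measurable_funD => //; exact: measurableT_comp.
under eq_integral => w _.
  rewrite mark_sumS.
  rewrite (_ : V n.+2 w = fun i => V n.+1 w i + h i (xi n.+1 w)); last first.
    by apply/funext => i; rewrite /V mark_sumS.
  over.
rewrite (step n.+1 (fun r v x => (r + rho x) * G (fun i => v i + h i x))); last 2 first.
- by move=> r v x r0; apply: mulr_ge0 => //; exact: addr_ge0.
- move=> d' T r u x mr mu mx; apply: measurable_funM.
    by apply: measurable_funD => //; exact: measurableT_comp.
  by apply: mG => i; apply: measurable_funD => //; exact: measurableT_comp.
rewrite (tonelli (fun x => (mark_sum rho n.+1 x.1 + rho (xi0 x.2)) *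
   G (fun i => V n.+1 x.1 i + h0 x.2 i)))//; last 2 first.
- apply: measurable_funM.
    apply: measurable_funD; first exact: measurable_fun_fst.
    exact: (measurable_fun_snd (rho \o xi0)).
  apply: mG => i; apply: measurable_funD; first exact: (measurable_fun_fst (V n.+1 ^~ i)).
  exact: (measurable_fun_snd (h0 ^~ i)).
- by move=> x; apply: mulr_ge0 => //; exact: addr_ge0.
(* Peeling the last mark off [V n.+1] writes [Q] as the integral of [f3] over two generic marks,
   which is also what the induction hypothesis returns for the shifted functional. The old sum thus
   yields [n.+1] copies of [Q] and the new mark one more. *)
pose Q := (\int[P]_w' \int[P]_w (rho (xi0 w') * G (fun i => V n.+1 w i + h0 w' i))%:E)%E.
pose f3 (x : Omega * Omega * Omega) : \bar R :=
  (rho (xi0 x.1.1) * G (fun i => V n x.2 i + h0 x.1.1 i + h0 x.1.2 i))%:E.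
have mf3 : measurable_fun setT f3.
  apply/measurable_EFinP/measurable_funM.
    by apply: (measurable_fun_fst (fun x => (rho \o xi0) x.1)); exact: measurable_fun_fst.
  apply: mG => i; apply: measurable_funD; first apply: measurable_funD.
  - exact: (measurable_fun_snd (V n ^~ i)).
  - apply: (measurable_fun_fst (fun x => h0 x.1 i)).
    exact: (measurable_fun_fst (h0 ^~ i)).
  - apply: (measurable_fun_fst (fun x => h0 x.2 i)).
    exact: (measurable_fun_snd (h0 ^~ i)).
have f3_ge0 x : (0 <= f3 x)%E by rewrite lee_fin mulr_ge0.
have QE : Q = (\int[P]_y \int[P]_w' \int[P]_w f3 (w', y, w))%E.
  rewrite -(fubini_tonelli (fubini_F P f3))//; last 2 first.
  - exact: measurable_fun_fubini_tonelli_F.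
  - by move=> x; exact: integral_ge0.
  apply: eq_integral => w' _.
  under eq_integral => w _.
    rewrite (_ : (fun i => V n.+1 w i + h0 w' i) =
        fun i => V n w i + h0 w' i + h i (xi n w)); last first.
      by apply/funext => i; rewrite /V mark_sumS addrAC.
    over.
  rewrite (step n (fun r v x => rho (xi0 w') * G (fun i => v i + h0 w' i + h i x))).
  - rewrite (tonelli (fun x => rho (xi0 w') * G (fun i => V n x.1 i + h0 w' i + h0 x.2 i)))//.
      apply: measurable_funM => //; apply: mG => i; apply: measurable_funD.
        by apply: measurable_funD => //; exact: (measurable_fun_fst (V n ^~ i)).
      exact: (measurable_fun_snd (h0 ^~ i)).
    by move=> x; exact: mulr_ge0.
  - by move=> r v x _; exact: mulr_ge0.
  - move=> d' T r u x mr mu mx; apply: measurable_funM => //.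
    apply: mG => i; apply: measurable_funD; first exact: measurable_funD.
    exact: measurableT_comp.
pose f1 (x : Omega * Omega) : \bar R :=
  (mark_sum rho n.+1 x.1 * G (fun i => V n.+1 x.1 i + h0 x.2 i))%:E.
pose f2 (x : Omega * Omega) : \bar R :=
  (rho (xi0 x.2) * G (fun i => V n.+1 x.1 i + h0 x.2 i))%:E.
have mG1 : measurable_fun setT (fun x : Omega * Omega => G (fun i => V n.+1 x.1 i + h0 x.2 i)).
  apply: mG => i; apply: measurable_funD; first exact: (measurable_fun_fst (V n.+1 ^~ i)).
  exact: (measurable_fun_snd (h0 ^~ i)).
have mf1 : measurable_fun setT f1.
  by apply/measurable_EFinP/measurable_funM => //; exact: measurable_fun_fst.
have mf2 : measurable_fun setT f2.
  by apply/measurable_EFinP/measurable_funM => //; exact: (measurable_fun_snd (rho \o xi0)).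
have f1_ge0 x : (0 <= f1 x)%E by rewrite lee_fin mulr_ge0.
have f2_ge0 x : (0 <= f2 x)%E by rewrite lee_fin mulr_ge0.
transitivity (\int[P]_y (fubini_G P f1 y + fubini_G P f2 y))%E.
  apply: eq_integral => y _; rewrite /fubini_G -ge0_integralD//.
  - by apply: eq_integral => x _; rewrite /f1 /f2 -EFinD -mulrDl.
  - exact: (measurableT_comp mf1 (pair2_measurable _)).
  - exact: (measurableT_comp mf2 (pair2_measurable _)).
rewrite ge0_integralD//; last 4 first.
- by move=> y _; exact: integral_ge0.
- exact: measurable_fun_fubini_tonelli_G.
- by move=> y _; exact: integral_ge0.
- exact: measurable_fun_fubini_tonelli_G.
rewrite -/Q -[n.+2%:R]natr1 EFinD ge0_muleDl ?lee_fin//.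
congr (_ + _)%E; last by rewrite mul1e.
transitivity (\int[P]_y (n.+1%:R%:E * fubini_G P (fubini_F P f3) y))%E.
  apply: eq_integral => y _.
  exact: (IH (fun v => G (fun i => v i + h0 y i))
    (product_measurable_shift G (h0 y) mG) (fun v => G0 _)).
rewrite ge0_integralZl; [by rewrite QE|exact: measurableT| | |by rewrite lee_fin].
- apply: measurable_fun_fubini_tonelli_G; first exact: measurable_fun_fubini_tonelli_F.
  by move=> x; exact: integral_ge0.
- by move=> y _; apply: integral_ge0 => w' _; exact: integral_ge0.
Qed.

Section random_index.
Variables (N : Omega -> nat) (FN : set (set Omega)) (c : R).
Hypothesis FNm : FN `<=` measurable.
Hypothesis NF : forall n, <<s FN >> (N @^-1` [set n]).
Hypothesis FNind : independent P <<s \bigcup_k F k >> <<s FN >>.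
(* The recursion characterising the Poisson law of mean [c]. *)
Hypothesis N_rec : forall n, (n.+1%:R%:E * P (N @^-1` [set n.+1]) = c%:E * P (N @^-1` [set n]))%E.

Let bigFm : \bigcup_k F k `<=` measurable.
Proof. by move=> A [k _ /Fm]. Qed.

(** The integral is split over the values of [N]; each event [N = n] is independent of the marks, so
    its probability factors out. *)
Lemma indep_index_integral (X : nat -> Omega -> R) : (forall n w, 0 <= X n w) ->
  (forall n, measurable_fun setT (X n : g_sigma_algebraType (\bigcup_k F k) -> R)) ->
  (\int[P]_w (X (N w) w)%:E =
   \sum_(0 <= n <oo) (P (N @^-1` [set n]) * \int[P]_w (X n w)%:E))%E.
Proof.
move=> X0 mX.
have mNn n : measurable (N @^-1` [set n]).
  exact: g_sigma_measurable FNm _ (NF n).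
have mX' n : measurable_fun setT (X n) by exact: measurable_fun_g_sigma bigFm (mX n).
transitivity (\int[P]_w \sum_(0 <= n <oo) (X n w * \1_(N @^-1` [set n]) w)%:E)%E.
  apply: eq_integral => w _.
  rewrite (@nneseriesD1 _ _ (N w))//; last by move=> n _; rewrite lee_fin mulr_ge0.
  rewrite indicE mem_set// mulr1 eseries0 ?adde0// => n _ nw.
  by rewrite indicE memNset ?mulr0// => /= Nw; rewrite Nw eqxx in nw.
rewrite integral_nneseries//; last 2 first.
- by move=> n; apply/measurable_EFinP/measurable_funM => //; exact: measurable_indic.
- by move=> n w _; rewrite lee_fin mulr_ge0.
apply: eq_eseriesr => n _.
pose f (x : g_sigma_algebraType (\bigcup_k F k) * g_sigma_algebraType FN) :=
  (X n x.1 * \1_(N @^-1` [set n]) x.2)%:E.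
have -> : (\int[P]_w (X n w * \1_(N @^-1` [set n]) w)%:E = \int[P]_w f (w, w))%E by [].
rewrite (decoupling P (\bigcup_k F k) FN); [|by []|by []|by []| |]; last 2 first.
- apply/measurable_EFinP/measurable_funM; first exact: measurable_fun_fst.
  have m1 : measurable_fun setT (\1_(N @^-1` [set n]) : g_sigma_algebraType FN -> R).
    by apply: measurable_indic; exact: NF.
  exact: (measurableT_comp m1 measurable_snd).
- by move=> x; rewrite lee_fin mulr_ge0.
rewrite muleC -ge0_integralZr//=.
- apply: eq_integral => w _.
  rewrite /f/=; under eq_integral do rewrite EFinM.
  rewrite ge0_integralZl//.
  + by rewrite integral_indic// setIT.
  + by apply/measurable_EFinP; exact: measurable_indic.
  + by rewrite lee_fin.
- exact/measurable_EFinP.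
- by move=> w _; rewrite lee_fin.
Qed.

(** The term [n = 0] vanishes with the empty sum. In the others the factor [n.+1] produced by
    [mecke_fixed] is absorbed by [N_rec], which lowers the index of the weight by one, so the same
    mixture reappears with [c] in front. *)
Lemma mecke_marks (G : (I -> R) -> R) : product_measurable G ->
  (forall v, 0 <= G v) -> 0 <= c ->
  (\int[P]_w (mark_sum rho (N w) w * G (V (N w) w))%:E =
   c%:E * \int[P]_w' \int[P]_w
     (rho (xi0 w') * G (fun i => V (N w) w i + h0 w' i))%:E)%E.
Proof.
move=> mG G0 c0.
rewrite (indep_index_integral (fun n w => mark_sum rho n w * G (V n w))); last 2 first.
- by move=> n w; apply: mulr_ge0 => //; exact: sumr_ge0.
- move=> n; apply: measurable_funM; first exact: measurable_mark_sum_all.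
  by apply: mG => i; exact: measurable_mark_sum_all.
rewrite nneseries_recl//; last first.
  move=> n _; rewrite mule_ge0//; apply: integral_ge0 => w _.
  by rewrite lee_fin mulr_ge0//; exact: sumr_ge0.
under eq_integral do rewrite /mark_sum big_ord0 mul0r.
rewrite integral0 mule0 add0e.
pose Q n := (\int[P]_w' \int[P]_w (rho (xi0 w') * G (fun i => V n w i + h0 w' i))%:E)%E.
have mh0 i : measurable_fun setT (fun w => h0 w i) by exact: measurableT_comp.
have mr0 : measurable_fun setT (rho \o xi0) by exact: measurableT_comp.
pose f n (x : Omega * Omega) := (rho (xi0 x.1) * G (fun i => V n x.2 i + h0 x.1 i))%:E.
have mf n : measurable_fun setT (f n).
  apply/measurable_EFinP/measurable_funM; first exact: (measurable_fun_fst (rho \o xi0)).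
  apply: mG => i; apply: measurable_funD; last exact: (measurable_fun_fst (h0 ^~ i)).
  apply: (measurable_fun_snd (V n ^~ i)); exact: measurable_mark_sum.
have f_ge0 n x : (0 <= f n x)%E by rewrite lee_fin mulr_ge0.
have Q_ge0 n : (0 <= Q n)%E by apply: integral_ge0 => w' _; apply: integral_ge0 => w _; rewrite lee_fin mulr_ge0.
have P_ge0 n : (0 <= P (N @^-1` [set n]))%E by [].
rewrite -nneseries_addn; last first.
  move=> n; rewrite mule_ge0//; apply: integral_ge0 => w _.
  by rewrite lee_fin mulr_ge0//; exact: sumr_ge0.
transitivity (\sum_(0 <= n <oo) (c%:E * (P (N @^-1` [set n]) * Q n)))%E.
  apply: eq_eseriesr => n _; rewrite addn1 mecke_fixed//.
  by rewrite muleA [X in (X * _)%E]muleC N_rec muleA.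
rewrite nneseriesZl; last by move=> n _; exact: mule_ge0.
congr (_ * _)%E.
transitivity (\sum_(0 <= n <oo) \int[P]_w' (P (N @^-1` [set n]) * fubini_F P (f n) w'))%E.
  apply: eq_eseriesr => n _; rewrite ge0_integralZl.
  - by [].
  - exact: measurableT.
  - exact: measurable_fun_fubini_tonelli_F.
  - by move=> w' _; apply: integral_ge0.
  - exact: P_ge0.
rewrite -integral_nneseries; last 3 first.
- exact: measurableT.
- move=> n; apply: emeasurable_funM; first exact: measurable_cst.
  exact: measurable_fun_fubini_tonelli_F.
- by move=> n w' _; apply: mule_ge0 => //; apply: integral_ge0.
apply: eq_integral => w' _.
rewrite (indep_index_integral (fun n w => rho (xi0 w') * G (fun i => V n w i + h0 w' i)))//.
- by move=> n w; exact: mulr_ge0.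
- move=> n; apply: measurable_funM => //.
  by apply: mG => i; apply: measurable_funD => //; exact: measurable_mark_sum_all.
Qed.

End random_index.
End marks.

Lemma measurable_random_index {d d'} {T : measurableType d} {U : measurableType d'}
    (N : T -> nat) (X : nat -> T -> U) :
  (forall n, measurable (N @^-1` [set n])) -> (forall n, measurable_fun setT (X n)) ->
  measurable_fun setT (fun w => X (N w) w).
Proof.
move=> mN mX _ B mB; rewrite setTI.
rewrite (_ : _ @^-1` B = \bigcup_n (N @^-1` [set n] `&` X n @^-1` B)); last first.
  apply/seteqP; split => [w /= Bw|w [n _ [/= <-]]//].
  by exists (N w).
apply: bigcup_measurable => n _; apply: measurableI => //.
by rewrite -[X in measurable X]setTI; exact: mX.
Qed.

(** * Mecke's identity with independent addends, bounded tests and signed marks *)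

Section mecke.
Context {R : realType} {d : measure_display} {Omega : measurableType d}
  (P : probability Omega R) {I : Type}.

(** [s] is the total weight of the claims and [U] the statistics tested by [G]; [r0] and [h0] are
    the weight of one extra mark and its effect on the statistics, taken on an independent copy of
    the space. With extended integrals and nonnegative tests the identity makes sense before
    integrability is known. *)
Definition mecke_identity (s : Omega -> R) (U : I -> Omega -> R) (r0 : Omega -> R)
    (h0 : I -> Omega -> R) (c : R) := forall G : (I -> R) -> R,
  product_measurable G -> (forall v, 0 <= G v) ->
  (\int[P]_w (s w * G (U ^~ w))%:E =
   c%:E * \int[P]_w' \int[P]_w (r0 w' * G (fun i => U i w + h0 i w'))%:E)%E.

(** [V] is independent of the claims behind [s] and [U]: with [V] frozen the identity applies to [G]
    shifted by [V], and integrating over [V] afterwards restores the joint law. *)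
Lemma mecke_identity_add (s : Omega -> R) (U : I -> Omega -> R) (r0 : Omega -> R)
    (h0 : I -> Omega -> R) (c : R) (V : I -> Omega -> R) (F FV : set (set Omega)) :
  F `<=` measurable -> FV `<=` measurable -> independent P <<s F >> <<s FV >> ->
  measurable_fun setT (s : g_sigma_algebraType F -> R) ->
  (forall i, measurable_fun setT (U i : g_sigma_algebraType F -> R)) ->
  (forall i, measurable_fun setT (V i : g_sigma_algebraType FV -> R)) ->
  measurable_fun setT r0 -> (forall i, measurable_fun setT (h0 i)) ->
  (forall w, 0 <= s w) -> (forall w, 0 <= r0 w) ->
  0 <= c ->
  mecke_identity s U r0 h0 c ->
  mecke_identity s (fun i w => U i w + V i w) r0 h0 c.
Proof.
move=> Fm FVm ind ms mU mV mr0 mh0 s0 r00 c0 mecke G mG G0.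
have mV' i : measurable_fun setT (V i) by exact: measurable_fun_g_sigma FVm (mV i).
have mU' i : measurable_fun setT (U i) by exact: measurable_fun_g_sigma Fm (mU i).
pose f (x : g_sigma_algebraType F * g_sigma_algebraType FV) :=
  (s x.1 * G (fun i => U i x.1 + V i x.2))%:E.
have -> : (\int[P]_w (s w * G (fun i => U i w + V i w))%:E = \int[P]_w f (w, w))%E by [].
rewrite (decoupling P F FV Fm FVm ind); last 2 first.
- apply/measurable_EFinP/measurable_funM; first exact: measurable_fun_fst.
  apply: mG => i; apply: measurable_funD; first exact: measurable_fun_fst.
  exact: measurable_fun_snd.
- by move=> x; rewrite lee_fin mulr_ge0.
pose g (x : Omega * Omega) : \bar R := (s x.1 * G (fun i => U i x.1 + V i x.2))%:E.
have mg : measurable_fun setT g.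
  apply/measurable_EFinP/measurable_funM.
    by apply: measurable_fun_fst; exact: measurable_fun_g_sigma Fm ms.
  apply: mG => i; apply: measurable_funD; first exact: measurable_fun_fst.
  exact: measurable_fun_snd.
transitivity (\int[P]_y \int[P]_x g (x, y))%E.
  by rewrite -(fubini_tonelli g mg)// => x; rewrite lee_fin mulr_ge0.
pose k (x : Omega * Omega * Omega) : \bar R :=
  (r0 x.1.2 * G (fun i => U i x.2 + h0 i x.1.2 + V i x.1.1))%:E.
have mk : measurable_fun setT k.
  apply/measurable_EFinP/measurable_funM.
    by apply: (measurable_fun_fst (fun x => r0 x.2)); exact: measurable_fun_snd.
  apply: mG => i; apply: measurable_funD; first apply: measurable_funD.
  - exact: measurable_fun_snd.
  - by apply: (measurable_fun_fst (fun x => h0 i x.2)); exact: measurable_fun_snd.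
  - by apply: (measurable_fun_fst (fun x => V i x.1)); exact: measurable_fun_fst.
have k0 x : (0 <= k x)%E by rewrite lee_fin mulr_ge0.
have mFk : measurable_fun setT (fubini_F P k) by exact: measurable_fun_fubini_tonelli_F.
have Fk0 x : (0 <= fubini_F P k x)%E by exact: integral_ge0.
transitivity (\int[P]_y (c%:E * fubini_F P (fubini_F P k) y))%E.
  apply: eq_integral => y _.
  exact: (mecke (fun v => G (fun i => v i + V i y)) (product_measurable_shift G _ mG)
    (fun v => G0 _)).
rewrite ge0_integralZl; first last.
- by rewrite lee_fin.
- by move=> y _; apply: integral_ge0.
- exact: measurable_fun_fubini_tonelli_F.
- exact: measurableT.
congr (_ * _)%E.
transitivity (\int[P]_x \int[P]_y fubini_F P k (y, x))%E.
  by rewrite -(fubini_tonelli (fubini_F P k)).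
apply: eq_integral => w' _.
pose q (x : g_sigma_algebraType F * g_sigma_algebraType FV) :=
  (r0 w' * G (fun i => U i x.1 + V i x.2 + h0 i w'))%:E.
pose q' (x : Omega * Omega) : \bar R :=
  (r0 w' * G (fun i => U i x.1 + V i x.2 + h0 i w'))%:E.
transitivity (\int[P]_w q (w, w))%E; last by [].
rewrite (decoupling P F FV Fm FVm ind); last 2 first.
- apply/measurable_EFinP/measurable_funM => //.
  apply: mG => i; apply: measurable_funD => //; apply: measurable_funD.
    exact: measurable_fun_fst.
  exact: measurable_fun_snd.
- by move=> x; rewrite lee_fin mulr_ge0.
transitivity (\int[P]_y \int[P]_x q' (x, y))%E.
  apply: eq_integral => y _; apply: eq_integral => x _; rewrite /k /q' /=.
  by congr (_ * G _)%:E; apply/funext => i; rewrite addrAC.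
rewrite -(fubini_tonelli q')//; last by move=> x; rewrite lee_fin mulr_ge0.
apply/measurable_EFinP/measurable_funM => //.
apply: mG => i; apply: measurable_funD => //; apply: measurable_funD.
  exact: measurable_fun_fst.
exact: measurable_fun_snd.
Qed.

Lemma measurable_expectation_shift (U h0 : I -> Omega -> R) (G : (I -> R) -> R) (K : R) :
  (forall i, measurable_fun setT (U i)) -> (forall i, measurable_fun setT (h0 i)) ->
  product_measurable G -> (forall v, `|G v| <= K) ->
  measurable_fun setT (fun w' => \int[P]_w G (fun i => U i w + h0 i w')).
Proof.
move=> mU mh0 mG GK.
(* The shift by [K] makes the integrand nonnegative for Tonelli; it is subtracted at the end. *)
pose f (x : Omega * Omega) : \bar R := (G (fun i => U i x.1 + h0 i x.2) + K)%:E.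
have mGf : measurable_fun setT (fun x : Omega * Omega => G (fun i => U i x.1 + h0 i x.2)).
  apply: mG => i; apply: measurable_funD; first exact: measurable_fun_fst.
  exact: measurable_fun_snd.
have mf : measurable_fun setT f by apply/measurable_EFinP/measurable_funD.
have f0 x : (0 <= f x)%E.
  by rewrite lee_fin -lerBlDr sub0r; have := GK (fun i => U i x.1 + h0 i x.2);
     rewrite ler_norml => /andP[].
have mGf' := measurable_fun_fubini_tonelli_G (m1 := P) f mf f0.
rewrite (_ : (fun _ => _) = (fun w' => fine (fubini_G P f w') - K)).
  by apply: measurable_funB => //; exact: (measurableT_comp (@fine_measurable R setT measurableT)).
apply/funext => w'; rewrite /fubini_G.
have mGw : measurable_fun setT (fun w => G (fun i => U i w + h0 i w')).
  by apply: mG => i; apply: measurable_funD.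
have -> : fine (\int[P]_x f (x, w')) = \int[P]_w (G (fun i => U i w + h0 i w') + K) by [].
rewrite RintegralD//; first by rewrite Rintegral_cstT addrK.
- by apply: rint_bounded mGw _ => w; exact: GK.
- exact: rint_cst.
Qed.

(** The test [G = 1] gives the integrability of [s]; a bounded signed [G] is then reached as [G + K]
    minus [K], both nonnegative. *)
Lemma mecke_bounded (s : Omega -> R) (U : I -> Omega -> R) (r0 : Omega -> R)
    (h0 : I -> Omega -> R) (c : R) (G : (I -> R) -> R) (K : R) :
  measurable_fun setT s -> (forall i, measurable_fun setT (U i)) ->
  P.-integrable setT (EFin \o r0) -> (forall i, measurable_fun setT (h0 i)) ->
  (forall w, 0 <= s w) -> (forall w, 0 <= r0 w) -> 0 <= c ->
  mecke_identity s U r0 h0 c ->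
  product_measurable G -> (forall v, `|G v| <= K) ->
  P.-integrable setT (EFin \o s) /\
  \int[P]_w (s w * G (U ^~ w)) =
   c * \int[P]_w' (r0 w' * \int[P]_w G (fun i => U i w + h0 i w')).
Proof.
move=> ms mU ir0 mh0 s0 r00 c0 mecke mG GK.
have mr0 := rint_measurable P _ ir0.
have K0 : 0 <= K by apply: le_trans (GK (fun=> 0)).
pose phi w' := \int[P]_w G (fun i => U i w + h0 i w').
have mphi : measurable_fun setT phi by exact: measurable_expectation_shift GK.
have mGw w' : measurable_fun setT (fun w => G (fun i => U i w + h0 i w')).
  by apply: mG => i; apply: measurable_funD.
have mGU : measurable_fun setT (fun w => G (U ^~ w)) by apply: mG.
have phiK w' : `|phi w'| <= K by apply: norm_Rintegral_bounded => // w; exact: GK.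
have eq_mecke (H : (I -> R) -> R) (L : R) : product_measurable H -> (forall v, 0 <= H v) ->
    (forall v, `|H v| <= L) ->
    (\int[P]_w (s w * H (U ^~ w))%:E =
     (c * \int[P]_w' (r0 w' * \int[P]_w H (fun i => U i w + h0 i w')))%:E)%E.
  move=> mH H0 HL; rewrite (mecke H mH H0) EFinM; congr (_ * _)%E.
  rewrite EFin_Rintegral; last first.
    apply: (rintM _ _ _ L ir0); first exact: measurable_expectation_shift HL.
    by move=> w'; apply: norm_Rintegral_bounded => //; apply: mH => i; apply: measurable_funD.
  apply: eq_integral => w' _.
  have mHw : measurable_fun setT (fun w => H (fun i => U i w + h0 i w')).
    by apply: mH => i; apply: measurable_funD.
  rewrite EFinM EFin_Rintegral; last by apply: rint_bounded mHw _ => w; exact: HL.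
  rewrite -ge0_integralZl//.
  + by apply/measurable_EFinP.
  + by move=> w _; rewrite lee_fin.
  + by rewrite lee_fin.
have is_ : P.-integrable setT (EFin \o s).
  apply/integrableP; split; first exact/measurable_EFinP.
  have := eq_mecke (fun=> 1) 1 (fun _ _ _ _ => measurable_cst _) (fun=> ler01).
  under eq_integral do rewrite mulr1.
  under [X in _ -> (X < _)%E]eq_integral => w _ do rewrite /= ger0_norm//.
  by move=> ->; rewrite ?ltry// => v; rewrite normr1.
split => //.
have GK0 v : 0 <= G v + K.
  by rewrite -lerBlDr sub0r; have := GK v; rewrite ler_norml => /andP[].
have GKK v : `|G v + K| <= K + K.
  by rewrite (le_trans (ler_normD _ _))// lerD// ger0_norm.
have mGK : product_measurable (fun v => G v + K).
  by move=> d' T u mu; apply: measurable_funD => //; exact: mG.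
have /(congr1 fine) := eq_mecke _ _ mGK GK0 GKK.
have /(congr1 fine) := eq_mecke (fun=> K) K (fun _ _ _ _ => measurable_cst _) (fun=> K0)
  (fun=> ltac:(by rewrite ger0_norm)).
rewrite /= -!/(Rintegral _ _ _) => EK EGK.
have isG : P.-integrable setT (EFin \o (fun w => s w * G (U ^~ w))).
  by apply: (rintM _ _ _ K is_) => // w; exact: GK.
have isK : P.-integrable setT (EFin \o (fun w => s w * K)).
  by apply: (rintM _ _ _ K is_) => // w; rewrite ger0_norm.
have irphi : P.-integrable setT (EFin \o (fun w => r0 w * phi w)).
  exact: (rintM _ _ _ K ir0).
have irK : P.-integrable setT (EFin \o (fun w => r0 w * K)).
  by apply: (rintM _ _ _ K ir0) => // w; rewrite ger0_norm.
move: EGK; under eq_Rintegral do rewrite mulrDr.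
rewrite RintegralD// EK => /eqP.
have -> : \int[P]_w' (r0 w' * \int[P]_w (G (fun i => U i w + h0 i w') + K)) =
    \int[P]_w' (r0 w' * phi w') + \int[P]_w' (r0 w' * K).
  rewrite -RintegralD//; apply: eq_Rintegral => w' _; rewrite -mulrDr; congr (_ * _).
  rewrite RintegralD//; first by rewrite Rintegral_cstT.
  - by apply: rint_bounded (mGw w') _ => w; exact: GK.
  - exact: rint_cst.
under [X in X + _ == _]eq_Rintegral do rewrite /=.
rewrite mulrDr; under [X in _ + c * X == _]eq_Rintegral do rewrite Rintegral_cstT.
by move=> /eqP /addIr.
Qed.

(** Signed marks are differences of nonnegative ones. The two identities share the statistics [U]
    and the shifts [h0], so they can be subtracted. *)
Lemma mecke_signed (sp sn : Omega -> R) (U : I -> Omega -> R) (rp rn : Omega -> R)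
    (h0 : I -> Omega -> R) (c : R) (G : (I -> R) -> R) (K : R) :
  measurable_fun setT sp -> measurable_fun setT sn -> (forall i, measurable_fun setT (U i)) ->
  P.-integrable setT (EFin \o rp) -> P.-integrable setT (EFin \o rn) ->
  (forall i, measurable_fun setT (h0 i)) ->
  (forall w, 0 <= sp w) -> (forall w, 0 <= sn w) ->
  (forall w, 0 <= rp w) -> (forall w, 0 <= rn w) -> 0 <= c ->
  mecke_identity sp U rp h0 c -> mecke_identity sn U rn h0 c ->
  product_measurable G -> (forall v, `|G v| <= K) ->
  P.-integrable setT (EFin \o (fun w => sp w - sn w)) /\
  \int[P]_w ((sp w - sn w) * G (U ^~ w)) =
   c * \int[P]_w' ((rp w' - rn w') * \int[P]_w G (fun i => U i w + h0 i w')).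
Proof.
move=> msp msn mU irp irn mh0 sp0 sn0 rp0 rn0 c0 mp mn mG GK.
have [isp ep] := mecke_bounded _ _ _ _ _ _ _ msp mU irp mh0 sp0 rp0 c0 mp mG GK.
have [isn en] := mecke_bounded _ _ _ _ _ _ _ msn mU irn mh0 sn0 rn0 c0 mn mG GK.
split; first exact: rintB.
have mphi := measurable_expectation_shift _ _ _ _ mU mh0 mG GK.
have mGU : measurable_fun setT (fun w => G (U ^~ w)) by apply: mG.
have mGw w' : measurable_fun setT (fun w => G (fun i => U i w + h0 i w')).
  by apply: mG => i; apply: measurable_funD.
have phiK w' : `|\int[P]_w G (fun i => U i w + h0 i w')| <= K.
  by apply: norm_Rintegral_bounded => // w; exact: GK.
under eq_Rintegral do rewrite mulrBl.
rewrite RintegralB//; last 2 first.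
- by apply: (rintM _ _ _ K isp) => // w; exact: GK.
- by apply: (rintM _ _ _ K isn) => // w; exact: GK.
under [X in _ = c * X]eq_Rintegral do rewrite mulrBl.
rewrite RintegralB//; last 2 first.
- exact: (rintM _ _ _ K irp).
- exact: (rintM _ _ _ K irn).
by rewrite ep en mulrBr.
Qed.

End mecke.

(** * Stein's equation for the normal law *)

Section stein_normal.
Context {R : realType} (s : R).
Hypothesis s0 : 0 < s.
Local Notation mu := (@lebesgue_measure R).
Local Notation p := (normal_pdf 0 s).
Let sn0 : s != 0. Proof. by rewrite gt_eqF. Qed.

Lemma integral_normal_prob (f : R -> R) : (normal_prob 0 s).-integrable setT (EFin \o f) ->
  (\int[normal_prob 0 s]_x (f x)%:E = \int[mu]_x (f x * p x)%:E)%E.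
Proof.
move=> fi; have mf := rint_measurable (normal_prob 0 s) f fi.
rewrite -(Radon_Nikodym_change_of_variables (normal_prob_dominates 0 s))//=.
apply: ae_eq_integral => //.
- apply: emeasurable_funM; first exact/measurable_EFinP.
  by apply: (measurable_int mu); apply: Radon_Nikodym_integrable; exact: normal_prob_dominates.
- by apply/measurable_EFinP/measurable_funM => //; exact: measurable_normal_pdf.
- under [X in ae_eq _ _ _ X]eq_fun do rewrite EFinM.
  apply: ae_eqe_mul2l => /=; rewrite Radon_NikodymE//=.
    exact: normal_prob_dominates.
  move=> abmu; case: cid => /= h [h1 h2 h3].
  apply: integral_ae_eq => //=.
  + by apply/measurable_EFinP; exact: measurable_normal_pdf.
  + by move=> E E01 mE; rewrite -h3.
Qed.

Lemma normal_pdf0E x : p x = normal_peak s * expR (- x ^+ 2 / (s ^+ 2 *+ 2)).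
Proof. by rewrite normal_pdfE// /normal_fun subr0. Qed.

Lemma normal_pdf_gt0 x : 0 < p x.
Proof. by rewrite normal_pdf0E mulr_gt0 ?expR_gt0// normal_peak_gt0. Qed.

Lemma is_derive_normal_pdf (x : R) : is_derive x 1 p (- (x / s ^+ 2) * p x).
Proof.
rewrite (_ : p = fun x => normal_peak s * expR (- x ^+ 2 / (s ^+ 2 *+ 2))); last first.
  by apply/funext => y; rewrite normal_pdf0E.
have d1 : is_derive x 1 (fun y : R => - y ^+ 2 / (s ^+ 2 *+ 2)) (- (x / s ^+ 2)).
  apply: is_derive_eq.
  rewrite /GRing.scale/=; field; exact: sn0.
have d2 : is_derive x 1 (expR \o (fun y : R => - y ^+ 2 / (s ^+ 2 *+ 2)))
   (- (x / s ^+ 2) * expR (- x ^+ 2 / (s ^+ 2 *+ 2))).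
  apply: is_derive_eq.
  by rewrite /GRing.scale/= mulrC.
have -> : - (x / s ^+ 2) * (normal_peak s * expR (- x ^+ 2 / (s ^+ 2 *+ 2))) =
  normal_peak s *: (- (x / s ^+ 2) * expR (- x ^+ 2 / (s ^+ 2 *+ 2))).
  by rewrite /GRing.scale/= mulrCA.
exact: (is_deriveZ _ d2).
Qed.

Lemma continuous_normal_pdf0 : continuous p.
Proof. exact: continuous_normal_pdf. Qed.

Lemma normal_pdf_even (x : R) : p (- x) = p x.
Proof. by rewrite !normal_pdf0E sqrrN. Qed.

Lemma cvg_normal_pdf : p x @[x --> +oo] --> (0 : R).
Proof.
rewrite (_ : p = fun x => normal_peak s * gauss_fun (x / Num.sqrt (s ^+ 2 *+ 2))); last first.
  apply/funext => x; rewrite normal_pdf0E /gauss_fun; congr (_ * expR _).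
  by rewrite exprMn exprVn sqr_sqrtr ?mulNr// mulrn_wge0// sqr_ge0.
rewrite -[X in _ --> X](mulr0 (normal_peak s)); apply: cvgMr.
apply: (cvg_comp (fun x => x / Num.sqrt (s ^+ 2 *+ 2)) gauss_fun); last exact: cvg_gauss_fun.
by apply/gt0_cvgMly; [rewrite invr_gt0 sqrtr_gt0 pmulrn_lgt0// exprn_gt0|exact: cvg_id].
Qed.

Lemma integrable_normal_pdfS (A : set (measurableTypeR R)) : measurable A -> mu.-integrable A (EFin \o p).
Proof.
move=> mA; apply: (integrableS measurableT) => //.
exact: integrable_normal_pdf.
Qed.

(** An antiderivative of [y * p y] is [- (s ^+ 2 * p y)], which vanishes at infinity. The case
    [x = 0] gives the half moments, the general case the tail bounds. *)
Lemma normal_partial_moment (x : R) : 0 <= x ->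
  (\int[mu]_(y in `[x, +oo[) (y * p y)%:E = (s ^+ 2 * p x)%:E)%E.
Proof.
move=> x0.
have dF (y : R) : is_derive y 1 (fun y : R => - (s ^+ 2 * p y)) (y * p y).
  have h := is_derive_normal_pdf y; apply: is_derive_eq.
  by rewrite /GRing.scale/= mulNr mulrN opprK mulrA mulrCA mulfV ?mulr1// expf_neq0.
rewrite (@ge0_continuous_FTC2y _ _ (fun y => - (s ^+ 2 * p y)) _ 0).
- by rewrite -EFinB sub0r opprK.
- by move=> y xy; rewrite mulr_ge0// ?normal_pdf_ge0// (le_trans x0).
- apply: continuous_subspaceT => y; apply: cvgM; first exact: cvg_id.
  exact: continuous_normal_pdf0.
- rewrite -[X in _ --> X]oppr0 -[X in _ --> - X](mulr0 (s ^+ 2)); apply: cvgN; apply: cvgMr; exact: cvg_normal_pdf.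
- by move=> y _; have [] := dF y.
- apply: cvgN; apply: cvgMr; apply: cvg_at_right_filter; exact: continuous_normal_pdf0.
- by move=> y _; rewrite derive1E; have [_ ->] := dF y.
Qed.

Lemma ge0_integral_normal_prob (f : R -> R) : measurable_fun setT f -> (forall x, 0 <= f x) ->
  (\int[normal_prob 0 s]_x (f x)%:E = \int[mu]_x (f x * p x)%:E)%E.
Proof.
move=> mf f0; have dom := normal_prob_dominates 0 s.
rewrite -(Radon_Nikodym_SigmaFinite.change_of_variables dom)//=; last exact/measurable_EFinP.
have fi := Radon_Nikodym_SigmaFinite.f_integrable dom.
apply: ae_eq_integral => //.
- by apply: emeasurable_funM; [exact/measurable_EFinP|exact: measurable_int fi].
- by apply/measurable_EFinP/measurable_funM => //; exact: measurable_normal_pdf.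
- under [X in ae_eq _ _ _ X]eq_fun do rewrite EFinM.
  apply: ae_eqe_mul2l; apply: integral_ae_eq => //.
  + by apply/measurable_EFinP; exact: measurable_normal_pdf.
  + by move=> E E01 mE; rewrite -(Radon_Nikodym_SigmaFinite.f_integral dom).
Qed.

Lemma normal_pos_part : (\int[normal_prob 0 s]_x (Num.max 0 x)%:E = (s ^+ 2 * p 0)%:E)%E.
Proof.
rewrite ge0_integral_normal_prob; [|exact: measurable_maxr|by move=> x; rewrite le_max lexx].
rewrite -(normal_partial_moment 0)// [RHS]integral_mkcond; apply: eq_integral => x _.
rewrite patchE mem_setE in_itv/= andbT; case: ifPn => [x0|]; first by rewrite max_r.
by rewrite -ltNge => /ltW x0; rewrite max_l// mul0r.
Qed.

Lemma normal_neg_part : (\int[normal_prob 0 s]_x (Num.max 0 (- x))%:E = (s ^+ 2 * p 0)%:E)%E.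
Proof.
rewrite ge0_integral_normal_prob; last 2 first.
- by apply: measurable_maxr => //; exact: measurableT_comp.
- by move=> x; rewrite le_max lexx.
rewrite -(normal_partial_moment 0)//.
transitivity (\int[mu]_(y in `]-oo, 0%R]) (Num.max 0 (- y) * p y)%:E)%E.
  rewrite [RHS]integral_mkcond; apply: eq_integral => x _.
  rewrite patchE mem_setE in_itv/=; case: ifPn => //; rewrite -ltNge => /ltW x0.
  by rewrite max_l ?oppr_le0// mul0r.
have := @ge0_integration_by_substitutionNy R (fun y => Num.max 0 (- y) * p y) 0.
rewrite oppr0 => ->.
- apply: eq_integral => x; rewrite inE/= in_itv/= andbT => x0.
  by rewrite opprK max_r// normal_pdf_even.
- apply: continuous_subspaceT => y; apply: cvgM; last exact: continuous_normal_pdf0.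
  by apply: continuous_max; [exact: cst_continuous|exact: opp_continuous].
- by move=> y _; rewrite mulr_ge0 ?normal_pdf_ge0// le_max lexx.
Qed.

(** Positive and negative part both have the finite integral [s ^+ 2 * p 0], whence integrability
    and cancellation. *)
Lemma normal_prob_mean : (normal_prob 0 s).-integrable setT (EFin \o (@idfun R)) /\
  (\int[normal_prob 0 s]_x x%:E = 0)%E.
Proof.
have mx : measurable_fun setT (fun x : R => Num.max 0 x) by exact: measurable_maxr.
have my : measurable_fun setT (fun x : R => Num.max 0 (- x)).
  by apply: measurable_maxr => //; exact: measurableT_comp.
have ix : (normal_prob 0 s).-integrable setT (EFin \o (fun x : R => Num.max 0 x)).
  apply/integrableP; split; first exact/measurable_EFinP.
  under eq_integral do rewrite /= ger0_norm ?le_max ?lexx//.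
  by rewrite normal_pos_part ltry.
have iy : (normal_prob 0 s).-integrable setT (EFin \o (fun x : R => Num.max 0 (- x))).
  apply/integrableP; split; first exact/measurable_EFinP.
  under eq_integral do rewrite /= ger0_norm ?le_max ?lexx//.
  by rewrite normal_neg_part ltry.
have E (x : R) : x = Num.max 0 x - Num.max 0 (- x).
  have [h|h] := leP 0 x; first by rewrite max_l ?subr0// oppr_le0.
  by rewrite max_r ?sub0r ?opprK// oppr_ge0 ltW.
split.
  by apply: eq_integrable (rintB _ _ _ ix iy) => // x _; rewrite /= -E.
transitivity (\int[normal_prob 0 s]_x ((Num.max 0 x)%:E - (Num.max 0 (- x))%:E))%E.
  by apply: eq_integral => x _; rewrite -EFinB -E.
by rewrite integralB_EFin// normal_pos_part normal_neg_part subee.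
Qed.

(** Mills' bound: [x <= y] on the tail, so [x] times the tail mass is at most the partial first
    moment. *)
Lemma normal_tail_le (x : R) : 0 < x -> \int[mu]_(y in `[x, +oo[) p y <= s ^+ 2 * p x / x.
Proof.
move=> x0; rewrite ler_pdivlMr// mulrC.
have E := normal_partial_moment x (ltW x0).
have ip := integrable_normal_pdfS `[x, +oo[ (measurable_itv _).
rewrite -RintegralZl//.
have -> : s ^+ 2 * p x = fine (\int[mu]_(y in `[x, +oo[) (y * p y)%:E)%E by rewrite E.
have m2 : measurable_fun setT (fun y : R => y * p y).
  by apply: measurable_funM => //; exact: measurable_normal_pdf.
apply: le_Rintegral => //.
- by apply: eq_integrable (integrableZl _ x ip).
- apply/integrableP; split; first by apply/measurable_EFinP; exact: measurable_funTS.
  under eq_integral => y.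
    rewrite inE/= in_itv/= andbT => xy.
    rewrite ger0_norm; last by rewrite mulr_ge0// ?normal_pdf_ge0// (le_trans (ltW x0)).
    over.
  by rewrite E ltry.
- move=> y; rewrite /= in_itv/= andbT => xy; rewrite ler_wpM2r//; exact: normal_pdf_ge0.
Qed.

Lemma normal_left_tail_le (x : R) : x < 0 -> \int[mu]_(y in `]-oo, x]) p y <= s ^+ 2 * p x / - x.
Proof.
move=> x0; rewrite -normal_pdf_even; apply: le_trans (normal_tail_le (- x) _); last by rewrite oppr_gt0.
rewrite /Rintegral -[in leLHS](opprK x) ge0_integration_by_substitutionNy.
- by rewrite (_ : p \o -%R = p)//; apply/funext => y; exact: normal_pdf_even.
- by apply: continuous_subspaceT; exact: continuous_normal_pdf0.
- by move=> y _; exact: normal_pdf_ge0.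
Qed.

Section stein_equation.
Variables (f : R -> R) (K : R).
Hypotheses (cf : continuous f) (fK : forall x, `|f x| <= K).

Let m : R := \int[normal_prob 0 s]_x f x.
Let h x : R := f x - m.
Let q x : R := h x * p x.
Let H x : R := \int[mu]_(t in `]-oo, x]) q t.

Let mf : measurable_fun setT f. Proof. exact: continuous_measurable_fun. Qed.

Let mK : `|m| <= K. Proof. exact: norm_Rintegral_bounded. Qed.

Let hK (x : R) : `|h x| <= K + K.
Proof. by rewrite (le_trans (ler_normB _ _))// lerD. Qed.

Let ch : continuous h.
Proof. by move=> x; apply: cvgB; [exact: cf|exact: cvg_cst]. Qed.

Let cq : continuous q.
Proof. by move=> x; apply: cvgM; [exact: ch|exact: continuous_normal_pdf0]. Qed.

Let qp (x : R) : `|q x| <= (K + K) * p x.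
Proof.
by rewrite normrM (ger0_norm (normal_pdf_ge0 _ _ _)) ler_wpM2r// normal_pdf_ge0.
Qed.

Let iKp (A : set (measurableTypeR R)) : measurable A -> mu.-integrable A (EFin \o (fun x => (K + K) * p x)).
Proof.
move=> mA; have := integrableZl mA (K + K) (integrable_normal_pdfS A mA).
by apply: eq_integrable.
Qed.

Let iq (A : set (measurableTypeR R)) : measurable A -> mu.-integrable A (EFin \o q).
Proof.
move=> mA; apply: le_integrable (iKp A mA) => //.
  by apply/measurable_EFinP/measurable_funTS; exact: continuous_measurable_fun.
by move=> x _ /=; rewrite lee_fin (le_trans (qp x))// ler_norm.
Qed.

Let int_q_le (A : set (measurableTypeR R)) : measurable A ->
  `|\int[mu]_(x in A) q x| <= (K + K) * \int[mu]_(x in A) p x.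
Proof.
move=> mA; apply: (le_trans (le_normr_Rintegral mA (iq A mA))).
rewrite -RintegralZl//; last exact: integrable_normal_pdfS.
apply: le_Rintegral => //; last exact: iKp.
by apply: integrable_norm; exact: iq.
Qed.

Let K0 : 0 <= K. Proof. exact: le_trans (normr_ge0 _) (fK 0). Qed.

Let int_p : \int[mu]_x p x = 1.
Proof. by rewrite /Rintegral integral_normal_pdf. Qed.

Let int_q : \int[mu]_x q x = 0.
Proof.
have ifN : (normal_prob 0 s).-integrable setT (EFin \o f) by exact: (rint_bounded (normal_prob 0 s) f K mf fK).
have mE : m = \int[mu]_x (f x * p x) by rewrite /m /Rintegral integral_normal_prob.
under eq_Rintegral do rewrite /q /h mulrBl.
rewrite RintegralB//.
- rewrite -mE RintegralZl//; last exact: integrable_normal_pdfS.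
  by rewrite int_p mulr1 subrr.
- apply: le_integrable (iKp setT measurableT) => //.
    by apply/measurable_EFinP; apply: measurable_funM => //; exact: measurable_normal_pdf.
  move=> x _ /=; rewrite lee_fin normrM [leRHS]normrM ler_wpM2r//.
  by rewrite (le_trans (fK x))// ger0_norm ?addr_ge0// lerDl.
- have := integrableZl measurableT m (integrable_normal_pdfS setT measurableT).
  by apply: eq_integrable.
Qed.

Let HK (x : R) : `|H x| <= K + K.
Proof.
apply: (le_trans (int_q_le _ (measurable_itv _))).
rewrite -[leRHS]mulr1 -int_p ler_wpM2l ?addr_ge0//.
rewrite /Rintegral fine_le//; last first.
  apply: ge0_subset_integral => //.
  - by apply/measurable_EFinP; exact: measurable_normal_pdf.
  - by move=> y _; rewrite lee_fin normal_pdf_ge0.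
- by apply: integrable_fin_num => //; exact: integrable_normal_pdfS.
- by apply: integrable_fin_num => //; exact: integrable_normal_pdfS.
Qed.

(** [q] has total integral 0, so [H] is also minus its right tail, which is the small one for
    positive [x]. *)
Let Htail (x : R) : H x = - \int[mu]_(t in `[x, +oo[) q t.
Proof.
apply/eqP; rewrite -addr_eq0 -Rintegral_itv_obnd_cbnd; last exact: iq.
rewrite /H -Rintegral_setU//.
- rewrite -int_q; apply/eqP; congr Rintegral; apply/seteqP; split => // y _ /=.
  by rewrite !in_itv/= andbT; case: (leP y x); [left|right].
- by apply: iq; apply: measurableU.
- apply/disj_setPS => y [/=]; rewrite !in_itv/= andbT => yx.
  by rewrite ltNge yx.
Qed.

(** Each side of 0 uses its own tail of [q]; the factor [|x|] cancels the division by [x] in Mills'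
    bound. *)
Let xHK (x : R) : `|x * H x| <= (K + K) * (s ^+ 2 * p x).
Proof.
have s2p : 0 <= s ^+ 2 * p x by rewrite mulr_ge0 ?sqr_ge0 ?normal_pdf_ge0.
have [x0|x0|x0] := ltgtP x 0; last first.
  by rewrite {1}x0 mul0r normr0; apply: mulr_ge0 => //; exact: addr_ge0.
- rewrite normrM gtr0_norm// Htail normrN mulrC -ler_pdivlMr//.
  apply: (le_trans (int_q_le _ (measurable_itv _))).
  by rewrite -mulrA ler_wpM2l ?addr_ge0//; exact: normal_tail_le.
- rewrite normrM ltr0_norm// mulrC -ler_pdivlMr ?oppr_gt0//.
  apply: (le_trans (int_q_le _ (measurable_itv _))).
  by rewrite -mulrA ler_wpM2l ?addr_ge0//; exact: normal_left_tail_le.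
Qed.

Let dH (x : R) : is_derive x 1 H (q x).
Proof.
have xu : x < x + 1 by rewrite ltrDl.
have [d e] := @continuous_FTC1 R q -oo%O x (x + 1) xu (iq _ (measurable_itv _))
  (ltNyr _) (cq x).
by apply: DeriveDef; [exact: d|rewrite -derive1E e].
Qed.

(** As the density satisfies p' = -(x / s^2) p, setting g = H / (s^2 p) reduces Stein's equation to
    H' = q. The derivative [g'] is read off the equation, so its continuity and its bound follow
    from those of [h] and of [x * g x]. *)
Lemma stein_equation : exists g g' : R -> R, exists B : R,
  [/\ forall x : R, is_derive x 1 g (g' x), continuous g',
     forall x, `|g x| <= B, forall x, `|g' x| <= B &
     forall x, s ^+ 2 * g' x - x * g x = f x - m].
Proof.
pose g x := H x / (s ^+ 2 * p x).
pose g' x := (h x + x * g x) / s ^+ 2.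
have s20 : s ^+ 2 != 0 by rewrite expf_neq0.
have s2p (x : R) : 0 < s ^+ 2 * p x by rewrite mulr_gt0 ?normal_pdf_gt0 ?exprn_gt0.
have xgK (x : R) : `|x * g x| <= K + K.
  by rewrite /g mulrA normrM normfV (gtr0_norm (s2p x)) ler_pdivrMr//; exact: xHK.
have dg (x : R) : is_derive x 1 g (g' x).
  have hp := is_derive_normal_pdf x; have hH := dH x.
  have hV : is_derive x 1 (fun x => (s ^+ 2 * p x)^-1) (x / s ^+ 2 / (s ^+ 2 * p x)).
    have nz : s ^+ 2 * p x != 0 by rewrite gt_eqF.
    have hs : is_derive x 1 (fun x => s ^+ 2 * p x) (s ^+ 2 *: (- (x / s ^+ 2) * p x)).
      exact: (is_deriveZ _ hp).
    apply: DeriveDef; first by apply: derivableV => //; have [] := hs.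
    rewrite deriveV//.
    have [_ ->] := hs; rewrite /GRing.scale/=; field.
    by rewrite sn0 gt_eqF// normal_pdf_gt0.
  apply: (is_derive_eq (is_deriveM hH hV)).
  rewrite /GRing.scale/= /g' /g /q; field.
  by rewrite sn0 gt_eqF// normal_pdf_gt0.
(* For [|x| <= 1] the denominator is at least [s ^+ 2 * p 1]; for larger [|x|] the bound on
   [x * g x] is stronger than needed. *)
have gB (x : R) : `|g x| <= (K + K) + (K + K) / (s ^+ 2 * p 1).
  have [x1|x1] := leP `|x| 1.
    apply: (@le_trans _ _ ((K + K) / (s ^+ 2 * p 1))); last by rewrite lerDr addr_ge0.
    rewrite normrM normfV (gtr0_norm (s2p x)) ler_pM ?invr_ge0 ?(ltW (s2p x))//.
    rewrite lef_pV2 ?posrE//; apply: ler_wpM2l; first exact: sqr_ge0.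
    rewrite !normal_pdf0E ler_wpM2l ?normal_peak_ge0// ler_expR.
    rewrite ler_wpM2r ?invr_ge0 ?mulrn_wge0 ?sqr_ge0// lerN2 expr1n.
    by rewrite -[x ^+ 2]real_normK ?num_real// expr_le1.
  apply: (@le_trans _ _ (K + K)); last by rewrite lerDl divr_ge0 ?addr_ge0// ltW.
  by apply: le_trans _ (xgK x); rewrite [leRHS]normrM ler_peMl// ltW.
have g'B (x : R) : `|g' x| <= ((K + K) + (K + K)) / s ^+ 2.
  rewrite normrM normfV (ger0_norm (sqr_ge0 s)) ler_pM2r ?invr_gt0 ?exprn_gt0//.
  by rewrite (le_trans (ler_normD _ _))// lerD.
exists g, g', (Num.max ((K + K) + (K + K) / (s ^+ 2 * p 1)) (((K + K) + (K + K)) / s ^+ 2)).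
split => //.
- move=> x; apply: cvgM; last exact: cvg_cst.
  apply: cvgD; first exact: ch.
  apply: cvgM; first exact: cvg_id.
  by apply: differentiable_continuous; apply/derivable1_diffP; have [] := dg x.
- by move=> x; rewrite le_max gB.
- by move=> x; rewrite le_max g'B orbT.
- by move=> x; rewrite /g' mulrC divfK// addrK.
Qed.

End stein_equation.

End stein_normal.

(** * Uniform continuity on segments and first-order expansion *)

Section real_analysis.
Context {R : realType}.

(** Compactness of the segment makes the radius uniform. Only [x] is confined to the segment; [y]
    may lie outside. *)
Lemma continuous_uniform_segment (f : R -> R) (K e : R) : continuous f -> 0 < e ->
  exists2 r : R, 0 < r & forall x y, `|x| <= K -> `|x - y| <= r -> `|f x - f y| <= e.
Proof.
move=> cf e0.
have /compact_near_coveringP cov : compact (`[- K, K] : set R) by exact: segment_compact.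
have : \forall r \near (0 : R)^'+, `[- K, K] `<=`
    [set x | forall y, `|x - y| <= r -> `|f x - f y| <= e].
  apply: cov => x _.
  have e2 : 0 < e / 2 by rewrite divr_gt0.
  have := cf x; rewrite /continuous_at => /cvgrPdist_le /(_ _ e2) /nbhs_ballP [r /= r0 xr].
  exists (ball x (r / 2), [set t : R | 0 < t < r / 2]) => /=.
    split; first by apply: nbhsx_ballx; rewrite divr_gt0.
    near=> t => /=; apply/andP; split; first by near: t; exact: nbhs_right_gt.
    by near: t; apply: nbhs_right_lt; rewrite divr_gt0.
  move=> [z t] /= [xz /andP[t0 tr]] y zy.
  rewrite [e]splitr -[f z](subrK (f x)) -addrA.
  apply: le_trans (ler_normD _ _) _; apply: lerD.
    rewrite distrC; apply: xr; apply: le_ball xz.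
    by rewrite ler_pdivrMr// ler_peMr ?ltW// ltr1n.
  apply: xr; rewrite /ball/= -[x - y](subrKA z).
  apply: (le_lt_trans (ler_normD _ _)); rewrite [ltRHS]splitr; apply: ltrD => //.
  exact: le_lt_trans tr.
move=> H; near (0 : R)^'+ => r; exists r; first by near: r; exact: nbhs_right_gt.
move=> x y xK; have Hr : `[- K, K] `<=` [set x | forall y, `|x - y| <= r -> `|f x - f y| <= e].
  by near: r.
by apply: Hr; rewrite /= in_itv/= -ler_norml.
Unshelve. all: by end_near. Qed.

(** By the mean value theorem the increment of [g] is [y] times [g'] at an intermediate point, so
    the oscillation of [g'] bounds the remainder. This suits the Stein solution, whose derivative is
    known only to be continuous. *)
Lemma taylor1_le (g g' : R -> R) (B : R) : (forall x : R, is_derive x 1 g (g' x)) ->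
  forall x y : R, (forall t, `|t| <= `|y| -> `|g' (x + t) - g' x| <= B) ->
  `|g (x + y) - g x - y * g' x| <= `|y| * B.
Proof.
move=> dg x y H.
have cg : continuous g.
  by move=> z; apply: differentiable_continuous; apply/derivable1_diffP; have [] := dg z.
have [y0|y0] := leP 0 y.
  have [c] := @MVT_segment R g g' x (x + y) ltac:(by rewrite lerDl) (fun z _ => dg z)
    (continuous_subspaceT cg).
  rewrite in_itv/= => /andP[xc cy] ->.
  rewrite addrAC subrr add0r mulrC -mulrBr normrM ler_wpM2l//.
  rewrite -[c](subrKC x); apply: H; rewrite !ger0_norm ?subr_ge0//.
  by rewrite lerBlDl.
have [c] := @MVT_segment R g g' (x + y) x ltac:(by rewrite gerDl ltW) (fun z _ => dg z)
  (continuous_subspaceT cg).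
rewrite in_itv/= => /andP[xc cy] E.
have -> : g (x + y) - g x - y * g' x = y * (g' c - g' x).
  have -> : g (x + y) - g x = - (g x - g (x + y)) by rewrite opprB.
  by rewrite E; ring.
rewrite normrM ler_wpM2l//.
rewrite -[c](subrKC x); apply: H; rewrite ler0_norm ?subr_le0// (ltr0_norm y0).
by rewrite opprB lerBlDl -lerBlDr opprK.
Qed.

End real_analysis.

(** * Tail probabilities and truncated second moments *)

Section tightness.
Context {R : realType} {d : measure_display} {Omega : measurableType d}
  (P : probability Omega R).
Local Notation rint f := (P.-integrable setT (EFin \o f)).

Lemma measurable_gt (f : Omega -> R) (k : R) : measurable_fun setT f ->
  measurable [set w | k < f w].
Proof.
by move=> mf; rewrite -[X in measurable X]setTI; apply: measurable_fun_ltr.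
Qed.

Definition exceed (f : Omega -> R) (k : R) : R := fine (P [set w | k < `|f w|]).

Lemma indic_exceed (f : Omega -> R) (k : R) :
  (fun w => (k < `|f w|)%R%:R : R) = \1_[set w | k < `|f w|].
Proof.
apply/funext => w; rewrite indicE; have [kf|kf] := boolP (k < `|f w|).
  by rewrite mem_set.
by rewrite memNset//; exact/negP.
Qed.

Lemma measurable_gt_fun (f : Omega -> R) (k : R) : measurable_fun setT f ->
  measurable_fun setT (fun w => (k < `|f w|)%R%:R : R).
Proof.
move=> mf; rewrite indic_exceed; apply: measurable_indic; apply: measurable_gt.
exact: measurableT_comp.
Qed.

Lemma exceedE (f : Omega -> R) (k : R) : measurable_fun setT f ->
  exceed f k = \int[P]_w (k < `|f w|)%R%:R.
Proof.
move=> mf; rewrite indic_exceed /exceed -[X in P X]setIT -integral_indic//.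
by apply: measurable_gt; exact: measurableT_comp.
Qed.

Lemma exceed_ge0 (f : Omega -> R) (k : R) : 0 <= exceed f k.
Proof. exact: fine_ge0. Qed.

(** Lindeberg's condition for one square-integrable mark: dominated convergence along integer
    thresholds, then monotonicity in the threshold. *)
Lemma tail_second_moment (X : Omega -> R) : measurable_fun setT X ->
  rint (fun w => X w ^+ 2) -> forall e : R, 0 < e -> exists t : R, forall u, t <= u ->
    \int[P]_w (X w ^+ 2 * (u < `|X w|)%R%:R) <= e.
Proof.
move=> mX iX e e0.
pose f n w : \bar R := (X w ^+ 2 * (n%:R < `|X w|)%R%:R)%:E.
have mf n : measurable_fun setT (f n).
  apply/measurable_EFinP; apply: measurable_funM; first exact: measurable_funX.
  exact: measurable_gt_fun.
have fb n w : (`|f n w| <= (X w ^+ 2)%:E)%E.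
  rewrite /f/= lee_fin normrM (ger0_norm (sqr_ge0 _)) ler_piMr ?sqr_ge0//.
  by case: (_ < _); rewrite ?normr1 ?normr0.
have f0 w : f ^~ w @ \oo --> 0%E.
  apply: cvg_near_cst; near=> n; rewrite /f.
  have Xn : `|X w| <= n%:R by near: n; exact: nbhs_infty_ger.
  by rewrite ltNge Xn mulr0.
have [_ _ /=] := @dominated_convergence _ Omega R P setT measurableT f (cst 0%E)
   (fun w => (X w ^+ 2)%:E) mf (measurable_cst _) (aeW P (fun w _ => f0 w)) iX
   (aeW P (fun w n _ => fb n w)).
rewrite integral_cst// mul0e => /fine_cvgP[_ /cvgrPdist_le /(_ _ e0)[N _ HN]].
exists N%:R => u Nu.
have := HN N (leqnn N); rewrite /= sub0r normrN; apply: le_trans.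
apply: le_trans _ (ler_norm _); apply: le_Rintegral => //.
- apply: (rint_le _ _ (fun w => X w ^+ 2)) => //.
    by apply: measurable_funM; [exact: measurable_funX|exact: measurable_gt_fun].
  move=> w; rewrite normrM (ger0_norm (sqr_ge0 _)) ler_piMr ?sqr_ge0//.
  by case: (_ < _); rewrite ?normr1 ?normr0.
- apply: (rint_le _ _ (fun w => X w ^+ 2)) => //.
    by apply: measurable_funM; [exact: measurable_funX|exact: measurable_gt_fun].
  by move=> w; have := fb N w; rewrite lee_fin.
- move=> w _; rewrite ler_wpM2l ?sqr_ge0// ler_nat.
  by have [uX|//] := boolP (u < `|X w|); rewrite (le_lt_trans Nu uX).
Unshelve. all: by end_near. Qed.

End tightness.

(** * Central limit theorem for compound Poisson sums *)

Section compound_poisson_clt.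
Context {R : realType} {d : measure_display} {Omega : measurableType d}
  (P : probability Omega R).
Local Notation rint f := (P.-integrable setT (EFin \o f)).
Context {J : Type} (js : seq J) (kappa : J -> R) (X : J -> Omega -> R) (a : R)
  (C : Omega -> R).
Hypothesis kappa_ge0 : forall j, 0 <= kappa j.
Hypothesis Xm : forall j, measurable_fun setT (X j).
Hypothesis iX2 : forall j, rint (fun w => X j w ^+ 2).
Hypothesis a_gt0 : 0 < a.
Hypothesis iC : rint C.
(* Mecke's identity is all that is assumed of the compound Poisson sum [C]. *)
Hypothesis size_bias : forall (G : R -> R) (K : R), measurable_fun setT G ->
  (forall x, `|G x| <= K) -> \int[P]_w (C w * G (C w)) =
  a * \sum_(j <- js) kappa j * \int[P]_w' (X j w' * \int[P]_w G (C w + X j w')).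

Definition cp_mean : R := \sum_(j <- js) kappa j * \int[P]_w X j w.
(** A compound Poisson variance is the rate times the second moment of the mark, the mark not being
    centred. *)
Definition cp_var : R := \sum_(j <- js) kappa j * \int[P]_w (X j w ^+ 2).
Definition cp_std (w : Omega) : R := (C w - a * cp_mean) / Num.sqrt a.
Local Notation W := cp_std.

Lemma rint_of_sqr j : rint (X j).
Proof.
apply: (rint_le _ _ (fun w => 1 + X j w ^+ 2)) => //; last exact: rintD (rint_cst _ _) (iX2 j).
move=> w; rewrite -[X j w ^+ 2]real_normK ?num_real//.
by have := normr_ge0 (X j w); nra.
Qed.

Let sqrta_gt0 : 0 < Num.sqrt a. Proof. by rewrite sqrtr_gt0. Qed.

Let mC : measurable_fun setT C. Proof. exact: rint_measurable iC. Qed.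

Lemma measurable_cp_std : measurable_fun setT W.
Proof. by apply: measurable_funM => //; apply: measurable_funB. Qed.

Lemma rint_cp_std : rint W.
Proof.
have := rintZl _ (Num.sqrt a)^-1 _ (rintB _ _ _ iC (rint_cst _ (a * cp_mean))).
by apply: eq_integrable => // w _; rewrite /= mulrC.
Qed.

Lemma measurable_cp_shift j (g : R -> R) (B : R) : measurable_fun setT g ->
  (forall x, `|g x| <= B) ->
  measurable_fun setT (fun w' => \int[P]_w g (W w + X j w' / Num.sqrt a)).
Proof.
move=> mg gB.
apply: (measurable_expectation_shift P (fun _ : unit => W)
  (fun _ w' => X j w' / Num.sqrt a) (fun v => g (v tt)) B) => //.
- by move=> _; exact: measurable_cp_std.
- by move=> _; apply: measurable_funM.
- by move=> d' T u mu; apply: (measurableT_comp mg).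
Qed.

(** This is [size_bias] for [g] composed with the standardisation; subtracting the mean
    [a * cp_mean] turns the shifted expectation of [g] into an increment. *)
Lemma stein_identity (g : R -> R) (B : R) : measurable_fun setT g ->
  (forall x, `|g x| <= B) ->
  \int[P]_w (W w * g (W w)) = Num.sqrt a * \sum_(j <- js) kappa j *
     \int[P]_w' (X j w' * (\int[P]_w g (W w + X j w' / Num.sqrt a) - \int[P]_w g (W w))).
Proof.
move=> mg gB.
pose G c := g ((c - a * cp_mean) / Num.sqrt a).
have mG : measurable_fun setT G.
  apply: (measurableT_comp mg); apply: measurable_funM => //.
  exact: measurable_funB.
have GB x : `|G x| <= B by exact: gB.
have iG : rint (fun w => G (C w)).
  by apply: (rint_bounded _ _ B) => //; apply: (measurableT_comp mG).
have iCG : rint (fun w => C w * G (C w)).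
  by apply: (rintM _ _ _ B) => //; apply: (measurableT_comp mG).
have -> : \int[P]_w (W w * g (W w)) =
    (Num.sqrt a)^-1 * (\int[P]_w (C w * G (C w)) - a * cp_mean * \int[P]_w G (C w)).
  rewrite -RintegralZl// -RintegralB//; last by apply: rintZl.
  rewrite -RintegralZl//; last by apply: rintB => //; exact: rintZl.
  by apply: eq_Rintegral => w _; rewrite /cp_std -/(G (C w)); ring.
rewrite (size_bias G B mG GB) -mulrA -mulrBr mulrA.
have -> : (Num.sqrt a)^-1 * a = Num.sqrt a.
  by rewrite -{2}(sqr_sqrtr (ltW a_gt0)) expr2 mulKf// gt_eqF.
congr (_ * _); rewrite /cp_mean mulr_suml -sumrB; apply: eq_bigr => j _.
rewrite -mulrA -mulrBr; congr (_ * _).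
under [RHS]eq_Rintegral do rewrite mulrBr.
have GE w' : \int[P]_w G (C w + X j w') = \int[P]_w g (W w + X j w' / Num.sqrt a).
  by apply: eq_Rintegral => w _; rewrite /G /cp_std; congr g; rewrite -mulrDl addrAC.
under eq_Rintegral do rewrite GE.
rewrite RintegralB//.
- by rewrite RintegralZr//; exact: rint_of_sqr.
- apply: (rintM _ _ _ B (rint_of_sqr j)); first exact: measurable_cp_shift gB.
  move=> w'; apply: norm_Rintegral_bounded => //; apply: (measurableT_comp mg).
  by apply: measurable_funD => //; exact: measurable_cp_std.
- by apply: (rintM _ _ _ `|\int[P]_w g (W w)| (rint_of_sqr j)).
Qed.

(** Chebyshev's inequality drawn from the Stein identity. That identity accepts bounded tests, so
    the identity function is clipped to [-k, k]: the clipped [g] is 1-Lipschitz, which bounds the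
    increments by the jumps, and [k ^+ 2] times the indicator of [|x| > k] is at most [x * g x]. *)
Lemma cp_std_tight (k : R) : 0 < k -> k ^+ 2 * exceed P W k <= cp_var.
Proof.
move=> k0.
pose g x := Num.max (- k) (Num.min k x).
have mg : measurable_fun setT g.
  apply: measurable_maxr => //; exact: measurable_minr.
have gk x : `|g x| <= k.
  rewrite /g ler_norml le_max lexx/= ge_max ge_min lexx/= andbT.
  by rewrite (le_trans _ (ltW k0))// oppr_le0 ltW.
have gE x : [\/ (k < x) && (g x == k), (x < - k) && (g x == - k) | (- k <= x <= k) && (g x == x)].
  have [kx|xk] := ltP k x.
    by apply: Or31; rewrite /g min_l ?ltW// max_r ?eqxx//; lra.
  have [kx|kx] := ltP x (- k).
    by apply: Or32; rewrite /g min_r// max_l ?eqxx// ltW.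
  by apply: Or33; rewrite /g min_r// max_r ?eqxx.
have glip x y : `|g (x + y) - g x| <= `|y|.
  have y1 := ler_norm y; have := ler_norm (- y); rewrite normrN => y2.
  rewrite ler_norml; apply/andP.
  case: (gE (x + y)) => /andP[h1 /eqP ->]; case: (gE x) => /andP[h2 /eqP ->]; split; lra.
have gW x : k ^+ 2 * (k < `|x|)%R%:R <= x * g x.
  have [kx|xk] := ltP k `|x|; last first.
    rewrite mulr0; move: xk; rewrite ler_norml => /andP[xk1 xk2].
    by case: (gE x) => /andP[h2 /eqP ->]; nra.
  rewrite mulr1; move: kx; rewrite ltr_normr => /orP[kx|kx];
  by case: (gE x) => /andP[h2 /eqP ->]; nra.
have mW := measurable_cp_std.
have mgW : measurable_fun setT (fun w => g (W w)) by apply: (measurableT_comp mg).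
rewrite exceedE// -RintegralZl//; last first.
  apply: (rint_bounded _ _ 1); first exact: measurable_gt_fun.
  by move=> w; case: (_ < _); rewrite ?normr1 ?normr0.
apply: (@le_trans _ _ (\int[P]_w (W w * g (W w)))).
  apply: le_Rintegral => //.
  - apply: (rint_bounded _ _ (k ^+ 2)).
      by apply: measurable_funM => //; exact: measurable_gt_fun.
    move=> w; rewrite normrM (ger0_norm (sqr_ge0 _)) ler_piMr ?sqr_ge0//.
    by case: (_ < _); rewrite ?normr1 ?normr0.
  - exact: (rintM _ _ _ k rint_cp_std).
rewrite (stein_identity _ _ mg gk) /cp_var mulr_sumr; apply: ler_sum => j _.
rewrite mulrCA ler_wpM2l//.
have mphi := measurable_cp_shift j _ _ mg gk.
have mgWy w' : measurable_fun setT (fun w => g (W w + X j w' / Num.sqrt a)).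
  by apply: (measurableT_comp mg); apply: measurable_funD.
have iphi : rint (fun w' => X j w' *
    (\int[P]_w g (W w + X j w' / Num.sqrt a) - \int[P]_w g (W w))).
  apply: (rintM _ _ _ (k + k) (rint_of_sqr j)); first exact: measurable_funB.
  move=> w'; rewrite (le_trans (ler_normB _ _))// lerD//; exact: norm_Rintegral_bounded.
rewrite -RintegralZl//; apply: le_Rintegral => //; first exact: rintZl.
move=> w' _; rewrite mulrCA.
apply: (le_trans (ler_norm _)); rewrite normrM -[leRHS]real_normK ?num_real// expr2.
rewrite ler_wpM2l// normrM gtr0_norm// mulrC -ler_pdivlMr//.
rewrite -RintegralB//; last 2 first.
- exact: (rint_bounded _ _ k).
- exact: (rint_bounded _ _ k).
rewrite -[leRHS](Rintegral_cstT P); apply: norm_Rintegral_le.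
- by apply: rintB; exact: (rint_bounded _ _ k).
- exact: rint_cst.
- by move=> w; rewrite (le_trans (glip _ _))// normrM normfV (gtr0_norm sqrta_gt0).
Qed.

(** Lindeberg's sum of truncated second moments. *)
Definition cp_tail (t : R) : R :=
  \sum_(j <- js) kappa j * \int[P]_w (X j w ^+ 2 * (t < `|X j w|)%R%:R).

(** The increments in the Stein identity are expanded to first order, and the linear part gives
    [cp_var] times the mean of [g']. The oscillation of [g'] is at most [e] if [|W| <= k] and the
    jump [X j / sqrt a] has size at most [r], and at most [B + B] otherwise; the two exceptions give
    the tail of [W] and Lindeberg's sum. *)
Lemma stein_bound (g g' : R -> R) (B e k r : R) :
  (forall x : R, is_derive x 1 g (g' x)) -> continuous g' ->
  (forall x, `|g x| <= B) -> (forall x, `|g' x| <= B) ->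
  (forall x y, `|x| <= k -> `|x - y| <= r -> `|g' x - g' y| <= e) -> 0 <= e ->
  `|\int[P]_w (W w * g (W w)) - cp_var * \int[P]_w g' (W w)|
    <= cp_var * (e + (B + B) * exceed P W k) + (B + B) * cp_tail (r * Num.sqrt a).
Proof.
move=> dg cg' gB g'B unif e0.
have B0 : 0 <= B by exact: le_trans (normr_ge0 _) (gB 0).
have cg : continuous g.
  by move=> z; apply: differentiable_continuous; apply/derivable1_diffP; have [] := dg z.
have mg : measurable_fun setT g by exact: continuous_measurable_fun.
have mg' : measurable_fun setT g' by exact: continuous_measurable_fun.
have mW := measurable_cp_std.
pose y j w' := X j w' / Num.sqrt a.
have my j : measurable_fun setT (y j) by exact: measurable_funM.
have mgW : measurable_fun setT (fun w => g (W w)) by apply: (measurableT_comp mg).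
have mg'W : measurable_fun setT (fun w => g' (W w)) by apply: (measurableT_comp mg').
have mgWy j w' : measurable_fun setT (fun w => g (W w + y j w')).
  by apply: (measurableT_comp mg); apply: measurable_funD.
have igW : rint (fun w => g (W w)) by exact: (rint_bounded _ _ B).
have ig'W : rint (fun w => g' (W w)) by exact: (rint_bounded _ _ B).
have igWy j w' : rint (fun w => g (W w + y j w')) by exact: (rint_bounded _ _ B).
pose m := \int[P]_w g' (W w).
pose phi j w' := \int[P]_w g (W w + y j w') - \int[P]_w g (W w).
have mphi j : measurable_fun setT (phi j).
  by apply: measurable_funB => //; exact: measurable_cp_shift gB.
have phiB j w' : `|phi j w'| <= B + B.
  by rewrite (le_trans (ler_normB _ _))// lerD//; exact: norm_Rintegral_bounded.
have iXphi j : rint (fun w' => X j w' * phi j w').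
  exact: (rintM _ _ _ (B + B) (rint_of_sqr j)).
pose L j w' := e + (B + B) * exceed P W k + (B + B) * (r * Num.sqrt a < `|X j w'|)%R%:R.
have key j w' : `|phi j w' - y j w' * m| <= `|y j w'| * L j w'.
  rewrite /phi /m -RintegralZl// -!RintegralB//; last 2 first.
  - exact: rintB.
  - exact: rintZl.
  pose b w := e + (B + B) * (k < `|W w|)%R%:R + (B + B) * (r * Num.sqrt a < `|X j w'|)%R%:R.
  have ib : rint (fun w => (k < `|W w|)%R%:R : R).
    apply: (rint_bounded _ _ 1); first exact: measurable_gt_fun.
    by move=> w; case: (_ < _); rewrite ?normr1 ?normr0.
  have ib2 : rint b.
    by apply: rintD (rint_cst _ _); apply: rintD (rint_cst _ _) _; exact: rintZl.
  have -> : `|y j w'| * L j w' = \int[P]_w (`|y j w'| * b w).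
    rewrite RintegralZl//; congr (_ * _); rewrite /b /L exceedE//.
    rewrite RintegralD//; last 2 first.
    - by apply: rintD (rint_cst _ _) _; exact: rintZl.
    - exact: rint_cst.
    rewrite Rintegral_cstT RintegralD//; last 2 first.
    - exact: rint_cst.
    - exact: rintZl.
    by rewrite Rintegral_cstT RintegralZl.
  apply: norm_Rintegral_le.
  - by apply: rintB; [exact: rintB|exact: rintZl].
  - exact: rintZl.
  - move=> w; apply: taylor1_le => // t ty; rewrite /b distrC.
    have nn1 : 0 <= (B + B) * (k < `|W w|)%R%:R by rewrite mulr_ge0 ?addr_ge0.
    have nn2 : 0 <= (B + B) * (r * Num.sqrt a < `|X j w'|)%R%:R by rewrite mulr_ge0 ?addr_ge0.
    have g'2 : `|g' (W w) - g' (W w + t)| <= B + B.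
      by rewrite (le_trans (ler_normB _ _))// lerD.
    have [kW|Wk] := ltP k `|W w|; first by rewrite mulr1; lra.
    have [rX|Xr] := ltP (r * Num.sqrt a) `|X j w'|; first by rewrite mulr0 mulr1; lra.
    rewrite !mulr0 !addr0; apply: unif => //.
    rewrite opprD addrA subrr add0r normrN (le_trans ty)//.
    by rewrite /y normrM normfV (gtr0_norm sqrta_gt0) ler_pdivrMr.
rewrite (stein_identity _ _ mg gB) /cp_var mulr_suml mulr_sumr -sumrB.
rewrite mulr_suml /cp_tail mulr_sumr -big_split/=.
apply: (le_trans (ler_norm_sum _ _ _)); apply: ler_sum => j _.
have iX2m : rint (fun w' => X j w' ^+ 2 * m) by exact: (rintM _ _ _ `|m|).
have itail : rint (fun w' => X j w' ^+ 2 * (r * Num.sqrt a < `|X j w'|)%R%:R).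
  apply: (rintM _ _ _ 1) => //; first exact: measurable_gt_fun.
  by move=> w; case: (_ < _); rewrite ?normr1 ?normr0.
have -> : Num.sqrt a * (kappa j * \int[P]_w' (X j w' * phi j w')) -
    kappa j * \int[P]_w (X j w ^+ 2) * m =
    kappa j * \int[P]_w' (Num.sqrt a * X j w' * (phi j w' - y j w' * m)).
  rewrite mulrCA -mulrA -mulrBr; congr (_ * _).
  rewrite -RintegralZl// -RintegralZr// -RintegralB//; last exact: rintZl.
  apply: eq_Rintegral => w' _; rewrite /y; field; exact: lt0r_neq0.
rewrite normrM (ger0_norm (kappa_ge0 j)).
have -> : kappa j * \int[P]_w (X j w ^+ 2) * (e + (B + B) * exceed P W k) +
  (B + B) * (kappa j * \int[P]_w (X j w ^+ 2 * (r * Num.sqrt a < `|X j w|)%R%:R)) =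
  kappa j * \int[P]_w (X j w ^+ 2 * L j w).
  rewrite mulrCA -mulrA -mulrDr; congr (_ * _).
  rewrite -RintegralZr// -RintegralZl// -RintegralD//; last 2 first.
  - by apply: (rintM _ _ _ `|e + (B + B) * exceed P W k|).
  - exact: rintZl.
  by apply: eq_Rintegral => w _; rewrite /L [RHS]mulrDr [X in _ = _ + X]mulrCA.
rewrite ler_wpM2l//; apply: norm_Rintegral_le.
- have := rintB _ _ _ (rintZl _ (Num.sqrt a) _ (iXphi j)) iX2m.
  apply: eq_integrable => // w' _ /=; congr EFin; rewrite /y; field; exact: lt0r_neq0.
- have := rintD _ _ _ (rintM _ _ (fun=> e + (B + B) * exceed P W k) _ (iX2 j) (measurable_cst _) (fun=> lexx _))
     (rintZl _ (B + B) _ itail).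
  by apply: eq_integrable => // w' _ /=; congr EFin; rewrite /L [RHS]mulrDr [X in _ = _ + X]mulrCA.
- move=> w'; rewrite normrM (normrM (Num.sqrt a)) (gtr0_norm sqrta_gt0).
  have -> : X j w' ^+ 2 * L j w' = Num.sqrt a * `|X j w'| * (`|y j w'| * L j w').
    rewrite /y normrM normfV (gtr0_norm sqrta_gt0) -[X j w' ^+ 2]real_normK ?num_real//.
    by field; exact: lt0r_neq0.
  by rewrite ler_wpM2l// mulr_ge0// ltW.
Qed.

End compound_poisson_clt.

(** * Convergence in law through real-valued integrals *)

Section convergence_in_law.
Context {R : realType} {d : measure_display} {Omega : measurableType d}
  (P : probability Omega R).
Local Notation rint f := (P.-integrable setT (EFin \o f)).

Lemma cvg_in_lawP (X : R -> Omega -> R) (mu : probability (measurableTypeR R) R) :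
  (forall a, 0 < a -> measurable_fun setT (X a)) ->
  cvg_in_law P X mu <->
  forall f : R -> R, continuous f -> (exists K : R, forall x, `|f x| <= K) ->
    forall e : R, 0 < e -> \forall a \near +oo,
      `|\int[P]_w f (X a w) - \int[mu]_x f x| <= e.
Proof.
move=> mX.
have E f : continuous f -> (exists K : R, forall x, `|f x| <= K) ->
    (forall a, 0 < a -> (\int[P]_w (f (X a w))%:E = (\int[P]_w f (X a w))%:E)%E) /\
    (\int[mu]_x (f x)%:E = (\int[mu]_x f x)%:E)%E.
  move=> cf [K fK]; have mf : measurable_fun setT f by exact: continuous_measurable_fun.
  split; last by rewrite EFin_Rintegral//; exact: (rint_bounded _ _ K).
  move=> a a0; rewrite EFin_Rintegral//; apply: (rint_bounded _ _ K) => //.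
  by apply: (measurableT_comp mf); exact: mX.
split=> H f cf bf; have [E1 E2] := E f cf bf.
- move=> e e0; have := H f cf bf; rewrite E2 => /fine_cvgP[_ /cvgrPdistC_le].
  exact.
- rewrite E2; apply: (@cvg_trans _ ((fun a => (\int[P]_w f (X a w))%:E) @ +oo)).
    apply: near_eq_cvg; near=> a; rewrite E1//; near: a; exact: nbhs_pinfty_gt.
  apply: cvg_EFin; first exact: nearW.
  apply/cvgrPdistC_le => e e0; exact: H.
Unshelve. all: by end_near. Qed.

End convergence_in_law.

Section clt.
Context {R : realType} {d : measure_display} {Omega : measurableType d}
  (P : probability Omega R).
Local Notation rint f := (P.-integrable setT (EFin \o f)).
Context {J : Type} (js : seq J) (kappa : J -> R) (X : J -> Omega -> R).
Hypothesis kappa_ge0 : forall j, 0 <= kappa j.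
Hypothesis Xm : forall j, measurable_fun setT (X j).
Hypothesis iX2 : forall j, rint (fun w => X j w ^+ 2).

Lemma cp_tail_cvg0 (e : R) : 0 < e -> exists t : R, forall u, t <= u ->
  cp_tail P js kappa X u <= e.
Proof.
rewrite /cp_tail; elim: js e => [|j s IH] e e0.
  by exists 0 => u _; rewrite big_nil ltW.
have e20 : 0 < e / 2 by rewrite divr_gt0.
have [t Ht] := IH _ e20.
(* The added 1 keeps the divisor positive when [kappa j] is 0. *)
have ek : 0 < e / 2 / (kappa j + 1) by rewrite divr_gt0// ltr_wpDl.
have [t' Ht'] := tail_second_moment P (X j) (Xm j) (iX2 j) _ ek.
exists (Num.max t t') => u; rewrite ge_max => /andP[tu t'u].
rewrite big_cons [leRHS]splitr lerD ?Ht//.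
apply: (@le_trans _ _ (kappa j * (e / 2 / (kappa j + 1)))); first by rewrite ler_wpM2l ?Ht'.
rewrite mulrCA ler_piMr ?ltW// ltr_pdivrMr ?mul1r ?ltrDl//.
by rewrite ltr_wpDl.
Qed.

Context (C : R -> Omega -> R).
Hypothesis iC : forall a, 0 < a -> rint (C a).
Hypothesis size_bias : forall a, 0 < a -> forall (G : R -> R) (K : R),
  measurable_fun setT G -> (forall x, `|G x| <= K) ->
  \int[P]_w (C a w * G (C a w)) =
  a * \sum_(j <- js) kappa j * \int[P]_w' (X j w' * \int[P]_w G (C a w + X j w')).
Local Notation V := (cp_var P js kappa X).
Local Notation W := (fun a => cp_std P js kappa X a (C a)).

Theorem compound_poisson_clt : 0 < V -> cvg_in_law P W (normal_prob 0 (Num.sqrt V)).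
Proof.
move=> V0; have s0 : 0 < Num.sqrt V by rewrite sqrtr_gt0.
have mW a : 0 < a -> measurable_fun setT (W a).
  by move=> a0; apply: measurable_cp_std; exact: iC.
apply/cvg_in_lawP => // f cf [K fK] e e0.
have [g [g' [B [dg cg' gB g'B steq]]]] := stein_equation (Num.sqrt V) s0 f K cf fK.
rewrite sqr_sqrtr ?(ltW V0)// in steq.
have B0 : 0 <= B by exact: le_trans (normr_ge0 _) (gB 0).
(* Since k >= 1, the bound k^2 P(|W| > k) <= V gives k P(|W| > k) <= V, and this [k] makes the
   exceptional term 2 B V P(|W| > k) at most [e / 4]. The tolerances [e / (4 * V)] and
   [e / (8 * (B + 1))] bound the oscillation term and Lindeberg's sum by [e / 4] each. *)
pose k := 1 + 8 * (B * V ^+ 2) / e.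
have k1 : 1 <= k by rewrite lerDl divr_ge0 ?(ltW e0)// mulr_ge0// mulr_ge0// sqr_ge0.
have k0 : 0 < k by exact: lt_le_trans k1.
have e1 : 0 < e / (4 * V) by rewrite divr_gt0// mulr_gt0.
have [r r0 unif] := continuous_uniform_segment g' k _ cg' e1.
have e2 : 0 < e / (8 * (B + 1)) by rewrite divr_gt0// mulr_gt0// ltr_wpDl.
have [t Ht] := cp_tail_cvg0 _ e2.
(* For large [a] the truncation level [r * sqrt a] passes the threshold [t] of Lindeberg's sum. *)
have tr : \forall a \near +oo, t / r <= Num.sqrt a.
  near=> a; apply: (@le_trans _ _ `|t / r|); first exact: ler_norm.
  rewrite -[leLHS]ger0_norm// -sqrtr_sqr ler_sqrt; near: a; exact: nbhs_pinfty_ge.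
near=> a.
have a0 : 0 < a by near: a; exact: nbhs_pinfty_gt.
have ta : t <= r * Num.sqrt a by rewrite mulrC -ler_pdivrMr//; near: a.
set m := \int[normal_prob 0 (Num.sqrt V)]_x f x.
have mf : measurable_fun setT f by exact: continuous_measurable_fun.
have mg : measurable_fun setT g.
  apply: continuous_measurable_fun => z.
  by apply: differentiable_continuous; apply/derivable1_diffP; have [] := dg z.
have mg' : measurable_fun setT g' by exact: continuous_measurable_fun.
have ifW : rint (fun w => f (W a w)).
  by apply: (rint_bounded _ _ K) => //; apply: (measurableT_comp mf); exact: mW.
have igW : rint (fun w => W a w * g (W a w)).
  apply: (rintM _ _ _ B) => //; last by apply: (measurableT_comp mg); exact: mW.
  by apply: rint_cp_std; exact: iC.
have ig'W : rint (fun w => g' (W a w)).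
  by apply: (rint_bounded _ _ B) => //; apply: (measurableT_comp mg'); exact: mW.
(* Stein's equation evaluated at [W a] and integrated, with the sign reversed. *)
have -> : \int[P]_w f (W a w) - m =
    - (\int[P]_w (W a w * g (W a w)) - V * \int[P]_w g' (W a w)).
  rewrite opprB -RintegralZl// -RintegralB//; last exact: rintZl.
  transitivity (\int[P]_w (f (W a w) - m)).
    by rewrite RintegralB ?Rintegral_cstT//; exact: rint_cst.
  by apply: eq_Rintegral => w _; rewrite -steq.
rewrite normrN.
apply: (le_trans (stein_bound P js kappa X a (C a) kappa_ge0 Xm iX2 a0 (iC a a0)
  (size_bias a a0) g g' B (e / (4 * V)) k r dg cg' gB g'B unif (ltW e1))).
have ht := Ht _ ta.
have hx := cp_std_tight P js kappa X a (C a) kappa_ge0 Xm iX2 a0 (iC a a0) (size_bias a a0) k k0.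
set x := exceed _ _ _ in hx *.
set T := cp_tail _ _ _ _ _ in ht *.
have -> : V * (e / (4 * V) + (B + B) * x) + (B + B) * T = e / 4 + 2 * B * V * x + 2 * B * T.
  by field; exact: lt0r_neq0.
have h1 : 2 * B * T <= e / 4.
  apply: (@le_trans _ _ (2 * B * (e / (8 * (B + 1))))); first by rewrite ler_wpM2l// mulr_ge0.
  rewrite mulrA ler_pdivrMr ?mulr_gt0 ?ltr_wpDl//; nra.
have h2 : 2 * B * V * x <= e / 4.
  have x0 : 0 <= x by exact: exceed_ge0.
  have kx : k * x <= V by apply: le_trans hx; rewrite ler_wpM2r// expr2 ler_peMl// ltW.
  have : (8 * (B * V ^+ 2) / e) * x <= V.
    by apply: le_trans kx; rewrite ler_wpM2r// lerDr.
  rewrite mulrAC ler_pdivrMr// => h.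
  have : (8 * B * V * x) * V <= e * V by rewrite (mulrC e) -(mulrA _ x) (mulrC x); nra.
  rewrite ler_pM2r//; lra.
lra.
Unshelve. all: by end_near. Qed.

End clt.

(** Inversion is continuous off 0; the point 0, where the inverse is 0 by convention, is split off
    as a measurable singleton. *)
Lemma measurable_invr {R : realType} : measurable_fun setT (@GRing.inv R).
Proof.
have -> : [set: R] = [set x | x != 0] `|` [set 0].
  apply/seteqP; split => // x _ /=; case: (eqVneq x 0) => [->|]; first by right.
  by left.
have o : open [set x : R | x != 0] by exact: open_neq.
apply/measurable_funU => //; first exact: open_measurable.
split.
  apply: open_continuous_measurable_fun => // x; rewrite inE/= => x0.
  exact: inv_continuous.
exact: measurable_fun_set1.
Qed.

(** * Slutsky calculus *)

Section convergence_in_probability.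
Context {R : realType} {d : measure_display} {Omega : measurableType d}
  (P : probability Omega R).
Local Notation rint f := (P.-integrable setT (EFin \o f)).

(** Limits at +oo see positive [a] only, and claim counts are random variables only at nonnegative
    times. *)
Definition measurable_family (X : R -> Omega -> R) :=
  forall a, 0 < a -> measurable_fun setT (X a).

Definition tight (X : R -> Omega -> R) := forall e : R, 0 < e ->
  exists2 k : R, 0 < k & \forall a \near +oo, exceed P (X a) k <= e.

Definition cvg_prob0 (X : R -> Omega -> R) := forall k : R, 0 < k ->
  forall e : R, 0 < e -> \forall a \near +oo, exceed P (X a) k <= e.

(** Union bound: where [f] exceeds [k], either [g] exceeds [k1] or [h] exceeds [k2]. The rules for
    sums, products, scaling and inverses are pointwise implications fed to it. *)
Lemma exceed_le2 (f g h : Omega -> R) (k k1 k2 : R) :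
  measurable_fun setT f -> measurable_fun setT g -> measurable_fun setT h ->
  (forall w, `|g w| <= k1 -> `|h w| <= k2 -> `|f w| <= k) ->
  exceed P f k <= exceed P g k1 + exceed P h k2.
Proof.
move=> mf mg mh H; rewrite !exceedE//.
have rb (u : Omega -> R) l : measurable_fun setT u -> rint (fun w => (l < `|u w|)%R%:R : R).
  move=> mu; apply: (rint_bounded _ _ 1); first exact: measurable_gt_fun.
  by move=> w; case: (_ < _); rewrite ?normr1 ?normr0.
rewrite -RintegralD; [|exact: measurableT|exact: rb|exact: rb].
apply: le_Rintegral; [exact: measurableT|exact: rb|by apply: rintD; exact: rb|].
move=> w _; have [kf|//] := ltP k `|f w|; last by rewrite addr_ge0.
have [gk|gk] := ltP k1 `|g w|; first by rewrite lerDl.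
have [hk|hk] := ltP k2 `|h w|; first by rewrite lerDr.
by have := H w gk hk; rewrite leNgt kf.
Qed.

Lemma exceed_le1f (f g : Omega -> R) (k k1 : R) :
  measurable_fun setT f -> measurable_fun setT g ->
  (forall w, `|g w| <= k1 -> `|f w| <= k) -> exceed P f k <= exceed P g k1.
Proof.
move=> mf mg H; rewrite -[leRHS]addr0.
have -> : 0 = exceed P (fun _ : Omega => 0) 0 :> R.
  by rewrite exceedE//; under eq_Rintegral do rewrite normr0 ltxx; rewrite Rintegral_cstT.
by apply: exceed_le2 => // w gk _; exact: H.
Qed.

Lemma tight_cst (c : R) : tight (fun _ _ => c).
Proof.
move=> e e0; exists (`|c| + 1); first by rewrite ltr_wpDl.
near=> a; rewrite exceedE//; under eq_Rintegral do rewrite ltNge lerDl ler01.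
by rewrite Rintegral_cstT ltW.
Unshelve. all: by end_near. Qed.

Lemma cvg_prob0_tight X : cvg_prob0 X -> tight X.
Proof. by move=> X0 e e0; exists 1 => //; exact: X0. Qed.

Lemma cvg_prob0D X Y : measurable_family X -> measurable_family Y ->
  cvg_prob0 X -> cvg_prob0 Y -> cvg_prob0 (fun a w => X a w + Y a w).
Proof.
move=> mX mY X0 Y0 k k0 e e0.
have k2 : 0 < k / 2 by rewrite divr_gt0.
have e2 : 0 < e / 2 by rewrite divr_gt0.
near=> a; have a0 : 0 < a by near: a; exact: nbhs_pinfty_gt.
rewrite [leRHS]splitr; apply: (@le_trans _ _ (exceed P (X a) (k / 2) + exceed P (Y a) (k / 2))).
  apply: exceed_le2; [by apply: measurable_funD; [exact: mX|exact: mY]|exact: mX|exact: mY|].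
  by move=> w Xk Yk; rewrite (le_trans (ler_normD _ _))// [leRHS]splitr lerD.
by apply: lerD; near: a; [exact: X0|exact: Y0].
Unshelve. all: by end_near. Qed.

Lemma tightD X Y : measurable_family X -> measurable_family Y ->
  tight X -> tight Y -> tight (fun a w => X a w + Y a w).
Proof.
move=> mX mY tX tY e e0.
have e2 : 0 < e / 2 by rewrite divr_gt0.
have [k1 k10 H1] := tX _ e2; have [k2 k20 H2] := tY _ e2.
exists (k1 + k2); first exact: addr_gt0.
near=> a; have a0 : 0 < a by near: a; exact: nbhs_pinfty_gt.
rewrite [leRHS]splitr; apply: (@le_trans _ _ (exceed P (X a) k1 + exceed P (Y a) k2)).
  apply: exceed_le2; [by apply: measurable_funD; [exact: mX|exact: mY]|exact: mX|exact: mY|].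
  by move=> w Xk Yk; rewrite (le_trans (ler_normD _ _))// lerD.
by apply: lerD; near: a.
Unshelve. all: by end_near. Qed.

Lemma tightM X Y : measurable_family X -> measurable_family Y ->
  tight X -> tight Y -> tight (fun a w => X a w * Y a w).
Proof.
move=> mX mY tX tY e e0.
have e2 : 0 < e / 2 by rewrite divr_gt0.
have [k1 k10 H1] := tX _ e2; have [k2 k20 H2] := tY _ e2.
exists (k1 * k2); first exact: mulr_gt0.
near=> a; have a0 : 0 < a by near: a; exact: nbhs_pinfty_gt.
rewrite [leRHS]splitr; apply: (@le_trans _ _ (exceed P (X a) k1 + exceed P (Y a) k2)).
  apply: exceed_le2; [by apply: measurable_funM; [exact: mX|exact: mY]|exact: mX|exact: mY|].
  by move=> w Xk Yk; rewrite normrM ler_pM.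
by apply: lerD; near: a.
Unshelve. all: by end_near. Qed.

Lemma cvg_prob0M X Y : measurable_family X -> measurable_family Y ->
  cvg_prob0 X -> tight Y -> cvg_prob0 (fun a w => X a w * Y a w).
Proof.
move=> mX mY X0 tY k k0 e e0.
have e2 : 0 < e / 2 by rewrite divr_gt0.
have [k2 k20 H2] := tY _ e2.
have kk : 0 < k / k2 by rewrite divr_gt0.
near=> a; have a0 : 0 < a by near: a; exact: nbhs_pinfty_gt.
rewrite [leRHS]splitr; apply: (@le_trans _ _ (exceed P (X a) (k / k2) + exceed P (Y a) k2)).
  apply: exceed_le2; [by apply: measurable_funM; [exact: mX|exact: mY]|exact: mX|exact: mY|].
  by move=> w Xk Yk; rewrite normrM -[leRHS](divfK (lt0r_neq0 k20)) ler_pM.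
by apply: lerD; near: a => //; exact: X0.
Unshelve. all: by end_near. Qed.

Lemma tight_divsqrt X : measurable_family X -> tight X ->
  cvg_prob0 (fun a w => X a w / Num.sqrt a).
Proof.
move=> mX tX k k0 e e0; have [l l0 H] := tX _ e0.
near=> a; have a0 : 0 < a by near: a; exact: nbhs_pinfty_gt.
have sa0 : 0 < Num.sqrt a by rewrite sqrtr_gt0.
apply: (@le_trans _ _ (exceed P (X a) l)); last by near: a.
apply: exceed_le1f; [by apply: measurable_funM => //; exact: mX|exact: mX|].
move=> w Xl; rewrite normrM normfV (gtr0_norm sa0) ler_pdivrMr// (le_trans Xl)//.
rewrite mulrC -ler_pdivrMr// -[leLHS]ger0_norm ?divr_ge0 ?(ltW l0) ?(ltW k0)//.
rewrite -sqrtr_sqr ler_sqrt ?(ltW a0)//; near: a; exact: nbhs_pinfty_ge.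
Unshelve. all: by end_near. Qed.

Lemma cvg_prob0_inv X (m : R) : measurable_family X -> 0 < m ->
  cvg_prob0 (fun a w => X a w - m) -> cvg_prob0 (fun a w => (X a w)^-1 - m^-1).
Proof.
move=> mX m0 X0 k k0 e e0.
(* The first bound keeps [X] above [m / 2]; then |1/X - 1/m| = |X - m| / (X m) is at most 2 |X - m|
   / m^2, which the second bound brings below [k]. *)
pose l := Num.min (m / 2) (k * m ^+ 2 / 2).
have l0 : 0 < l by rewrite lt_min !divr_gt0// mulr_gt0// exprn_gt0.
near=> a; have a0 : 0 < a by near: a; exact: nbhs_pinfty_gt.
apply: (@le_trans _ _ (exceed P (fun w => X a w - m) l)); last by near: a; exact: X0.
have mXa := mX a a0.
apply: exceed_le1f.
- apply: measurable_funB => //; apply: (measurableT_comp _ mXa).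
  exact: measurable_invr.
- exact: measurable_funB.
move=> w; rewrite /l le_min => /andP[Xm1 Xm2].
have Xm : m / 2 <= X a w by move: Xm1; rewrite ler_norml => /andP[h _]; lra.
have X0' : 0 < X a w by apply: lt_le_trans Xm; rewrite divr_gt0.
have -> : (X a w)^-1 - m^-1 = - (X a w - m) / (X a w * m).
  by field; rewrite !lt0r_neq0.
rewrite normrM normrN normfV (gtr0_norm (mulr_gt0 X0' m0)) ler_pdivrMr ?mulr_gt0//.
apply: (le_trans Xm2); rewrite -mulrA ler_pM2l//.
by rewrite expr2 mulrAC ler_pM2r.
Unshelve. all: by end_near. Qed.

(** A continuous test function is uniformly continuous only on segments. Tightness keeps [X] in a
    segment up to a small probability; there a small [Y - X] moves [f] little, and elsewhere
    boundedness of [f] suffices. *)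
Lemma slutsky X Y (mu : probability (measurableTypeR R) R) :
  measurable_family X -> measurable_family Y -> tight X ->
  cvg_prob0 (fun a w => Y a w - X a w) -> cvg_in_law P X mu -> cvg_in_law P Y mu.
Proof.
move=> mX mY tX YX /(cvg_in_lawP _ _ _ mX) HX.
apply/(cvg_in_lawP _ _ _ mY) => f cf [B fB] e e0.
have B0 : 0 <= B by exact: le_trans (normr_ge0 _) (fB 0).
have e4 : 0 < e / 4 by rewrite divr_gt0.
have eB : 0 < e / 4 / (B + B + 1) by rewrite divr_gt0// ltr_wpDl// addr_ge0.
have [k k0 Hk] := tX _ eB.
have [r r0 unif] := continuous_uniform_segment f k _ cf e4.
near=> a; have a0 : 0 < a by near: a; exact: nbhs_pinfty_gt.
have mXa := mX a a0; have mYa := mY a a0.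
have mf : measurable_fun setT f by exact: continuous_measurable_fun.
have ifX : rint (fun w => f (X a w)).
  by apply: (rint_bounded _ _ B) => //; apply: (measurableT_comp mf).
have ifY : rint (fun w => f (Y a w)).
  by apply: (rint_bounded _ _ B) => //; apply: (measurableT_comp mf).
have h1 : `|\int[P]_w f (X a w) - \int[mu]_x f x| <= e / 4.
  by near: a; apply: HX => //; exists B.
have h2 : exceed P (X a) k <= e / 4 / (B + B + 1) by near: a.
have h3 : exceed P (fun w => Y a w - X a w) r <= e / 4 / (B + B + 1) by near: a; exact: YX.
have rb (u : Omega -> R) l : measurable_fun setT u -> rint (fun w => (l < `|u w|)%R%:R : R).
  move=> mu'; apply: (rint_bounded _ _ 1); first exact: measurable_gt_fun.
  by move=> w; case: (_ < _); rewrite ?normr1 ?normr0.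
have h4 : `|\int[P]_w f (Y a w) - \int[P]_w f (X a w)| <=
    e / 4 + ((B + B) * exceed P (X a) k + (B + B) * exceed P (fun w => Y a w - X a w) r).
  have i1 := rb _ k mXa.
  have i2 : rint (fun w => (r < `|Y a w - X a w|)%R%:R : R).
    by apply: rb; exact: measurable_funB.
  rewrite !exceedE//; last exact: measurable_funB.
  rewrite -!RintegralZl// -RintegralD//; [|exact: rintZl|exact: rintZl].
  rewrite -RintegralB// -[e / 4](Rintegral_cstT P) -RintegralD//; last 2 first.
  - exact: rint_cst.
  - by apply: rintD; exact: rintZl.
  apply: norm_Rintegral_le; first exact: rintB.
    by apply: rintD; [exact: rint_cst|apply: rintD; exact: rintZl].
  move=> w.
  have nn1 : 0 <= (B + B) * (k < `|X a w|)%R%:R by rewrite mulr_ge0 ?addr_ge0.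
  have nn2 : 0 <= (B + B) * (r < `|Y a w - X a w|)%R%:R by rewrite mulr_ge0 ?addr_ge0.
  have f2 : `|f (Y a w) - f (X a w)| <= B + B.
    by rewrite (le_trans (ler_normB _ _))// lerD.
  have [kX|Xk] := ltP k `|X a w|; first by rewrite mulr1; lra.
  have [rY|Yr] := ltP r `|Y a w - X a w|; first by rewrite mulr0 mulr1; lra.
  rewrite !mulr0 !addr0 distrC; apply: unif => //.
  by rewrite distrC.
have h5 y : 0 <= y -> y <= e / 4 / (B + B + 1) -> (B + B) * y <= e / 4.
  rewrite ler_pdivlMr ?ltr_wpDl ?addr_ge0// => y0 h; nra.
have h6 := h5 _ (exceed_ge0 _ _ _) h2.
have h7 := h5 _ (exceed_ge0 _ _ _) h3.
rewrite -(subrKA (\int[P]_w f (X a w))); apply: (le_trans (ler_normD _ _)); lra.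
Unshelve. all: by end_near. Qed.

End convergence_in_probability.

(** * Convergence in law of products of independent families *)

Section product_convergence.
Context {R : realType} {d : measure_display} {Omega : measurableType d}
  (P : probability Omega R).
Local Notation rint f := (P.-integrable setT (EFin \o f)).
Variables (X Y : R -> Omega -> R) (mu1 mu2 : probability (measurableTypeR R) R).
Hypotheses (mX : measurable_family X) (mY : measurable_family Y).
Hypotheses (tX : tight P X) (tY : tight P Y).
Hypotheses (cX : cvg_in_law P X mu1) (cY : cvg_in_law P Y mu2).

Section test_function.
Variables (f : R -> R) (B : R).
Hypotheses (cf : continuous f) (fB : forall x, `|f x| <= B).

Let mf : measurable_fun setT f. Proof. exact: continuous_measurable_fun. Qed.
Let B0 : 0 <= B. Proof. exact: le_trans (normr_ge0 _) (fB 0). Qed.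
Let F (a x : R) : R := \int[P]_w f (x * Y a w).
Let Foo (x : R) : R := \int[mu2]_y f (x * y).

Let cfx (x : R) : continuous (fun y => f (x * y)).
Proof.
by move=> y; apply: (continuous_comp _ (cf _)); apply: cvgM; [exact: cvg_cst|exact: cvg_id].
Qed.

Let ifY a x : 0 < a -> rint (fun w => f (x * Y a w)).
Proof.
move=> a0; apply: (rint_bounded _ _ B) => //; apply: (measurableT_comp mf).
by apply: measurable_funM => //; exact: mY.
Qed.

(** Up to a small probability [|Y a| <= k]; there [x * Y a] lies in the segment of radius [|x| * k]
    and moves by at most [k] times the change of [x], so uniform continuity of [f] applies with
    radius [r / k]. *)
Let equicontinuous (x e : R) : 0 < e -> exists2 r : R, 0 < r &
  \forall a \near +oo, forall x', `|x - x'| <= r -> `|F a x - F a x'| <= e.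
Proof.
move=> e0.
have e2 : 0 < e / 2 by rewrite divr_gt0.
have eB : 0 < e / 2 / (B + B + 1) by rewrite divr_gt0// ltr_wpDl// addr_ge0.
have [k k0 Hk] := tY _ eB.
have [r r0 unif] := continuous_uniform_segment f (`|x| * k) _ cf e2.
exists (r / k); first by rewrite divr_gt0.
near=> a => x' xx'.
have a0 : 0 < a by near: a; exact: nbhs_pinfty_gt.
have mYa := mY a a0.
have h2 : exceed P (Y a) k <= e / 2 / (B + B + 1) by near: a.
have ik : rint (fun w => (k < `|Y a w|)%R%:R : R).
  apply: (rint_bounded _ _ 1); first exact: measurable_gt_fun.
  by move=> w; case: (_ < _); rewrite ?normr1 ?normr0.
apply: (@le_trans _ _ (e / 2 + (B + B) * exceed P (Y a) k)); last first.
  have := exceed_ge0 P (Y a) k; move: h2; rewrite ler_pdivlMr ?ltr_wpDl ?addr_ge0//; nra.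
rewrite exceedE// -[e / 2](Rintegral_cstT P) -RintegralZl// -RintegralD//; last 2 first.
- exact: rint_cst.
- exact: rintZl.
rewrite /F -RintegralB//; [|exact: ifY|exact: ifY].
apply: norm_Rintegral_le.
- by apply: rintB; exact: ifY.
- by apply: rintD; [exact: rint_cst|exact: rintZl].
move=> w; have [kY|Yk] := ltP k `|Y a w|.
  rewrite mulr1 (le_trans (ler_normB _ _))// ler_wpDl ?(ltW e2)// lerD//.
rewrite mulr0 addr0; apply: unif; first by rewrite normrM ler_wpM2l.
rewrite -mulrBl normrM -[leRHS](divfK (lt0r_neq0 k0)) ler_pM//.
Unshelve. all: by end_near. Qed.

Let Fcvg (x e : R) : 0 < e -> \forall a \near +oo, `|F a x - Foo x| <= e.
Proof.
move=> e0; have /(cvg_in_lawP _ _ _ mY) H := cY.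
by apply: (H (fun y => f (x * y))) => //; exists B.
Qed.

(** The limit inherits the modulus of continuity of the [F a]: for each [y] a single large [a] is
    close to the limit at both [x] and [y]. *)
Let cFoo : continuous Foo.
Proof.
move=> x; apply/cvgrPdist_le => e e0.
have e3 : 0 < e / 3 by rewrite divr_gt0.
have [r r0 H] := equicontinuous x _ e3.
near=> y; have xy : `|x - y| <= r.
  by near: y; apply: cvgr_dist_le => //; exact: cvg_id.
have [a [h1 h2 h3]] : exists a, [/\ `|F a x - Foo x| <= e / 3,
    `|F a y - Foo y| <= e / 3 & `|F a x - F a y| <= e / 3].
  near (pinfty_nbhs R) => a; exists a; split.
  - by near: a; exact: Fcvg.
  - by near: a; exact: Fcvg.
  - have h : forall x', `|x - x'| <= r -> `|F a x - F a x'| <= e / 3 by near: a.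
    exact: h.
have -> : Foo x - Foo y = - (F a x - Foo x) + (F a x - F a y) + (F a y - Foo y) by ring.
apply: (le_trans (ler_normD _ _)).
have := ler_normD (- (F a x - Foo x)) (F a x - F a y); rewrite normrN => h4.
have -> : e = (e / 3 + e / 3) + e / 3 by field.
by rewrite lerD// (le_trans h4)// lerD.
Unshelve. all: by end_near. Qed.

Let FooB (x : R) : `|Foo x| <= B.
Proof.
apply: norm_Rintegral_bounded => //.
by apply: continuous_measurable_fun; exact: cfx.
Qed.

(** Equicontinuity upgrades pointwise convergence to uniform convergence on segments, by
    compactness. *)
Let F_uniform (K e : R) : 0 < e ->
  \forall a \near +oo, forall x, `|x| <= K -> `|F a x - Foo x| <= e.
Proof.
move=> e0.
have /compact_near_coveringP cov : compact (`[- K, K] : set R) by exact: segment_compact.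
have : \forall a \near (pinfty_nbhs R), `[- K, K] `<=` [set x | `|F a x - Foo x| <= e].
  apply: cov => x _.
  have e3 : 0 < e / 3 by rewrite divr_gt0.
  have [r r0 H] := equicontinuous x _ e3.
  have := cFoo x; rewrite /continuous_at => /cvgrPdist_le /(_ _ e3) /nbhs_ballP [r' /= r'0 xr'].
  pose q := Num.min r r'.
  have q0 : 0 < q by rewrite lt_min r0.
  exists (ball x q, [set a | `|F a x - Foo x| <= e / 3 /\
     forall x', `|x - x'| <= r -> `|F a x - F a x'| <= e / 3]) => /=.
    split; first exact: nbhsx_ballx.
    by near=> a; split; near: a; [exact: Fcvg|].
  move=> [z a] /= [xz [h1 h2]].
  have xzr : `|x - z| <= r by rewrite ltW// (lt_le_trans xz)// ge_min lexx.
  have h3 := h2 _ xzr.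
  have h4 : `|Foo x - Foo z| <= e / 3.
    by apply: xr'; apply: le_ball xz; rewrite ge_min lexx orbT.
  have -> : F a z - Foo z = - (F a x - F a z) + (F a x - Foo x) + (Foo x - Foo z) by ring.
  apply: (le_trans (ler_normD _ _)).
  have := ler_normD (- (F a x - F a z)) (F a x - Foo x); rewrite normrN => h5.
  have -> : e = (e / 3 + e / 3) + e / 3 by field.
  by rewrite lerD// (le_trans h5)// lerD.
move=> H; near=> a => x xK.
have Ha : `[- K, K] `<=` [set x | `|F a x - Foo x| <= e] by near: a.
by apply: Ha; rewrite /= in_itv/= -ler_norml.
Unshelve. all: by end_near. Qed.

(** The test function [F a] changes with [a], so convergence in law of [X] is applied to the fixed
    limit [Foo]. The difference of the two is uniformly small on a segment and at most [B + B] off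
    it, where tightness of [X] takes over. *)
Lemma product_test_cvg (e : R) : 0 < e -> 
  (forall a, 0 < a -> measurable_fun setT (F a)) ->
  \forall a \near +oo, `|\int[P]_w (F a (X a w)) - \int[mu1]_x Foo x| <= e.
Proof.
move=> e0 mF.
have e3 : 0 < e / 3 by rewrite divr_gt0.
have eB : 0 < e / 3 / (B + B + 1) by rewrite divr_gt0// ltr_wpDl// addr_ge0.
have [k k0 Hk] := tX _ eB.
have HX : \forall a \near +oo, `|\int[P]_w Foo (X a w) - \int[mu1]_x Foo x| <= e / 3.
  by have /(cvg_in_lawP _ _ _ mX) H := cX; apply: H => //; exists B; exact: FooB.
near=> a; have a0 : 0 < a by near: a; exact: nbhs_pinfty_gt.
have mXa := mX a a0.
have h1 : `|\int[P]_w Foo (X a w) - \int[mu1]_x Foo x| <= e / 3 by near: a.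
have h2 : exceed P (X a) k <= e / 3 / (B + B + 1) by near: a.
have h3 : forall x, `|x| <= k -> `|F a x - Foo x| <= e / 3.
  by near: a; exact: F_uniform.
have FB x : `|F a x| <= B.
  apply: norm_Rintegral_bounded => //; apply: (measurableT_comp mf).
  by apply: measurable_funM => //; exact: mY.
have mFoo : measurable_fun setT Foo by exact: continuous_measurable_fun.
have i1 : rint (fun w => F a (X a w)).
  by apply: (rint_bounded _ _ B) => //; apply: (measurableT_comp (mF a a0)).
have i2 : rint (fun w => Foo (X a w)).
  by apply: (rint_bounded _ _ B) => //; apply: (measurableT_comp mFoo).
have ik : rint (fun w => (k < `|X a w|)%R%:R : R).
  apply: (rint_bounded _ _ 1); first exact: measurable_gt_fun.
  by move=> w; case: (_ < _); rewrite ?normr1 ?normr0.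
have h4 : `|\int[P]_w F a (X a w) - \int[P]_w Foo (X a w)| <= e / 3 + (B + B) * exceed P (X a) k.
  rewrite exceedE// -[e / 3](Rintegral_cstT P) -RintegralZl// -RintegralD//; last 2 first.
  - exact: rint_cst.
  - exact: rintZl.
  rewrite -RintegralB//; apply: norm_Rintegral_le; first exact: rintB.
    by apply: rintD; [exact: rint_cst|exact: rintZl].
  move=> w; have [kX|Xk] := ltP k `|X a w|.
    by rewrite mulr1 (le_trans (ler_normB _ _))// ler_wpDl ?(ltW e3)// lerD.
  by rewrite mulr0 addr0; exact: h3.
have h5 : (B + B) * exceed P (X a) k <= e / 3.
  have := exceed_ge0 P (X a) k; move: h2; rewrite ler_pdivlMr ?ltr_wpDl ?addr_ge0//; nra.
rewrite -(subrKA (\int[P]_w Foo (X a w))); apply: (le_trans (ler_normD _ _)); lra.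
Unshelve. all: by end_near. Qed.

End test_function.

(** Independence enters through [dec]: integrating out [Y a] first leaves a test function of [X a]
    alone. *)
Lemma cvg_in_law_mul (mu : probability (measurableTypeR R) R) :
  (forall a : R, 0 < a -> forall f : R -> R, continuous f -> (exists B, forall x, `|f x| <= B) ->
     measurable_fun setT (fun x : R => \int[P]_w' f (x * Y a w')) /\
     \int[P]_w f (X a w * Y a w) = \int[P]_w \int[P]_w' f (X a w * Y a w')) ->
  (forall f : R -> R, continuous f -> (exists B, forall x, `|f x| <= B) ->
     \int[mu]_x f x = \int[mu1]_x \int[mu2]_y f (x * y)) ->
  cvg_in_law P (fun a w => X a w * Y a w) mu.
Proof.
move=> dec Emu; apply/cvg_in_lawP.
  by move=> a a0; apply: measurable_funM; [exact: mX|exact: mY].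
move=> f cf bf e e0; rewrite Emu//; have [B fB] := bf.
have := product_test_cvg f B cf fB e e0 (fun a a0 => (dec a a0 f cf bf).1).
move=> H; near=> a; have a0 : 0 < a by near: a; exact: nbhs_pinfty_gt.
by rewrite (dec a a0 f cf bf).2; near: a.
Unshelve. all: by end_near. Qed.

End product_convergence.

(** * Conditional expectations and independence up to null sets *)

Section conditional.
Context {R : realType} {d : measure_display} {Omega : measurableType d}
  (P : probability Omega R).
Local Notation rint f := (P.-integrable setT (EFin \o f)).

(** The events where [Y - W] is nonnegative or negative belong to the sigma-algebra; testing on both
    shows that the integral of |Y - W| is 0. *)
Lemma cond_exp_unique (F : set (set Omega)) (Y W : Omega -> R) :
  F `<=` measurable -> rint Y -> rint W ->
  (forall B, measurable B -> <<s F >> (Y @^-1` B)) ->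
  (forall B, measurable B -> <<s F >> (W @^-1` B)) ->
  (forall A, <<s F >> A ->
     \int[P]_(w in A) (Y w)%:E = \int[P]_(w in A) (W w)%:E)%E ->
  {ae P, forall w, Y w = W w}.
Proof.
move=> Fm iY iW mY mW YW.
pose DE (w : Omega) := Y w - W w.
have mDE : measurable_fun setT (DE : g_sigma_algebraType F -> R).
  apply: (@measurable_funB _ (g_sigma_algebraType F)) => _ B mB; rewrite setTI;
    [exact: mY|exact: mW].
have iDE : rint DE by exact: rintB.
have FA : <<s F >> [set w | 0 <= DE w].
  have := mDE measurableT `[0, +oo[%classic (measurable_itv _).
  rewrite setTI (_ : _ @^-1` _ = [set w | 0 <= DE w])//.
  by apply/seteqP; split => w /=; rewrite in_itv/= andbT.
have FC : <<s F >> (~` [set w | 0 <= DE w]).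
  exact: (@measurableC _ (g_sigma_algebraType F)).
have D0 A : <<s F >> A -> (\int[P]_(w in A) (DE w)%:E = 0)%E.
  move=> sA; have mA := g_sigma_measurable F Fm _ sA.
  have iYA : P.-integrable A (EFin \o Y) by exact: integrableS iY.
  have iWA : P.-integrable A (EFin \o W) by exact: integrableS iW.
  rewrite integralB_EFin// YW// subee//; exact: integrable_fin_num.
have mdE : measurable_fun setT (EFin \o DE) by apply/measurable_EFinP; exact: (rint_measurable _ _ iDE).
pose Ap : set Omega := [set w | 0 <= DE w].
have hp : (\int[P]_(w in Ap) `|(EFin \o DE) w| = 0)%E.
  rewrite -(D0 _ FA); apply: eq_integral => w; rewrite inE/= => h.
  by rewrite ger0_norm.
have iC : P.-integrable (~` Ap) (EFin \o DE).
  by apply: integrableS iDE => //; exact: g_sigma_measurable FC.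
have hn : (\int[P]_(w in ~` Ap) `|(EFin \o DE) w| = 0)%E.
  rewrite -[RHS]oppe0 -[in RHS](D0 _ FC) -integralN; last first.
    by apply: integrable_add_def iC; exact: g_sigma_measurable FC.
  apply: eq_integral => w; rewrite inE/= => /negP; rewrite -ltNge => h.
  by rewrite ltr0_norm.
have : ae_eq P setT (EFin \o DE) (cst 0%E).
  apply/ae_eq_integral_abs => //; rewrite -(setUv Ap) ge0_integral_setU//.
  - by rewrite hp hn adde0.
  - exact: g_sigma_measurable FA.
  - exact: g_sigma_measurable FC.
  - by apply: measurable_funTS; apply: measurableT_comp.
  - exact/disj_setPCl.
apply: filterS => w /(_ I) [/eqP]; rewrite subr_eq0 => /eqP//.
Qed.

(** Every event comes with its own null set, so a family of uncountably many variables, each known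
    only almost surely, still generates a sub-sigma-algebra of this one. *)
Definition almost (F : set (set Omega)) : set (set Omega) :=
  [set A | measurable A /\ exists2 B, <<s F >> B & {ae P, forall w, A w <-> B w}].

Lemma almost_sigma_algebra F : sigma_algebra setT (almost F).
Proof.
split.
- split=> //; exists set0; first exact: (@measurable0 _ (g_sigma_algebraType F)).
  exact: aeW.
- move=> A [mA [B sB AB]]; rewrite setTD; split; first exact: measurableC.
  exists (~` B); first exact: (@measurableC _ (g_sigma_algebraType F)).
  by apply: filterS AB => w AB; split => h; rewrite /setC/= => /AB.
- move=> A HA; split; first by apply: bigcup_measurable => k _; exact: (HA k).1.
  have /choice[B HB] : forall k, exists B, <<s F >> B /\ {ae P, forall w, A k w <-> B w}.
    by move=> k; have [_ [B]] := HA k; exists B.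
  exists (\bigcup_k B k).
    apply: (@bigcup_measurable _ (g_sigma_algebraType F)) => k _; exact: (HB k).1.
  have : {ae P, forall w, forall k, A k w <-> B k w} by apply: ae_foralln => k; exact: (HB k).2.
  by apply: filterS => w AB; split => -[k _ h]; exists k => //; apply/AB.
Qed.

(** An event of [almost F] has the same probabilities and intersections, up to null sets, as one of
    the sigma-algebra of [F]; and [almost F], being a sigma-algebra, contains all that [C]
    generates. *)
Lemma independent_almost (F C G : set (set Omega)) : F `<=` measurable -> G `<=` measurable ->
  C `<=` almost F -> independent P <<s F >> G -> independent P <<s C >> G.
Proof.
move=> Fm Gm CF FG A B sA GB.
have [mA [A' sA' AA']] : almost F A.
  by move: A sA; apply: smallest_sub => //; exact: almost_sigma_algebra.
have mA' := g_sigma_measurable F Fm _ sA'; have mB := Gm _ GB.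
have ae_eqP X Y : measurable X -> measurable Y -> {ae P, forall w, X w <-> Y w} -> P X = P Y.
  move=> mX mY XY; rewrite -[X]setIT -[Y]setIT -!integral_indic//.
  apply: ae_eq_integral => //.
  - by apply/measurable_EFinP; exact: measurable_indic.
  - by apply/measurable_EFinP; exact: measurable_indic.
  apply: filterS XY => w XY _; rewrite !indicE; congr ((_%:R)%:E).
  by congr nat_of_bool; apply/idP/idP; rewrite !inE => /XY.
rewrite (ae_eqP A A')// -(FG A' B)//; apply: ae_eqP; [exact: measurableI|exact: measurableI|].
by apply: filterS AA' => w h; split => -[/h].
Qed.

End conditional.

(** * Decoupling and limit law for products of two variables *)

Section decoupling_mul.
Context {R : realType} {d : measure_display} {Omega : measurableType d}
  (P : probability Omega R).
Local Notation rint f := (P.-integrable setT (EFin \o f)).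
Variables (f : R -> R) (K : R).
Hypotheses (cf : continuous f) (fK : forall x, `|f x| <= K).

Let mf : measurable_fun setT f. Proof. exact: continuous_measurable_fun. Qed.

Let fK0 x : 0 <= f x + K.
Proof. by have := fK x; rewrite ler_norml => /andP[h _]; rewrite -lerBlDr sub0r. Qed.

Let rint_f (X : Omega -> R) : measurable_fun setT X -> rint (fun w => f (X w)).
Proof. by move=> mX; apply: (rint_bounded _ _ K) => //; exact: measurableT_comp. Qed.

Let shiftE (X : Omega -> R) : measurable_fun setT X ->
  (\int[P]_w (f (X w) + K)%:E = (\int[P]_w f (X w) + K)%:E)%E.
Proof.
move=> mX; rewrite -EFin_Rintegral; last by apply: rintD; [exact: rint_f|exact: rint_cst].
rewrite RintegralD//; [by rewrite Rintegral_cstT|exact: rint_f|exact: rint_cst].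
Qed.

Lemma measurable_mul_expectation (Y : Omega -> R) : measurable_fun setT Y ->
  measurable_fun setT (fun x : R => \int[P]_w f (x * Y w)).
Proof.
move=> mY; pose g (z : R * Omega) : \bar R := (f (z.1 * Y z.2) + K)%:E.
have mg : measurable_fun setT g.
  apply/measurable_EFinP/measurable_funD => //; apply: (measurableT_comp mf).
  by apply: measurable_funM => //; exact: measurableT_comp.
have g0 z : (0 <= g z)%E by rewrite lee_fin.
have mF := measurable_fun_fubini_tonelli_F (m2 := P) g mg g0.
rewrite (_ : (fun _ => _) = (fun x => fine (fubini_F P g x) - K)).
  by apply: measurable_funB => //; exact: (measurableT_comp (@fine_measurable R setT measurableT)).
apply/funext => x; rewrite /fubini_F /g/= shiftE/= ?addrK//.
exact: measurable_funM.
Qed.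

Lemma decoupling_mul (A B : set (set Omega)) (X Y : Omega -> R) :
  A `<=` measurable -> B `<=` measurable -> independent P <<s A >> <<s B >> ->
  measurable_fun setT (X : g_sigma_algebraType A -> R) ->
  measurable_fun setT (Y : g_sigma_algebraType B -> R) ->
  \int[P]_w f (X w * Y w) = \int[P]_w \int[P]_w' f (X w * Y w').
Proof.
move=> Am Bm AB mX mY.
have mX' : measurable_fun setT X by exact: measurable_fun_g_sigma Am mX.
have mY' : measurable_fun setT Y by exact: measurable_fun_g_sigma Bm mY.
(* Decoupling holds for nonnegative functions, hence the shift by [K]. *)
pose g (z : g_sigma_algebraType A * g_sigma_algebraType B) : \bar R := (f (X z.1 * Y z.2) + K)%:E.
have mg : measurable_fun setT g.
  apply/measurable_EFinP/measurable_funD => //; apply: (measurableT_comp mf).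
  by apply: measurable_funM => //; exact: measurableT_comp.
have g0 z : (0 <= g z)%E by rewrite lee_fin.
have := decoupling P A B Am Bm AB g mg g0; rewrite /g/= shiftE; last exact: measurable_funM.
have -> : (\int[P]_w \int[P]_w' (f (X w * Y w') + K)%:E =
    \int[P]_w (\int[P]_w' f (X w * Y w') + K)%:E)%E.
  by apply: eq_integral => w _; rewrite shiftE//; exact: measurable_funM.
have mh : measurable_fun setT (fun w => \int[P]_w' f (X w * Y w')).
  exact: (measurableT_comp (measurable_mul_expectation Y mY') mX').
have ih : rint (fun w => \int[P]_w' f (X w * Y w')).
  apply: (rint_bounded _ _ K mh) => w; apply: norm_Rintegral_bounded => //.
  by apply: (measurableT_comp mf); exact: measurable_funM.
rewrite -EFin_Rintegral; last by apply: rintD; [exact: ih|exact: rint_cst].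
rewrite RintegralD//; [|exact: rint_cst]; rewrite Rintegral_cstT => -[] /addIr //.
Qed.

End decoupling_mul.

(** The law of a product of two independent variables: it is integrable because E|xy| = E|x| E|y|,
    and centred because the inner integral over [m2] is a multiple of its mean. *)
Lemma product_law {R : realType} (m1 m2 : probability (measurableTypeR R) R) :
  m1.-integrable setT EFin -> m2.-integrable setT EFin -> (\int[m2]_x x%:E = 0)%E ->
  exists mu : probability (measurableTypeR R) R,
    [/\ mu.-integrable setT EFin, (\int[mu]_x x%:E = 0)%E &
      forall f : R -> R, continuous f -> (exists B, forall x, `|f x| <= B) ->
        \int[mu]_x f x = \int[m1]_x \int[m2]_y f (x * y)].
Proof.
move=> i1 i2 m20.
have mm : @measurable_fun _ _ (measurableTypeR R * measurableTypeR R)%type (measurableTypeR R)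
    setT (fun z => (z.1 : R) * z.2).
  exact: measurable_funM.
pose pr : probability (measurableTypeR R * measurableTypeR R)%type R := (m1 \x m2)%E.
pose XY : {mfun (measurableTypeR R * measurableTypeR R)%type >-> measurableTypeR R} :=
  @mfun_Sub _ _ (measurableTypeR R * measurableTypeR R)%type (measurableTypeR R)
    (fun z => (z.1 : R) * z.2) (mem_set mm).
pose mu : probability (measurableTypeR R) R := @distribution _ _ _ (measurableTypeR R) _ pr XY.
have iprod : pr.-integrable setT (fun z => (z.1 * z.2)%:E).
  apply/integrable12ltyP; first by apply/measurable_EFinP.
  have a1 := rint_norm m1 idfun i1; have a2 := rint_norm m2 idfun i2.
  rewrite (_ : integral _ _ _ = \int[m1]_x (`|x| * \int[m2]_y `|y|)%:E)%E; last first.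
    apply: eq_integral => x _; rewrite EFinM EFin_Rintegral// -integralZl//.
    by apply: eq_integral => y _; rewrite /= normrM EFinM.
  have a3 := rintZl m1 (\int[m2]_y `|y|) _ a1.
  rewrite (_ : integral _ _ _ = \int[m1]_x ((\int[m2]_y `|y|) * `|x|)%:E)%E.
    by rewrite -(EFin_Rintegral _ _ a3) ltry.
  by apply: eq_integral => x _; rewrite mulrC.
exists mu; split.
- exact: integrable_pushforward.
- rewrite integral_distribution//= -integral12_prod_meas1//.
  rewrite /fubini_F integral0_eq// => x _ /=.
  rewrite (_ : integral _ _ _ = \int[m2]_y (x%:E * y%:E))%E; last first.
    by apply: eq_integral => y _; rewrite EFinM.
  by rewrite integralZl// m20 mule0.
- move=> f cf [B fB]; have mf : measurable_fun setT f by exact: continuous_measurable_fun.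
  have mfz : measurable_fun setT (fun z : measurableTypeR R * measurableTypeR R => f (z.1 * z.2)).
    exact: (measurableT_comp mf mm).
  have ifz : pr.-integrable setT (fun z => (f (z.1 * z.2))%:E).
    exact: (rint_bounded pr _ B mfz).
  rewrite {1}/Rintegral integral_distribution//=; last exact/measurable_EFinP.
  rewrite -integral12_prod_meas1// /fubini_F /Rintegral; congr fine.
  apply: eq_integral => x _; rewrite -EFin_Rintegral//.
  apply: (rint_bounded m2 _ B) => //; apply: (measurableT_comp mf).
  rewrite /=; apply: measurable_funM => //; exact: measurable_cst.
Qed.

Lemma g_sigma_setT {T : pointedType} (F : set (set T)) : <<s F >> setT.
Proof. exact: (@measurableT _ (g_sigma_algebraType F)). Qed.

Lemma g_sigma_setI {T : pointedType} (F : set (set T)) : setI_closed <<s F >>.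
Proof. by move=> A B FA FB; exact: (@measurableI _ (g_sigma_algebraType F)). Qed.

(** * The claims model *)

Section special_model.
Context {R : realType} {d : measure_display} {Omega : measurableType d}
  (P : probability Omega R) (T : nat) (lam : nat -> R)
  (M : nat -> R -> Omega -> nat) (D : nat -> nat -> Omega -> nat)
  (Z : nat -> nat -> Omega -> R) (D0 : Omega -> nat) (Z0 : Omega -> R).
Local Notation rint f := (P.-integrable setT (EFin \o f)).
Hypothesis lam_gt0 : forall j, (1 <= j <= T)%N -> 0 < lam j.
Hypothesis poisM : forall j, (1 <= j <= T)%N -> poisson_process P (M j) (lam j).
Hypothesis mD : forall j k n, (1 <= j <= T)%N -> (1 <= k)%N ->
  measurable (D j k @^-1` [set n]).
Hypothesis mZ : forall j k, (1 <= j <= T)%N -> (1 <= k)%N -> measurable_fun setT (Z j k).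
Hypothesis mD0 : forall n, measurable (D0 @^-1` [set n]).
Hypothesis mZ0 : measurable_fun setT Z0.
Hypothesis D0T : forall w, (1 <= D0 w <= T)%N.
Hypothesis iZ2 : rint (fun w => Z0 w ^+ 2).
Hypothesis DZ_law : forall j k, (1 <= j <= T)%N -> (1 <= k)%N ->
  forall t B, measurable B ->
    P (D j k @^-1` [set t] `&` Z j k @^-1` B) = P (D0 @^-1` [set t] `&` Z0 @^-1` B).
Hypothesis marks_ind : forall j, (1 <= j <= T)%N ->
  mutually_independent P (fun k : nat =>
    <<s events_nat (D j k.+1) `|` events_real (Z j k.+1) >>).
Hypothesis marks_M_ind : forall j, (1 <= j <= T)%N ->
  independent P
    (<<s \bigcup_(k in [set k : nat | (1 <= k)%N])
           (events_nat (D j k) `|` events_real (Z j k)) >>)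
    (<<s \bigcup_(a in [set a : R | 0 <= a]) events_nat (M j a) >>).
Let year (j : nat) : set (set Omega) :=
  (\bigcup_(a in [set a : R | 0 <= a]) events_nat (M j a)) `|`
  (\bigcup_(k in [set k : nat | (1 <= k)%N]) (events_nat (D j k) `|` events_real (Z j k))).
Hypothesis years_ind : mutually_independent P (fun j : 'I_T => <<s year j.+1 >>).

Lemma measurable_fun_nat {d'} {T' : measurableType d'} (f : T' -> nat) :
  (forall n, measurable (f @^-1` [set n])) -> measurable_fun setT f.
Proof.
move=> mf _ B _; rewrite setTI (_ : _ @^-1` _ = \bigcup_(n in B) f @^-1` [set n]).
  exact: bigcup_measurable.
by apply/seteqP; split => [w Bw|w [n Bn /= fw]]; [exists (f w)|rewrite /= fw].
Qed.

Lemma ord_year (j : 'I_T) : (1 <= j.+1 <= T)%N.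
Proof. exact: (ltn_ord j). Qed.

(** Claims are numbered from 1 and the marks of Mecke's identity from 0, hence [k.+1]. *)
Let mark (j k : nat) (w : Omega) : nat * R := (D j k.+1 w, Z j k.+1 w).
Let mark_events (j k : nat) := events_nat (D j k.+1) `|` events_real (Z j k.+1).

Lemma mark_events_measurable j k : (1 <= j <= T)%N -> mark_events j k `<=` measurable.
Proof.
move=> jT A [[n _ <-]|[B mB <-]]; first exact: mD.
by rewrite -[X in measurable X]setTI; exact: mZ.
Qed.

Lemma measurable_mark j k : (1 <= j <= T)%N ->
  measurable_fun setT (mark j k : g_sigma_algebraType (mark_events j k) -> nat * R).
Proof.
move=> jT; apply: measurable_fun_pair.
  apply: (measurable_fun_nat (D j k.+1 : g_sigma_algebraType (mark_events j k) -> nat)) => n.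
  by apply: sub_sigma_algebra; left; exists n.
by move=> _ B mB; rewrite setTI; apply: sub_sigma_algebra; right; exists B.
Qed.

Lemma mark_law j k (f : nat * R -> \bar R) : (1 <= j <= T)%N ->
  measurable_fun setT f -> (forall x, 0 <= f x)%E ->
  (\int[P]_w f (mark j k w) = \int[P]_w f (D0 w, Z0 w))%E.
Proof.
move=> jT mf f0.
have mm : measurable_fun setT (mark j k).
  exact: measurable_fun_g_sigma (mark_events_measurable _ _ jT) (measurable_mark _ _ jT).
have mm0 : measurable_fun setT (fun w => (D0 w, Z0 w)).
  by apply: measurable_fun_pair => //; exact: measurable_fun_nat.
have E : forall A, measurable A -> P (mark j k @^-1` A) = P ((fun w => (D0 w, Z0 w)) @^-1` A).
  move=> A mA.
  have mA' n : measurable (xsection A n) by exact: measurable_xsection.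
  have dec (D' : Omega -> nat) (Z' : Omega -> R) : (forall n, measurable (D' @^-1` [set n])) ->
      measurable_fun setT Z' -> P ((fun w => (D' w, Z' w)) @^-1` A) =
      (\sum_(0 <= n <oo) P (D' @^-1` [set n] `&` Z' @^-1` (xsection A n)))%E.
    move=> mD' mZ'.
    rewrite (_ : _ @^-1` A = \bigcup_n (D' @^-1` [set n] `&` Z' @^-1` (xsection A n))).
      rewrite measure_semi_bigcup//.
      + move=> n; apply: measurableI => //; rewrite -[X in measurable X]setTI; exact: mZ'.
      + move=> m n _ _ [w [[/= <- _] [/= <- _]]]//.
      + apply: bigcup_measurable => n _; apply: measurableI => //.
        by rewrite -[X in measurable X]setTI; exact: mZ'.
    apply/seteqP; split => [w /= Aw|w [n _ [/= <-]]].
      by exists (D' w) => //; split => //=; rewrite /xsection/= inE.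
    by rewrite /xsection/= inE.
  rewrite (dec (D j k.+1) (Z j k.+1)); last 2 first.
  - by move=> n; exact: mD.
  - exact: mZ.
  rewrite dec//; apply: eq_eseriesr => n _; exact: DZ_law.
pose d1 := distribution P (mfun_Sub (mem_set mm)).
pose d2 := distribution P (mfun_Sub (mem_set mm0)).
transitivity (\int[d1]_x f x)%E; first by rewrite ge0_integral_distribution.
transitivity (\int[d2]_x f x)%E; last by rewrite ge0_integral_distribution.
by apply: eq_measure_integral => A mA _; exact: E.
Qed.

(** The process prescribes the law of increments and starts at 0 only almost surely, so count and
    increment are compared on the event that the count at time 0 vanishes. *)
Lemma poisson_law j a n : (1 <= j <= T)%N -> 0 < a ->
  P (M j a @^-1` [set n]) = (poisson_pmf (lam j * a) n)%:E.
Proof.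
move=> jT a0; have [mM [M0 [pois _]]] := poisM j jT.
rewrite -[a in RHS]subr0 -(pois 0 a n); last by rewrite lexx.
have m0 : measurable [set w | M j 0 w = 0%N] by exact: mM.
have ma : measurable (M j a @^-1` [set n]) by apply: mM; exact: ltW.
have mdiff : measurable [set w | (M j a w)%:R - (M j 0 w)%:R = n%:R :> R].
  have mfM b : 0 <= b -> measurable_fun setT (fun w => (M j b w)%:R : R).
    move=> b0; apply: (@measurableT_comp _ _ _ _ _ _ (fun n : nat => n%:R : R)) => //.
    by apply: measurable_fun_nat => m; exact: mM.
  rewrite -[X in measurable X]setTI.
  have := measurable_funB (mfM _ (ltW a0)) (mfM _ (lexx 0)).
  by move=> /(_ measurableT [set n%:R] (measurable_set1 _)).
have null : P (~` [set w | M j 0 w = 0%N]) = 0%E.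
  by rewrite probability_setC// M0 subee.
have cap A : measurable A -> P A = P (A `&` [set w | M j 0 w = 0%N]).
  move=> mA; rewrite -[A in LHS](setIT A) -(setUv [set w | M j 0 w = 0%N]) setIUr measureU.
  - rewrite [X in (_ + X)%E](_ : _ = 0%E) ?adde0//.
    apply: (subset_measure0 _ _ _ null) => //; [|exact: measurableC].
    by apply: measurableI => //; exact: measurableC.
  - exact: measurableI.
  - by apply: measurableI => //; exact: measurableC.
  - by rewrite setICA -setIA setICr !setI0.
rewrite cap// [RHS]cap//; congr (P _); apply/seteqP; split => w /= [h1 h2]; split => //.
  by rewrite h1 h2 subr0.
by move: h1; rewrite h2 subr0 => /eqP; rewrite eqr_nat => /eqP.
Qed.

Lemma poisson_rec j a n : (1 <= j <= T)%N -> 0 < a ->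
  (n.+1%:R%:E * P (M j a @^-1` [set n.+1]) = (lam j * a)%:E * P (M j a @^-1` [set n]))%E.
Proof.
move=> jT a0; rewrite !poisson_law// -!EFinM; congr EFin.
have la : 0 < lam j * a by rewrite mulr_gt0// lam_gt0.
rewrite /poisson_pmf la exprS factS natrM; field.
by rewrite pnatr_eq0 -lt0n fact_gt0 nat1r pnatr_eq0.
Qed.

(** Claims weighted by a function of their delay. The indicator of the delays up to [t] gives back
    [claims], and differences of such indicators give the claims reported between two delays. *)
Definition wclaims (c : nat -> R) (j : nat) (a : R) (w : Omega) : R :=
  \sum_(1 <= k < (M j a w).+1) Z j k w * c (D j k w).

Let wt (c : nat -> R) (x : nat * R) : R := x.2 * c x.1.

Let mwt c : measurable_fun setT (wt c).
Proof.
apply: measurable_funM; first exact: measurable_snd.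
have mc : measurable_fun setT c by [].
exact: measurable_fun_fst.
Qed.

Let total (f : nat * R -> R) j a w := mark_sum (mark j) f (M j a w) w.

Lemma wclaimsE c j a w : wclaims c j a w = total (wt c) j a w.
Proof. by rewrite /wclaims big_add1 big_mkord. Qed.

Let bigmark_year j : \bigcup_k mark_events j k `<=` year j.
Proof. by move=> A [k _ Ak]; right; exists k.+1. Qed.

Lemma year_measurable j : (1 <= j <= T)%N -> year j `<=` measurable.
Proof.
move=> jT A [[a a0 [n _ <-]]|[[//|k] _ Ak]].
  by have [mM _] := poisM j jT; exact: mM.
exact: mark_events_measurable jT _ Ak.
Qed.

Lemma measurable_total (f : nat * R -> R) j a : (1 <= j <= T)%N -> 0 <= a ->
  measurable_fun setT f -> measurable_fun setT (total f j a : g_sigma_algebraType (year j) -> R).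
Proof.
move=> jT a0 mf; apply: (@measurable_random_index _ _ (g_sigma_algebraType (year j)) _
  (M j a) (mark_sum (mark j) f)).
  by move=> n; apply: sub_sigma_algebra; left; exists a => //; exists n.
move=> n; apply: (measurable_fun_g_sigma_sub (\bigcup_k mark_events j k)).
  by move=> A /bigmark_year; exact: sub_sigma_algebra.
by apply: measurable_mark_sum_all => // k; exact: measurable_mark.
Qed.

Lemma measurable_wclaims_year c j a : (1 <= j <= T)%N -> 0 <= a ->
  measurable_fun setT (wclaims c j a : g_sigma_algebraType (year j) -> R).
Proof.
move=> jT a0; rewrite (_ : wclaims c j a = total (wt c) j a).
  exact: measurable_total.
by apply/funext => w; exact: wclaimsE.
Qed.

Lemma measurable_wclaims c j a : (1 <= j <= T)%N -> 0 <= a ->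
  measurable_fun setT (wclaims c j a).
Proof.
move=> jT a0; apply: measurable_fun_g_sigma (year_measurable j jT) _.
exact: measurable_wclaims_year.
Qed.

Let mDZ0 : measurable_fun setT (fun w => (D0 w, Z0 w)).
Proof. by apply: measurable_fun_pair => //; exact: measurable_fun_nat. Qed.

Lemma mecke_year (I : Type) (h : I -> nat * R -> R) (rho : nat * R -> R) j a :
  (1 <= j <= T)%N -> 0 < a -> (forall i, measurable_fun setT (h i)) ->
  measurable_fun setT rho -> (forall x, 0 <= rho x) ->
  mecke_identity P (total rho j a) (fun i => total (h i) j a)
    (fun w => rho (D0 w, Z0 w)) (fun i w => h i (D0 w, Z0 w)) (lam j * a).
Proof.
move=> jT a0 mh mrho rho0 G mG G0.
have [mM _] := poisM j jT.
apply: (mecke_marks P (mark j) (fun w => (D0 w, Z0 w)) (mark_events j) _ _ _ mDZ0 _ h rho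
   mh mrho rho0 (M j a) (\bigcup_(a in [set a : R | 0 <= a]) events_nat (M j a))) => //.
- by move=> k; exact: mark_events_measurable.
- by move=> k; exact: measurable_mark.
- move=> k; apply: (mutually_independent_others P nat (fun k => <<s mark_events j k >>)).
  + by move=> k'; apply: g_sigma_measurable; exact: mark_events_measurable.
  + by move=> k'; exact: g_sigma_setT.
  + by move=> k'; exact: g_sigma_setI.
  + exact: marks_ind.
- by move=> k f; exact: mark_law.
- by move=> A [b /= b0 [n _ <-]]; exact: mM.
- by move=> n; apply: sub_sigma_algebra; exists a; [exact: ltW|exists n].
- rewrite (_ : \bigcup_k mark_events j k = \bigcup_(k in [set k : nat | (1 <= k)%N])
      (events_nat (D j k) `|` events_real (Z j k))); first exact: marks_M_ind.
  apply/seteqP; split => [A [k _ Ak]|A [[//|k] _ Ak]]; first by exists k.+1.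
  by exists k.
- by move=> n; exact: poisson_rec.
- by rewrite mulr_ge0 ?ltW// lam_gt0.
Qed.

Let rp (c : nat -> R) (x : nat * R) : R := Num.max 0 (wt c x).
Let rn (c : nat -> R) (x : nat * R) : R := Num.max 0 (- wt c x).

Let rpn c x : rp c x - rn c x = wt c x.
Proof.
rewrite /rp /rn; have [h|h] := leP 0 (wt c x).
  by rewrite max_l ?subr0// oppr_le0.
by rewrite max_r ?sub0r ?opprK// oppr_ge0 ltW.
Qed.

Let rp_ge0 c x : 0 <= rp c x. Proof. by rewrite le_max lexx. Qed.
Let rn_ge0 c x : 0 <= rn c x. Proof. by rewrite le_max lexx. Qed.
Let mrp c : measurable_fun setT (rp c).
Proof. exact: measurable_maxr. Qed.
Let mrn c : measurable_fun setT (rn c).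
Proof. by apply: measurable_maxr => //; exact: measurableT_comp. Qed.

Definition mark0 (c : nat -> R) (w : Omega) : R := Z0 w * c (D0 w).

Lemma measurable_mark0 c : measurable_fun setT (mark0 c).
Proof. exact: (measurableT_comp (mwt c) mDZ0). Qed.

(** Delays lie between 1 and [T], so a weight takes finitely many values on them and the
    square-integrability of [Z0] carries over to weighted marks. *)
Let cbound (c : nat -> R) : R := \sum_(t < T.+1) `|c t|.

Let c_le (c : nat -> R) w : `|c (D0 w)| <= cbound c.
Proof.
have DT : (D0 w < T.+1)%N by rewrite ltnS; have /andP[] := D0T w.
rewrite /cbound (bigD1 (Ordinal DT))//= lerDl; exact: sumr_ge0.
Qed.

Lemma rint_mark0_sqr c : rint (fun w => mark0 c w ^+ 2).
Proof.
have mc : measurable_fun setT (fun w => c (D0 w) ^+ 2).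
  apply: measurable_funX; apply: (@measurableT_comp _ _ _ _ _ _ c) => //.
  exact: measurable_fun_nat.
have := rintM _ _ _ (cbound c ^+ 2) iZ2 mc.
have cb w : `|c (D0 w) ^+ 2| <= cbound c ^+ 2.
  rewrite normrX ler_sqr ?nnegrE//; exact: sumr_ge0.
move=> /(_ cb); apply: eq_integrable => // w _.
by rewrite /= /mark0 exprMn.
Qed.

Lemma rint_mark0 c : rint (mark0 c).
Proof.
apply: (rint_le _ _ (fun w => 1 + mark0 c w ^+ 2)).
- exact: measurable_mark0.
- move=> w; rewrite -[mark0 c w ^+ 2]real_normK ?num_real//.
  by have := normr_ge0 (mark0 c w); nra.
- exact: rintD (rint_cst _ _) (rint_mark0_sqr c).
Qed.

Let other_years (j0 : 'I_T) := \bigcup_(j in [set j : 'I_T | j != j0]) <<s year j.+1 >>.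

Lemma other_years_measurable j0 : other_years j0 `<=` measurable.
Proof.
by move=> A [j _]; apply: g_sigma_measurable; apply: year_measurable; exact: ord_year.
Qed.

Lemma year_other_years_independent (j0 : 'I_T) :
  independent P <<s year j0.+1 >> <<s other_years j0 >>.
Proof.
apply: (mutually_independent_others P 'I_T (fun j => <<s year j.+1 >>)).
- by move=> j; apply: g_sigma_measurable; apply: year_measurable; exact: ord_year.
- by move=> j; exact: g_sigma_setT.
- by move=> j; exact: g_sigma_setI.
- exact: years_ind.
Qed.

Lemma measurable_wclaims_other (j0 j : 'I_T) c a : j != j0 -> 0 <= a ->
  measurable_fun setT (wclaims c j.+1 a : g_sigma_algebraType (other_years j0) -> R).
Proof.
move=> jj0 a0.
apply: measurable_fun_g_sigma_sub (measurable_wclaims_year c j.+1 a (ord_year j) a0).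
by move=> A yA; apply: sub_sigma_algebra; exists j => //; exact: sub_sigma_algebra.
Qed.

(** Year [j0.+1] supplies the extra mark, and the other years enter every statistic as an
    independent addend. [I] indexes the statistics tested jointly: [unit] serves Stein's method,
    pairs of a year and a delay serve the observed events. *)
Lemma mecke_model (I : Type) (c : I -> 'I_T -> nat -> R) (j0 : 'I_T) (x : nat -> R) (a : R)
    (G : (I -> R) -> R) (K : R) : 0 < a -> product_measurable G -> (forall v, `|G v| <= K) ->
  rint (wclaims x j0.+1 a) /\
  \int[P]_w (wclaims x j0.+1 a w * G (fun i => \sum_(j < T) wclaims (c i j) j.+1 a w)) =
  lam j0.+1 * a * \int[P]_w' (mark0 x w' *
    \int[P]_w G (fun i => \sum_(j < T) wclaims (c i j) j.+1 a w + mark0 (c i j0) w')).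
Proof.
move=> a0 mG GK.
have jT := ord_year j0.
pose U i := total (wt (c i j0)) j0.+1 a.
pose V i w := \sum_(j < T | j != j0) wclaims (c i j) j.+1 a w.
have othersm := other_years_measurable j0; have ind := year_other_years_independent j0.
have mV i : measurable_fun setT (V i : g_sigma_algebraType (other_years j0) -> R).
  rewrite /V; under eq_fun do rewrite big_mkcond.
  apply: (@measurable_sum _ (g_sigma_algebraType (other_years j0))) => j.
  case: (eqVneq j j0) => [|jj0]; first by move=> _; exact: measurable_cst.
  by apply: measurable_wclaims_other => //; exact: ltW.
have UV : (fun i w => \sum_(j < T) wclaims (c i j) j.+1 a w) = (fun i w => U i w + V i w).
  by apply/funext => i; apply/funext => w; rewrite (bigD1 j0)//= wclaimsE.
have id_ (rho : nat * R -> R) : measurable_fun setT rho -> (forall x, 0 <= rho x) ->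
    mecke_identity P (total rho j0.+1 a) (fun i w => U i w + V i w)
     (fun w => rho (D0 w, Z0 w)) (fun i w => mark0 (c i j0) w) (lam j0.+1 * a).
  move=> mrho rho0.
  apply: (mecke_identity_add P _ _ _ _ _ V (year j0.+1) (other_years j0)) => //.
  - exact: year_measurable.
  - by apply: measurable_total => //; exact: ltW.
  - by move=> i; apply: measurable_total => //; exact: ltW.
  - exact: (measurableT_comp mrho mDZ0).
  - by move=> i; exact: measurable_mark0.
  - by move=> w; exact: sumr_ge0.
  - by rewrite mulr_ge0 ?ltW// lam_gt0.
  - exact: (mecke_year _ (fun i => wt (c i j0))).
have mtot f : measurable_fun setT f -> measurable_fun setT (total f j0.+1 a).
  move=> mf; apply: measurable_fun_g_sigma (year_measurable _ jT) _.
  by apply: measurable_total => //; exact: ltW.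
have mUV i : measurable_fun setT (fun w => U i w + V i w).
  by apply: measurable_funD; [exact: mtot|exact: measurable_fun_g_sigma othersm (mV i)].
have irho (rho : nat * R -> R) : measurable_fun setT rho -> (forall z, `|rho z| <= `|wt x z|) ->
    rint (fun w => rho (D0 w, Z0 w)).
  move=> mrho rhole; apply: (rint_le _ _ (fun w => `|mark0 x w|)).
  - exact: (measurableT_comp mrho mDZ0).
  - by move=> w; exact: rhole.
  - exact: rint_norm (rint_mark0 x).
have := mecke_signed P (total (rp x) j0.+1 a) (total (rn x) j0.+1 a) (fun i w => U i w + V i w)
  (fun w => rp x (D0 w, Z0 w)) (fun w => rn x (D0 w, Z0 w)) (fun i w => mark0 (c i j0) w)
  (lam j0.+1 * a) G K.
case=> //.
- exact: mtot.
- exact: mtot.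
- apply: irho => // z; rewrite /rp ger0_norm ?le_max ?lexx// ge_max normr_ge0 ler_norm//.
- apply: irho => // z; rewrite /rn ger0_norm ?le_max ?lexx// ge_max normr_ge0/= -normrN ler_norm//.
- by move=> i; exact: measurable_mark0.
- by move=> w; exact: sumr_ge0.
- by move=> w; exact: sumr_ge0.
- by rewrite mulr_ge0 ?ltW// lam_gt0.
- exact: id_.
- exact: id_.
have totB w : total (rp x) j0.+1 a w - total (rn x) j0.+1 a w = wclaims x j0.+1 a w.
  rewrite wclaimsE /total /mark_sum -sumrB; apply: eq_bigr => k _; exact: rpn.
move=> i1 e1; split; first by move: i1; apply: eq_integrable => // w _; rewrite /= totB.
transitivity (\int[P]_w ((total (rp x) j0.+1 a w - total (rn x) j0.+1 a w) *
     G (fun i => U i w + V i w))).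
  by apply: eq_Rintegral => w _; rewrite totB; congr (_ * G _);
     apply/funext => i; rewrite (bigD1 j0)//= wclaimsE.
rewrite e1; congr (_ * _); apply: eq_Rintegral => w' _; rewrite rpn; congr (_ * _).
by apply: eq_Rintegral => w _; congr G;
     apply/funext => i; rewrite (bigD1 j0)//= wclaimsE.
Qed.

(** * Linear statistics of the claims: tightness, normality and law of large numbers *)

Definition lin (y : 'I_T -> nat -> R) (a : R) (w : Omega) : R :=
  \sum_(j < T) wclaims (y j) j.+1 a w.

Local Notation js := (index_enum (ordinal T)).
Local Notation kappa := (fun j : 'I_T => lam j.+1).
Local Notation mean y := (cp_mean P js kappa (fun j : 'I_T => mark0 (y j))).
Local Notation var y := (cp_var P js kappa (fun j : 'I_T => mark0 (y j))).
Local Notation std y := (fun a => cp_std P js kappa (fun j : 'I_T => mark0 (y j)) a (lin y a)).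

Let kappa_ge0 (j : 'I_T) : 0 <= lam j.+1.
Proof. by apply: ltW; apply: lam_gt0; exact: ord_year. Qed.

(** Integrability is the first conclusion of Mecke's identity, here taken with the zero
    functional. *)
Lemma rint_wclaims c (j : 'I_T) a : 0 < a -> rint (wclaims c j.+1 a).
Proof.
move=> a0; have [] // := mecke_model unit (fun _ _ _ => 0) j c a (fun=> 0) 0 a0.
by move=> v; rewrite normr0.
Qed.

Lemma measurable_lin y a : 0 <= a -> measurable_fun setT (lin y a).
Proof.
move=> a0; apply: measurable_sum => j; apply: measurable_wclaims => //; exact: ord_year.
Qed.

Lemma rint_lin y a : 0 < a -> rint (lin y a).
Proof. by move=> a0; apply: rint_sum => j; exact: rint_wclaims. Qed.

(** Mecke's identity summed over the years, each of which contributes one summand of [lin]; it is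
    the hypothesis [size_bias] of the central limit theorem. *)
Lemma lin_size_bias y a (G : R -> R) (K : R) : 0 < a -> measurable_fun setT G ->
  (forall x, `|G x| <= K) ->
  \int[P]_w (lin y a w * G (lin y a w)) = a * \sum_(j <- js) lam j.+1 *
    \int[P]_w' (mark0 (y j) w' * \int[P]_w G (lin y a w + mark0 (y j) w')).
Proof.
move=> a0 mG GK.
under eq_Rintegral do rewrite {1}/lin mulr_suml.
have mGl : measurable_fun setT (fun w => G (lin y a w)).
  by apply: (measurableT_comp mG); apply: measurable_lin; exact: ltW.
rewrite (Rintegral_sum P _ _ (fun j w => wclaims (y j) j.+1 a w * G (lin y a w))); last first.
  by move=> j; apply: (rintM _ _ _ K) => //; exact: rint_wclaims.
rewrite mulr_sumr; apply: eq_bigr => j _; rewrite mulrCA mulrA.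
have [_ ->] := mecke_model unit (fun _ => y) j (y j) a (fun v => G (v tt)) K a0
  (fun d' T' u mu => measurableT_comp mG (mu tt)) (fun v => GK _).
by [].
Qed.

Lemma measurable_std y : measurable_family (std y).
Proof. by move=> a a0; apply: measurable_cp_std; exact: rint_lin. Qed.

Lemma std_tight y : tight P (std y).
Proof.
move=> e e0; have v0 : 0 <= var y.
  apply: sumr_ge0 => j _; rewrite mulr_ge0//; apply: Rintegral_ge0 => w _; exact: sqr_ge0.
(* With k = 1 + var / e, the bound k^2 x <= var on the tail probability x and k >= 1 give k x <= var
   <= k e. *)
have k1 : 1 <= 1 + var y / e by rewrite lerDl divr_ge0// ltW.
have k0 : 0 < 1 + var y / e by exact: lt_le_trans k1.
exists (1 + var y / e) => //; near=> a; have a0 : 0 < a by near: a; exact: nbhs_pinfty_gt.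
have := cp_std_tight P js kappa (fun j : 'I_T => mark0 (y j)) a (lin y a) kappa_ge0
  (fun j => measurable_mark0 _) (fun j => rint_mark0_sqr _) a0 (rint_lin y a a0)
  (fun G K => lin_size_bias y a G K a0) _ k0.
set k := 1 + _ in k0 k1 *; set x := exceed _ _ _ => h.
have x0 : 0 <= x by exact: exceed_ge0.
have h1 : k * x <= var y.
  by apply: le_trans h; rewrite ler_wpM2r// expr2 ler_peMl// ltW.
have h2 : var y <= k * e by rewrite /k mulrDl divfK ?lt0r_neq0// mul1r lerDr ltW.
by rewrite -(ler_pM2l k0) (le_trans h1).
Unshelve. all: by end_near. Qed.

Lemma std_clt y : 0 < var y -> cvg_in_law P (std y) (normal_prob 0 (Num.sqrt (var y))).
Proof.
apply: compound_poisson_clt => //.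
- by move=> j; exact: measurable_mark0.
- by move=> j; exact: rint_mark0_sqr.
- by move=> a a0; exact: rint_lin.
- by move=> a a0 G K mG GK; exact: (lin_size_bias y a G K).
Qed.

(** The deviation is [std y a / sqrt a], which tends to 0 in probability because [std y] is
    tight. *)
Lemma lin_lln y : cvg_prob0 P (fun a w => lin y a w / a - mean y).
Proof.
have := tight_divsqrt P _ (measurable_std y) (std_tight y).
move=> H k k0 e e0; near=> a; have a0 : 0 < a by near: a; exact: nbhs_pinfty_gt.
rewrite (_ : (fun w => _) = fun w => std y a w / Num.sqrt a).
  by near: a; exact: H.
apply/funext => w; rewrite /cp_std -mulrA -invfM -expr2 sqr_sqrtr ?ltW//.
by rewrite mulrBl [a * _]mulrC mulfK ?lt0r_neq0.
Unshelve. all: by end_near. Qed.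

Lemma lin_linear (y z : 'I_T -> nat -> R) (k l : R) a w :
  lin (fun j n => k * y j n + l * z j n) a w = k * lin y a w + l * lin z a w.
Proof.
rewrite /lin !mulr_sumr -big_split/=; apply: eq_bigr => j _.
rewrite /wclaims !mulr_sumr -big_split/=; apply: eq_bigr => i _; ring.
Qed.

Lemma mean_linear (y z : 'I_T -> nat -> R) (k l : R) :
  mean (fun j n => k * y j n + l * z j n) = k * mean y + l * mean z.
Proof.
rewrite /cp_mean !mulr_sumr -big_split/=; apply: eq_bigr => j _.
rewrite (mulrCA k) (mulrCA l) -mulrDr; congr (_ * _).
have i1 := rint_mark0 (y j); have i2 := rint_mark0 (z j).
rewrite -!RintegralZl// -RintegralD//; [|exact: rintZl|exact: rintZl].
by apply: eq_Rintegral => w _; rewrite /mark0; ring.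
Qed.

Lemma sqr_Rintegral_le (X : Omega -> R) : rint X -> rint (fun w => X w ^+ 2) ->
  (\int[P]_w X w) ^+ 2 <= \int[P]_w (X w ^+ 2).
Proof.
move=> iX iX2; set m := \int[P]_w X w.
have : 0 <= \int[P]_w ((X w - m) ^+ 2) by apply: Rintegral_ge0 => w _; exact: sqr_ge0.
have -> : \int[P]_w ((X w - m) ^+ 2) = \int[P]_w (X w ^+ 2) - (2 * m) * m + m ^+ 2.
  rewrite {3}/m -RintegralZl// -RintegralB//; last exact: rintZl.
  rewrite -[m ^+ 2](Rintegral_cstT P) -RintegralD//; last 2 first.
  - by apply: rintB => //; exact: rintZl.
  - exact: rint_cst.
  by apply: eq_Rintegral => w _; ring.
lra.
Qed.

(** [var y] is a sum of second moments, so a single year is enough; there the second moment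
    dominates that of [mark0 c], which is at least its squared mean. *)
Lemma var_gt0 (y : 'I_T -> nat -> R) (j : 'I_T) (c : nat -> R) :
  (forall n, `|c n| <= `|y j n|) -> \int[P]_w mark0 c w != 0 -> 0 < var y.
Proof.
move=> cy c0; rewrite /cp_var (bigD1 j)//=; apply: ltr_wpDr.
  apply: sumr_ge0 => i _; rewrite mulr_ge0//; apply: Rintegral_ge0 => w _; exact: sqr_ge0.
rewrite mulr_gt0 ?lam_gt0 ?ord_year//.
apply: (@lt_le_trans _ _ (\int[P]_w (mark0 c w ^+ 2))).
  apply: lt_le_trans (sqr_Rintegral_le _ (rint_mark0 c) (rint_mark0_sqr c)).
  by rewrite lt_neqAle sqr_ge0 eq_sym expf_neq0.
apply: le_Rintegral => //; [exact: rint_mark0_sqr|exact: rint_mark0_sqr|].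
move=> w _; rewrite /mark0 !exprMn ler_wpM2l ?sqr_ge0//.
by rewrite -[leLHS]real_normK ?num_real// -[leRHS]real_normK ?num_real// ler_sqr.
Qed.

(** * Development factors and linearisation of one chain-ladder factor *)

Hypothesis EZD_gt0 : forall t, (1 <= t <= T)%N ->
  (0 < 'E_P[(fun w => Z0 w * (D0 w == t)%:R)%R])%E.
Local Notation f := (dev_factor P D0 Z0).
Local Notation fh := (fhat M D Z T).
Local Notation upto := (fun t n : nat => (n <= t)%:R).

Definition mean_upto (t : nat) : R := \int[P]_w mark0 (upto t) w.

Lemma mean_eq_gt0 t : (1 <= t <= T)%N -> 0 < \int[P]_w mark0 (fun n => (n == t)%:R) w.
Proof.
move=> tT; have := EZD_gt0 t tT; rewrite unlock => h.
have i := rint_mark0 (fun n => (n == t)%:R).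
by rewrite -lte_fin EFin_Rintegral.
Qed.

Lemma mean_uptoS t : mean_upto t.+1 = mean_upto t + \int[P]_w mark0 (fun n => (n == t.+1)%:R) w.
Proof.
have i1 := rint_mark0 (upto t); have i2 := rint_mark0 (fun n => (n == t.+1)%:R).
rewrite /mean_upto -RintegralD//; apply: eq_Rintegral => w _.
rewrite /mark0 -mulrDr; congr (_ * _); rewrite -natrD; congr (_%:R).
by case: (ltngtP (D0 w) t.+1) => h; rewrite ?h; lia.
Qed.

Lemma mean_upto_gt0 t : (1 <= t <= T)%N -> 0 < mean_upto t.
Proof.
elim: t => // t IH /andP[_ tT]; rewrite mean_uptoS.
have h := mean_eq_gt0 t.+1 tT.
case: t IH tT h => [|t] IH tT h; last by apply: addr_gt0 => //; apply: IH; rewrite /= ltnW.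
(* Delays start at 1, so [mean_upto 0] vanishes. *)
rewrite [X in X + _](_ : _ = 0) ?add0r// -[RHS](Rintegral_cstT P).
apply: eq_Rintegral => w _; have /andP[h1 _] := D0T w.
by rewrite /mark0 leqn0 -[D0 w == 0%N]negbK -lt0n h1 mulr0.
Qed.

Lemma dev_factorE t : f t = mean_upto t.+1 / mean_upto t.
Proof. by rewrite /dev_factor unlock. Qed.

Let early s t : 'I_T -> nat -> R := fun j n => (j.+1 <= T - s)%:R * upto t n.

Lemma sum_claimsE s t a w :
  \sum_(1 <= j < (T - s).+1) claims M D Z j t a w = lin (early s t) a w.
Proof.
rewrite big_add1 big_mkord (big_ord_widen T (fun j => claims M D Z j.+1 t a w)) ?leq_subr//.
rewrite big_mkcond/=; apply: eq_bigr => j _; rewrite /early /wclaims.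
case: ifP => _; last by rewrite big1// => k _; rewrite mul0r mulr0.
by apply: eq_bigr => k _; rewrite mul1r.
Qed.

Let Lam s : R := \sum_(j < T) lam j.+1 * (j.+1 <= T - s)%:R.

Lemma mean_early s t : mean (early s t) = Lam s * mean_upto t.
Proof.
rewrite /cp_mean /Lam mulr_suml; apply: eq_bigr => j _; rewrite -mulrA; congr (_ * _).
have i1 := rint_mark0 (upto t).
rewrite /mean_upto -RintegralZl//; apply: eq_Rintegral => w _.
by rewrite /mark0 /early; ring.
Qed.

Lemma Lam_gt0 s : (s < T)%N -> 0 < Lam s.
Proof.
move=> sT; have T0 : (0 < T)%N by exact: leq_ltn_trans sT.
rewrite /Lam (bigD1 (Ordinal T0))//= subn_gt0 sT mulr1.
apply: ltr_wpDr; last by apply: lam_gt0.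
by apply: sumr_ge0 => j _; rewrite mulr_ge0.
Qed.

Lemma mean_early_gt0 s : (1 <= s < T)%N -> 0 < mean (early s s).
Proof.
move=> /andP[s1 sT]; rewrite mean_early mulr_gt0 ?Lam_gt0//.
by apply: mean_upto_gt0; rewrite s1 ltnW.
Qed.

(* Weights of the residual [sum_j C_{j,s+1} - f_s sum_j C_{j,s}] over the years
   [j <= T - s]; the shape [1 * _ + _ * _] is the one of [lin_linear]. *)
Let resid s : 'I_T -> nat -> R := fun j n => 1 * early s s.+1 j n + (- f s) * early s s j n.

(** Numerator and denominator of the estimator run over the same years, so [Lam s] cancels and [f s]
    is the ratio of their means. *)
Lemma mean_resid s : (1 <= s < T)%N -> mean (resid s) = 0.
Proof.
move=> /andP[s1 sT]; rewrite mean_linear !mean_early dev_factorE.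
have m0 : mean_upto s != 0 by rewrite lt0r_neq0// mean_upto_gt0// s1 ltnW.
by field.
Qed.

Lemma std_mean0 y a w : mean y = 0 -> std y a w = lin y a w / Num.sqrt a.
Proof. by move=> y0; rewrite /cp_std y0 mulr0 subr0. Qed.

Lemma measurable_fhat s : measurable_family (fh s).
Proof.
move=> a a0; have a0' := ltW a0.
rewrite (_ : fh s a = fun w => lin (early s s.+1) a w * (lin (early s s) a w)^-1).
  apply: measurable_funM; first exact: measurable_lin.
  by apply: (measurableT_comp measurable_invr); exact: measurable_lin.
by apply/funext => w; rewrite /fhat !sum_claimsE.
Qed.

Lemma measurable_sqrtM (X : R -> Omega -> R) : measurable_family X ->
  measurable_family (fun a w => Num.sqrt a * X a w).
Proof. by move=> mX a a0; apply: measurable_funM => //; exact: mX. Qed.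

Lemma measurable_familyB (X Y : R -> Omega -> R) : measurable_family X ->
  measurable_family Y -> measurable_family (fun a w => X a w - Y a w).
Proof. by move=> mX mY a a0; apply: measurable_funB; [exact: mX|exact: mY]. Qed.

Lemma measurable_familyM (X Y : R -> Omega -> R) : measurable_family X ->
  measurable_family Y -> measurable_family (fun a w => X a w * Y a w).
Proof. by move=> mX mY a a0; apply: measurable_funM; [exact: mX|exact: mY]. Qed.

Lemma measurable_family_cst (X : R -> R) :
  measurable_family (fun a (_ : Omega) => X a).
Proof. by move=> a a0. Qed.

(** Where the denominator of [fh s] is nonzero, [sqrt a * (fh s - f s)] equals the standardised
    residual divided by [N], the denominator over [a]. By the law of large numbers [N] may be
    replaced by its limit [mu]. *)
Lemma fhat_linearization s : (1 <= s < T)%N ->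
  cvg_prob0 P (fun a w => Num.sqrt a * (fh s a w - f s) -
    std (resid s) a w * (mean (early s s))^-1).
Proof.
move=> sT; have mu0 := mean_early_gt0 s sT; set mu := mean _ in mu0 *.
pose N a w := lin (early s s) a w / a.
have mN : measurable_family N.
  by move=> a a0; apply: measurable_funM => //; apply: measurable_lin; exact: ltW.
have mNV : measurable_family (fun a w => (N a w)^-1).
  by move=> a a0; apply: (measurableT_comp measurable_invr); exact: mN.
have mL := measurable_std (resid s).
have hN : cvg_prob0 P (fun a w => N a w - mu) by exact: lin_lln.
have hV := cvg_prob0_inv P N mu mN mu0 hN.
pose E a w := Num.sqrt a * (fh s a w - f s) - std (resid s) a w * (N a w)^-1.
have mE : measurable_family E.
  apply: measurable_familyB; last exact: measurable_familyM.
  apply: measurable_sqrtM; apply: measurable_familyB; first exact: measurable_fhat.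
  exact: measurable_family_cst.
(* The exact identity can fail only where the denominator is 0, since [x / 0 = 0]; that event lies
   in |N - mu| > mu / 2, whose probability tends to 0. *)
have hE : cvg_prob0 P E.
  move=> k k0 e e0; near=> a; have a0 : 0 < a by near: a; exact: nbhs_pinfty_gt.
  apply: (@le_trans _ _ (exceed P (fun w => N a w - mu) (mu / 2))); last first.
    by near: a; apply: hN => //; rewrite divr_gt0.
  apply: exceed_le1f; [exact: mE|by apply: measurable_funB => //; exact: mN|].
  move=> w; rewrite ler_norml => /andP[h _].
  have mu2 : 0 < mu / 2 by rewrite divr_gt0.
  have N0 : 0 < N a w by lra.
  rewrite (_ : E a w = 0) ?normr0 ?ltW//.
  have l0 : lin (early s s) a w != 0.
    by apply: contraTneq N0 => l0; rewrite /N l0 mul0r ltxx.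
  have sa0 : Num.sqrt a != 0 by rewrite lt0r_neq0// sqrtr_gt0.
  have ra : a = Num.sqrt a ^+ 2 by rewrite sqr_sqrtr// ltW.
  rewrite /E std_mean0; last exact: mean_resid.
  rewrite /N /resid lin_linear /fhat !sum_claimsE.
  set r := Num.sqrt a in ra sa0 *; set l := lin (early s s) a w in l0 *.
  set u := lin _ _ _; rewrite ra; field; rewrite sa0.
  by rewrite l0.
have hL := cvg_prob0M P _ _ (measurable_familyB _ _ mNV (measurable_family_cst _)) mL hV
  (std_tight (resid s)).
have := cvg_prob0D P _ _ mE (measurable_familyM _ _ (measurable_familyB _ _ mNV
  (measurable_family_cst (fun=> mu^-1))) mL) hE hL.
move=> H k k0 e e0; have := H k k0 e e0; apply: filterS => a.
rewrite (_ : (fun w => E a w + _) = (fun w => Num.sqrt a * (fh s a w - f s) -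
    std (resid s) a w * mu^-1))//.
by apply/funext => w; rewrite /E; ring.
Unshelve. all: by end_near. Qed.

(** * Products of chain-ladder factors *)

Section chain_ladder.
Variable t0 : nat.
Hypothesis t0_ge1 : (1 <= t0)%N.

Let prodf k := \prod_(t0 <= s < t0 + k) f s.
Let prodfh k a w := \prod_(t0 <= s < t0 + k) fh s a w.

(* Weights of the linear statistic equivalent to [sqrt a (prod fhat - prod f)],
   from the product rule applied to one factor after the other. *)
Fixpoint ladder (k : nat) : 'I_T -> nat -> R :=
  if k is k'.+1 then fun j n => f (t0 + k') * ladder k' j n +
    (prodf k' * (mean (early (t0 + k') (t0 + k')))^-1) * resid (t0 + k') j n
  else fun _ _ => 0.

Lemma f_gt0 s : (1 <= s < T)%N -> 0 < f s.
Proof.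
move=> /andP[s1 sT]; have h1 : (1 <= s <= T)%N by rewrite s1 ltnW.
by rewrite dev_factorE; apply: divr_gt0; apply: mean_upto_gt0.
Qed.

Lemma prodf_gt0 k : (t0 + k <= T)%N -> 0 < prodf k.
Proof.
move=> kT; rewrite /prodf big_nat; apply: prodr_gt0 => s /andP[t0s sk].
by apply: f_gt0; rewrite (leq_trans t0_ge1)//= (leq_trans sk).
Qed.

Lemma mean_ladder k : (t0 + k <= T)%N -> mean (ladder k) = 0.
Proof.
elim: k => [|k IH] kT.
  rewrite /cp_mean big1// => j _; rewrite (_ : \int[P]_w _ = 0) ?mulr0//.
  rewrite -[RHS](Rintegral_cstT P); apply: eq_Rintegral => w _; exact: mulr0.
rewrite addnS in kT.
rewrite [ladder _]/= mean_linear IH ?(ltnW kT)// mean_resid ?mulr0 ?addr0//.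
by rewrite (leq_trans t0_ge1) ?leq_addr.
Qed.

Lemma measurable_prodfh k : measurable_family (prodfh k).
Proof.
move=> a a0; rewrite /prodfh; apply: measurable_prod => s _; exact: measurable_fhat.
Qed.

(** With Q and R the scaled errors of the product and of the next factor, the new scaled error is Q
    f + (R / sqrt a) Q + R prodf. The cross term vanishes in probability because Q and R are tight,
    and tightness itself follows from the linearisations. *)
Lemma ladder_linearization k : (t0 + k <= T)%N ->
  cvg_prob0 P (fun a w => Num.sqrt a * (prodfh k a w - prodf k) - std (ladder k) a w).
Proof.
elim: k => [|k IH] kT.
  move=> k k0 e e0; near=> a; have a0 : 0 < a by near: a; exact: nbhs_pinfty_gt.
  rewrite [X in exceed P X k](_ : _ = fun=> 0); last first.
    apply/funext => w; rewrite std_mean0; last exact: mean_ladder.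
    rewrite /prodfh /prodf !addn0 !big_geq// subrr mulr0 sub0r.
    rewrite /lin big1 ?mul0r ?oppr0// => j _.
    by rewrite /wclaims big1// => l _; rewrite mulr0.
  rewrite exceedE//; under eq_Rintegral do rewrite normr0 ltNge (ltW k0).
  by rewrite Rintegral_cstT ltW.
rewrite addnS in kT; have kT' := ltnW kT.
have sT : (1 <= t0 + k < T)%N by rewrite kT (leq_trans t0_ge1) ?leq_addr.
set s := (t0 + k)%N in sT *.
have {}IH := IH kT'.
pose Q a w := Num.sqrt a * (prodfh k a w - prodf k).
pose Rs a w := Num.sqrt a * (fh s a w - f s).
have mQ : measurable_family Q.
  apply: measurable_sqrtM; apply: measurable_familyB; first exact: measurable_prodfh.
  exact: measurable_family_cst.
have mR : measurable_family Rs.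
  apply: measurable_sqrtM; apply: measurable_familyB; first exact: measurable_fhat.
  exact: measurable_family_cst.
have mSl := measurable_std (ladder k).
have mSr := measurable_std (resid s).
have tQ : tight P Q.
  have := tightD P _ _ (measurable_familyB _ _ mQ mSl) mSl (cvg_prob0_tight P _ IH) (std_tight _).
  move=> H e e0; have [l l0 h] := H e e0; exists l => //; apply: filterS h => a.
  rewrite (_ : (fun w => _ - _ + _) = Q a)//.
  by apply/funext => w; rewrite subrK.
have hR := fhat_linearization s sT.
set mu := mean _ in hR.
have mRl : measurable_family (fun a w => std (resid s) a w * mu^-1).
  by apply: measurable_familyM => //; exact: measurable_family_cst.
have tR : tight P Rs.
  have := tightD P _ _ (measurable_familyB _ _ mR mRl) mRl (cvg_prob0_tight P _ hR)
    (tightM P _ _ mSr (measurable_family_cst (fun=> mu^-1)) (std_tight _) (tight_cst P mu^-1)).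
  move=> H e e0; have [l l0 h] := H e e0; exists l => //; apply: filterS h => a.
  rewrite (_ : (fun w => _ - _ + _) = Rs a)//.
  by apply/funext => w; rewrite subrK.
have h1 := cvg_prob0M P _ _ (measurable_familyB _ _ mQ mSl) (measurable_family_cst (fun=> f s)) IH
  (tight_cst P (f s)).
have mRa : measurable_family (fun a w => Rs a w / Num.sqrt a).
  by apply: measurable_familyM => //; exact: measurable_family_cst.
have h2 := cvg_prob0M P _ _ mRa mQ (tight_divsqrt P _ mR tR) tQ.
have h3 := cvg_prob0M P _ _ (measurable_familyB _ _ mR mRl) (measurable_family_cst (fun=> prodf k))
  hR (tight_cst P (prodf k)).
have m1 := measurable_familyM _ _ (measurable_familyB _ _ mQ mSl)
  (measurable_family_cst (fun=> f s)).
have m2 := measurable_familyM _ _ mRa mQ.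
have m3 := measurable_familyM _ _ (measurable_familyB _ _ mR mRl)
  (measurable_family_cst (fun=> prodf k)).
have m12 : measurable_family (fun a w => (Q a w - std (ladder k) a w) * f s +
  Rs a w / Num.sqrt a * Q a w).
  by move=> a a0; apply: measurable_funD; [exact: m1|exact: m2].
have H := cvg_prob0D P _ _ m12 m3 (cvg_prob0D P _ _ m1 m2 h1 h2) h3.
move=> l l0 e e0; near=> a; have a0 : 0 < a by near: a; exact: nbhs_pinfty_gt.
rewrite [X in exceed P X l](_ : _ = fun w => (Q a w - std (ladder k) a w) * f s +
  Rs a w / Num.sqrt a * Q a w + (Rs a w - std (resid s) a w * mu^-1) * prodf k).
  by near: a; exact: H.
apply/funext => w; have sa0 : Num.sqrt a != 0 by rewrite lt0r_neq0// sqrtr_gt0.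
rewrite std_mean0; last by apply: mean_ladder; rewrite addnS.
rewrite /ladder -/ladder lin_linear -/s -/mu.
rewrite /prodfh /prodf addnS !big_nat_recr ?leq_addr//= -/(prodf k) -/(prodfh k a w).
rewrite /Q /Rs (std_mean0 (ladder k)); last exact: mean_ladder.
rewrite (std_mean0 (resid s)); last exact: mean_resid.
rewrite -/s; set L1 := lin _ a w; set L2 := lin _ a w; field.
by rewrite sa0 lt0r_neq0// mean_early_gt0.
Unshelve. all: by end_near. Qed.

(** The residual of factor [s] sees delays up to [s.+1] only, so delay [T] is reached by the last
    factor alone. *)
Lemma ladder_last k j : (t0 + k < T)%N -> ladder k j T = 0.
Proof.
elim: k => [//|k IH]; rewrite addnS => kT /=.
rewrite IH ?(ltnW kT)// mulr0 add0r /resid /early.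
have -> : (T <= (t0 + k).+1)%N = false by apply/negbTE; rewrite -ltnNge.
have -> : (T <= t0 + k)%N = false by apply/negbTE; rewrite -ltnNge ltnW.
by rewrite !mulr0 addr0 mulr0.
Qed.

(** In year 1, which every estimator uses, a claim of delay [T] has weight of absolute value
    [b > 0], coming from the last residual. The coefficients -1 and 0 put the sign change of the
    second error term in the shape of [lin_linear]. *)
Lemma var_ladder_gt0 k : (t0 + k.+1 = T)%N ->
  0 < var (fun j n => (-1) * ladder k.+1 j n + 0 * ladder k.+1 j n).
Proof.
rewrite addnS => kT.
have T0 : (0 < T)%N by rewrite -kT.
have sT : (1 <= t0 + k < T)%N by rewrite -kT ltnS leqnn andbT (leq_trans t0_ge1) ?leq_addr.
have TT : (1 <= T <= T)%N by rewrite leqnn andbT.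
pose b := prodf k * (mean (early (t0 + k) (t0 + k)))^-1.
have b0 : 0 < b.
  apply: mulr_gt0; first by apply: prodf_gt0; rewrite -kT.
  by rewrite invr_gt0 mean_early_gt0.
pose c : nat -> R := fun n => b * (n == T)%:R.
apply: (var_gt0 _ (Ordinal T0) c).
  move=> n; rewrite mul0r addr0 mulN1r normrN /c; case: eqP => [->|_]; last first.
    by rewrite mulr0 normr0.
  have r1 : resid (t0 + k) (Ordinal T0) T = 1.
    have h1 : (0 < T - (t0 + k))%N by rewrite subn_gt0 -kT.
    have h2 : (T <= (t0 + k).+1)%N by rewrite kT.
    have h3 : (T <= t0 + k)%N = false by apply/negbTE; rewrite -ltnNge -kT.
    by rewrite /resid /early h1 h2 h3 !mulr0 !mulr1 addr0.
  have kl : (t0 + k < T)%N by rewrite -kT.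
  have -> : ladder k.+1 (Ordinal T0) T = f (t0 + k) * ladder k (Ordinal T0) T +
    b * resid (t0 + k) (Ordinal T0) T by [].
  by rewrite ladder_last// r1 mulr0 add0r.
have i1 := rint_mark0 (fun n => (n == T)%:R).
have -> : \int[P]_w mark0 c w = b * \int[P]_w mark0 (fun n => (n == T)%:R) w.
  by rewrite -RintegralZl//; apply: eq_Rintegral => w _; rewrite /mark0 /c; ring.
by rewrite lt0r_neq0// mulr_gt0// mean_eq_gt0.
Qed.

Lemma ladder_error k : (t0 + k.+1 = T)%N ->
  let A2 := fun a w => Num.sqrt a * (prodf k.+1 - prodfh k.+1 a w) in
  [/\ measurable_family A2, tight P A2 &
     exists2 s : R, 0 < s & cvg_in_law P A2 (normal_prob 0 s)].
Proof.
move=> kT A2; have kT' : (t0 + k.+1 <= T)%N by rewrite kT.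
pose y j n := (-1) * ladder k.+1 j n + 0 * ladder k.+1 j n.
have y0 : mean y = 0 by rewrite mean_linear mean_ladder// !mulr0 addr0.
have mA2 : measurable_family A2.
  apply: measurable_sqrtM; apply: measurable_familyB; last exact: measurable_prodfh.
  exact: measurable_family_cst.
pose E a w := Num.sqrt a * (prodfh k.+1 a w - prodf k.+1) - std (ladder k.+1) a w.
have mE : measurable_family E.
  apply: measurable_familyB; last exact: measurable_std.
  apply: measurable_sqrtM; apply: measurable_familyB; first exact: measurable_prodfh.
  exact: measurable_family_cst.
have near0 : cvg_prob0 P (fun a w => A2 a w - std y a w).
  have := cvg_prob0M P E (fun _ _ => -1) mE (measurable_family_cst (fun=> -1))
    (ladder_linearization _ kT') (tight_cst P (-1)).
  rewrite (_ : (fun a w => E a w * -1) = (fun a w => A2 a w - std y a w))//.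
  apply/funext => a; apply/funext => w.
  rewrite /E /A2 (std_mean0 y)// (std_mean0 (ladder k.+1)); last exact: mean_ladder.
  have -> : lin y a w = -1 * lin (ladder k.+1) a w + 0 * lin (ladder k.+1) a w.
    exact: lin_linear.
  by ring.
split => //.
  have := tightD P _ _ (measurable_familyB _ _ mA2 (measurable_std y)) (measurable_std y)
    (cvg_prob0_tight P _ near0) (std_tight y).
  rewrite (_ : (fun a w => _ - _ + _) = A2)//.
  by apply/funext => a; apply/funext => w; rewrite subrK.
have v0 := var_ladder_gt0 k kT.
exists (Num.sqrt (var y)); first by rewrite sqrtr_gt0.
exact: slutsky P (std y) A2 _ (measurable_std y) mA2 (std_tight y) near0 (std_clt y v0).
Qed.

End chain_ladder.

(** * Observed events as sets of vectors of claims *)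

Let observed (jt : nat * nat) := [&& (1 <= jt.1)%N, (1 <= jt.2)%N & (jt.1 + jt.2 <= T.+1)%N].

Let obs a (jt : nat * nat) (w : Omega) : R :=
  if observed jt then claims M D Z jt.1 jt.2 a w else 0.

(** The analogue of [product_measurable] for sets of vectors. *)
Let cylinder (B : set (nat * nat -> R)) := forall d' (T' : measurableType d')
  (u : nat * nat -> T' -> R), (forall jt, measurable_fun setT (u jt)) ->
  measurable [set x | B (u ^~ x)].

(** Good-sets argument: the preimages of cylinders under the observed vector form a sigma-algebra
    containing the generators. It turns an observed event into a functional to which Mecke's
    identity applies. *)
Lemma obs_sigma_cylinder a A : obs_sigma M D Z T a A ->
  exists B, cylinder B /\ A = [set w | B (obs a ^~ w)].
Proof.
pose G := [set A : set Omega | exists B, cylinder B /\ A = [set w | B (obs a ^~ w)]].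
suff: obs_sigma M D Z T a `<=` G by apply.
apply: smallest_sub.
  split.
  - by exists set0; split => // d' T' u mu; rewrite (_ : [set _ | _] = set0).
  - move=> _ [B [mB ->]]; exists (~` B); split; last by rewrite setTD.
    by move=> d' T' u mu; apply: measurableC; exact: mB.
  - move=> F /choice[B HB]; exists (\bigcup_n B n); split.
      move=> d' T' u mu; rewrite (_ : [set _ | _] = \bigcup_n [set x | B n (u ^~ x)])//.
      by apply: bigcup_measurable => n _; apply: (HB n).1.
    by apply/seteqP; split => w [n _]; [rewrite (HB n).2|move=> Bn]; exists n => //; rewrite (HB n).2.
move=> A' [jt ojt [B mB <-]]; exists [set v | B (v jt)]; split.
  by move=> d' T' u mu; rewrite -[X in measurable X]setTI; exact: mu.
have {}ojt : observed jt = true by exact: ojt.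
by apply/funext => w; rewrite /= /obs ojt.
Qed.

Lemma obs_lin a jt w :
  obs a jt w = lin (fun j n => (observed jt && (j.+1 == jt.1))%:R * (n <= jt.2)%:R) a w.
Proof.
rewrite /obs /lin; case: ifP => [ojt|_]; last first.
  by rewrite big1// => j _; rewrite /wclaims big1// => k _; rewrite mul0r mulr0.
case: jt ojt => -[|j] t /and3P[//= _ t1 jt].
have jT : (j < T)%N by rewrite -(addn1 j) in jt *; lia.
rewrite (bigD1 (Ordinal jT))//= big1 ?addr0 => [|j' j'j].
  by apply: eq_bigr => k _; rewrite eqxx mul1r.
rewrite /wclaims big1// => k _; rewrite (_ : _ == _ = false) ?mul0r ?mulr0//.
apply: contra_neqF j'j => /eqP[j'j]; exact/val_inj.
Qed.

Section latest_diagonal.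
Variable j0 : 'I_T.
(** The year is i = [j0.+1], so [t0] is T - i + 1, its latest observed delay. *)
Let t0 := (T - j0)%N.

Let late (n : nat) : R := (n <= T)%:R - (n <= t0)%:R.

(* A claim with delay beyond [t0] moves none of the observed variables, so
   adding it in Mecke's identity leaves the event [A] unchanged. *)
Lemma late_claims_obs a A : 0 < a -> obs_sigma M D Z T a A ->
  \int[P]_w (wclaims late j0.+1 a w * \1_A w) =
  lam j0.+1 * a * (mean_upto T - mean_upto t0) * fine (P A).
Proof.
move=> a0 /obs_sigma_cylinder[B [cB AE]].
pose c (jt : nat * nat) (j : 'I_T) n : R :=
  (observed jt && (j.+1 == jt.1))%:R * (n <= jt.2)%:R.
have mB : product_measurable (\1_B : (nat * nat -> R) -> R).
  move=> d' T' u mu; rewrite (_ : (fun x => _) = \1_[set x | B (u ^~ x)]).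
    by apply: measurable_indic; exact: cB.
  by apply/funext => x; rewrite !indicE.
have B1 v : `|\1_B v : R| <= 1 by rewrite indicE; case: (_ \in _); rewrite ?normr1 ?normr0.
have [_ h] := mecke_model _ c j0 late a (\1_B) 1 a0 mB B1.
have mA : measurable A.
  rewrite AE; apply: cB => jt; rewrite (_ : obs a jt = lin (c jt) a); last first.
    by apply/funext => w; exact: obs_lin.
  by apply: measurable_lin; exact: ltW.
have BA w : \1_B (fun jt => \sum_(j < T) wclaims (c jt j) j.+1 a w) = \1_A w :> R.
  rewrite !indicE AE; congr (_%:R); congr nat_of_bool; apply/idP/idP; rewrite !inE/=.
    by rewrite (_ : obs a ^~ w = fun jt => \sum_(j < T) wclaims (c jt j) j.+1 a w)//;
      apply/funext => jt; rewrite obs_lin.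
  by rewrite (_ : obs a ^~ w = fun jt => \sum_(j < T) wclaims (c jt j) j.+1 a w)//;
      apply/funext => jt; rewrite obs_lin.
transitivity (\int[P]_w (wclaims late j0.+1 a w *
     \1_B (fun i => \sum_(j < T) wclaims (c i j) j.+1 a w))).
  by apply: eq_Rintegral => w _; rewrite BA.
rewrite h -[RHS]mulrA; congr (_ * _).
have i1 := rint_mark0 (upto T); have i2 := rint_mark0 (upto t0).
have iL := rint_mark0 late.
transitivity (\int[P]_w' (mark0 late w' * fine (P A))).
  apply: eq_Rintegral => w' _.
  have [D0t|tD0] := leqP (D0 w') t0.
    rewrite (_ : mark0 late w' = 0) ?mul0r// /mark0 /late D0t.
    by have /andP[_ ->] := D0T w'; rewrite subrr mulr0.
  congr (_ * _); transitivity (\int[P]_w (\1_A w : R)); last first.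
    by rewrite /Rintegral integral_indic// setIT.
  apply: eq_Rintegral => w _; rewrite -BA; congr (\1_B _); apply/funext => jt.
  rewrite (_ : mark0 _ _ = 0) ?addr0// /mark0 /c.
  case: jt => j t /=; case: eqP => [<-|_]; last by rewrite andbF mul0r mulr0.
  have [Dt|_] := leqP (D0 w') t; last by rewrite !mulr0.
  rewrite andbT (_ : observed _ = false) ?mul0r ?mulr0//.
  apply/negbTE/negP => /and3P[_ /= _ jt].
  by move: tD0; rewrite ltnNge => /negP; apply; rewrite /t0; have := ltn_ord j0; lia.
rewrite RintegralZr//; congr (_ * _).
rewrite /mean_upto -RintegralB//; apply: eq_Rintegral => w _.
by rewrite /mark0 /late; ring.
Qed.

Lemma mean_upto_lt t : (t < T)%N -> mean_upto t < mean_upto T.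
Proof.
have H k : (t + k.+1 <= T)%N -> mean_upto t < mean_upto (t + k.+1).
  elim: k => [|k IH] kT.
    by rewrite addn1 in kT *; rewrite mean_uptoS ltrDl; apply: mean_eq_gt0.
  rewrite addnS mean_uptoS; apply: lt_le_trans (IH _) _; first by apply: leq_trans kT; rewrite leq_add2l.
  by rewrite lerDl; apply: ltW; apply: mean_eq_gt0; rewrite -addnS kT addnS.
by move=> tT; have := H (T - t).-1; rewrite prednK ?subn_gt0// subnKC ?(ltnW tT)//; apply.
Qed.

Let t0_ge1 : (1 <= t0)%N. Proof. by rewrite subn_gt0. Qed.

Let t0_leT : (t0 <= T)%N. Proof. exact: leq_subr. Qed.

Let m0_gt0 : 0 < mean_upto t0. Proof. by apply: mean_upto_gt0; rewrite t0_ge1. Qed.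

Lemma prod_dev_factor : \prod_(t0 <= s < T) f s = mean_upto T / mean_upto t0.
Proof.
have H k : (t0 + k <= T)%N -> \prod_(t0 <= s < t0 + k) f s = mean_upto (t0 + k) / mean_upto t0.
  elim: k => [|k IH] kT; first by rewrite addn0 big_geq// mulfV// lt0r_neq0.
  rewrite addnS big_nat_recr ?leq_addr//= IH ?dev_factorE; last first.
    by apply: leq_trans kT; rewrite leq_add2l.
  have h : mean_upto (t0 + k) != 0.
    apply: lt0r_neq0; apply: mean_upto_gt0; rewrite (leq_trans t0_ge1) ?leq_addr//=.
    by apply: leq_trans kT; rewrite leq_add2l.
  by field; rewrite h lt0r_neq0.
by have := H (T - t0)%N; rewrite subnKC//; apply.
Qed.

Let kap : R := (mean_upto T - mean_upto t0) / mean_upto t0.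

(** [kap] is the product of the [f s] minus 1. The first part is the mean of the late claims, [lam
    j0.+1 * a * (mean_upto T - mean_upto t0)]; the second is the chain-ladder prediction of them
    from the diagonal. *)
Let pred a w := kap * (lam j0.+1 * a * mean_upto t0 - claims M D Z j0.+1 t0 a w).

Lemma measurable_obs_generators a : 0 <= a ->
  \bigcup_(jt in [set jt : nat * nat |
         [&& (1 <= jt.1)%N, (1 <= jt.2)%N & (jt.1 + jt.2 <= T.+1)%N]])
        events_real (claims M D Z jt.1 jt.2 a) `<=` measurable.
Proof.
move=> a0 A [jt ojt [B mB <-]]; rewrite -[X in measurable X]setTI.
have {}ojt : observed jt by exact: ojt.
rewrite (_ : claims M D Z jt.1 jt.2 a =
    lin (fun j n => (observed jt && (j.+1 == jt.1))%:R * (n <= jt.2)%:R) a).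
  exact: measurable_lin.
by apply/funext => w; rewrite -obs_lin /obs ojt.
Qed.

Lemma integral_indicM (X : Omega -> R) A : measurable A -> rint X ->
  (\int[P]_(w in A) (X w)%:E = (\int[P]_w (X w * \1_A w))%:E)%E.
Proof.
move=> mA iX; rewrite EFin_Rintegral; last first.
  apply: (rintM _ _ _ 1) => // w.
  by rewrite indicE; case: (_ \in _); rewrite ?normr1 ?normr0.
rewrite integral_mkcond; apply: eq_integral => w _; rewrite patchE indicE.
by case: ifP; rewrite ?mulr1 ?mulr0.
Qed.

(** [pred] is observable because the indices [j0.+1] and [t0] add up to [T.+1]. It has the right
    integral over each observed event because [late_claims_obs] replaces the late claims by their
    mean there. *)
Lemma prediction_residual a (Y : Omega -> R) : 0 < a ->
  cond_exp_version P (obs_sigma M D Z T a)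
    (fun w => claims M D Z j0.+1 T a w -
       claims M D Z j0.+1 t0 a w * \prod_(t0 <= s < T) f s) Y ->
  {ae P, forall w, Y w = pred a w}.
Proof.
move=> a0 [mY [iY YX]].
have gen := measurable_obs_generators a (ltW a0).
have iT : rint (claims M D Z j0.+1 T a) := rint_wclaims (upto T) j0 a a0.
have it0 : rint (claims M D Z j0.+1 t0 a) := rint_wclaims (upto t0) j0 a a0.
have iL : rint (wclaims late j0.+1 a) := rint_wclaims late j0 a a0.
have ip : rint (pred a) by apply: rintZl; apply: rintB => //; exact: rint_cst.
have iX : rint (fun w => claims M D Z j0.+1 T a w -
       claims M D Z j0.+1 t0 a w * \prod_(t0 <= s < T) f s).
  apply: rintB => //; apply: eq_integrable (rintZl _ (\prod_(t0 <= s < T) f s) _ it0) => // w _.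
  by rewrite /= mulrC.
apply: (cond_exp_unique P _ _ _ gen iY ip mY).
  move=> B mB.
  set S := \bigcup_(_ in _) _.
  have mp : measurable_fun setT (pred a : g_sigma_algebraType S -> R).
    apply: measurable_funM => //; apply: measurable_funB => //.
    move=> _ C mC; rewrite setTI; apply: sub_sigma_algebra.
    exists (j0.+1, t0); last by exists C.
    by rewrite /= t0_ge1/= /t0 addSn subnKC// ltnW.
  by have := mp measurableT B mB; rewrite setTI.
move=> A sA; have mA := g_sigma_measurable _ gen _ sA.
rewrite YX// !integral_indicM//; congr EFin.
have ind1 w : `|\1_A w : R| <= 1 by rewrite indicE; case: (_ \in _); rewrite ?normr1 ?normr0.
have mi : measurable_fun setT (\1_A : Omega -> R) by exact: measurable_indic.
have iLA := rintM _ _ _ 1 iL mi ind1; have it0A := rintM _ _ _ 1 it0 mi ind1.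
have iA : rint (\1_A : Omega -> R) by exact: (rint_bounded _ _ 1).
have PA : \int[P]_w (\1_A w : R) = fine (P A) by rewrite /Rintegral integral_indic// setIT.
transitivity (\int[P]_w (wclaims late j0.+1 a w * \1_A w +
    (- kap) * (claims M D Z j0.+1 t0 a w * \1_A w))).
  apply: eq_Rintegral => w _.
  have -> : wclaims late j0.+1 a w = claims M D Z j0.+1 T a w - claims M D Z j0.+1 t0 a w.
    by rewrite /wclaims /claims -sumrB; apply: eq_bigr => k _; rewrite /late mulrBr.
  rewrite prod_dev_factor /kap; field; exact: lt0r_neq0.
transitivity (\int[P]_w (kap * lam j0.+1 * a * mean_upto t0 * \1_A w +
    (- kap) * (claims M D Z j0.+1 t0 a w * \1_A w))); last first.
  by apply: eq_Rintegral => w _; rewrite /pred; ring.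
rewrite !RintegralD//; [|exact: rintZl|exact: rintZl|exact: rintZl].
congr (_ + _); rewrite RintegralZl// PA late_claims_obs// /kap; field.
exact: lt0r_neq0.
Qed.

Let ydiag : 'I_T -> nat -> R := fun j n => ((j == j0)%:R * - kap) * (n <= t0)%:R.

Lemma std_ydiag a w : 0 < a -> std ydiag a w = (Num.sqrt a)^-1 * pred a w.
Proof.
move=> a0; rewrite /cp_std mulrC; congr (_ * _).
have -> : lin ydiag a w = - kap * claims M D Z j0.+1 t0 a w.
  rewrite /lin (bigD1 j0)//= big1 ?addr0 => [|j jj0].
    by rewrite /wclaims /claims mulr_sumr; apply: eq_bigr => k _; rewrite /ydiag eqxx mul1r; ring.
  by rewrite /wclaims big1// => k _; rewrite /ydiag (negbTE jj0) !mul0r mulr0.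
have -> : mean ydiag = - kap * lam j0.+1 * mean_upto t0.
  rewrite /cp_mean (bigD1 j0)//= [X in _ + X]big1 ?addr0 => [|j jj0]; last first.
    rewrite (_ : \int[P]_w _ = 0) ?mulr0// -[RHS](Rintegral_cstT P).
    by apply: eq_Rintegral => v _; rewrite /mark0 /ydiag (negbTE jj0) !mul0r mulr0.
  have i1 := rint_mark0 (upto t0).
  rewrite [_ * lam _]mulrC -mulrA; congr (_ * _); rewrite /mean_upto -RintegralZl//.
  by apply: eq_Rintegral => v _; rewrite /mark0 /ydiag eqxx mul1r; ring.
by rewrite /pred; ring.
Qed.

Lemma diagonal_clt (Y : R -> Omega -> R) : (t0 < T)%N ->
  (forall a, 0 <= a -> cond_exp_version P (obs_sigma M D Z T a)
    (fun w => claims M D Z j0.+1 T a w -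
       claims M D Z j0.+1 t0 a w * \prod_(t0 <= s < T) f s) (Y a)) ->
  let A1 := fun a w => (Num.sqrt a)^-1 * Y a w in
  [/\ measurable_family A1, tight P A1 &
     exists2 s : R, 0 < s & cvg_in_law P A1 (normal_prob 0 s)].
Proof.
move=> t0T condY A1.
have mA1 : measurable_family A1.
  move=> a a0; apply: measurable_funM => //.
  by have [_ [iY _]] := condY a (ltW a0); exact: rint_measurable iY.
have near0 : cvg_prob0 P (fun a w => A1 a w - std ydiag a w).
  move=> k k0 e e0; near=> a; have a0 : 0 < a by near: a; exact: nbhs_pinfty_gt.
  (* The two terms agree almost surely for this [a], so the exceedance probability is exactly 0. *)
  rewrite (_ : exceed _ _ _ = 0) ?ltW// /exceed (_ : P _ = 0%E)//.
  apply: measure_negligible.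
    apply: measurable_gt; apply: measurableT_comp => //; apply: measurable_funB; first exact: mA1.
    exact: measurable_std.
  apply: negligibleS (prediction_residual a (Y a) a0 (condY a (ltW a0))) => w /= h Yw; move: h.
  by rewrite std_ydiag// /A1 Yw subrr normr0 ltNge ltW.
have mS := measurable_std ydiag.
split => //.
  have := tightD P _ _ (measurable_familyB _ _ mA1 mS) mS (cvg_prob0_tight P _ near0) (std_tight _).
  rewrite (_ : (fun a w => _ - _ + _) = A1)//.
  by apply/funext => a; apply/funext => w; rewrite subrK.
have k0 : 0 < kap by rewrite divr_gt0// subr_gt0 mean_upto_lt.
have v0 : 0 < var ydiag.
  apply: (var_gt0 _ j0 (fun n => kap * (n <= t0)%:R)).
    by move=> n; rewrite /ydiag eqxx mul1r mulNr normrN.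
  have i1 := rint_mark0 (upto t0).
  rewrite (_ : \int[P]_w _ = kap * mean_upto t0); first by rewrite lt0r_neq0// mulr_gt0.
  rewrite /mean_upto -RintegralZl//; apply: eq_Rintegral => w _; rewrite /mark0; ring.
exists (Num.sqrt (var ydiag)); first by rewrite sqrtr_gt0.
exact: slutsky P (std ydiag) A1 _ mS mA1 (std_tight ydiag) near0 (std_clt ydiag v0).
Unshelve. all: by end_near. Qed.

(** For [s >= t0] the sums in the estimator run over years up to [T - s <= j0], which excludes year
    [j0.+1]. *)
Lemma measurable_fhat_other_years s a : (t0 <= s)%N -> 0 <= a ->
  measurable_fun setT (fh s a : g_sigma_algebraType (other_years j0) -> R).
Proof.
move=> t0s a0.
have m t : measurable_fun setT (lin (early s t) a : g_sigma_algebraType (other_years j0) -> R).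
  apply: (@measurable_sum _ (g_sigma_algebraType (other_years j0))) => j.
  have [->|jj0] := eqVneq j j0; last exact: measurable_wclaims_other.
  rewrite (_ : wclaims _ _ _ = fun=> 0); first exact: measurable_cst.
  apply/funext => w; rewrite /wclaims big1// => k _; rewrite /early.
  rewrite (_ : (_ <= T - s)%N = false) ?mul0r ?mulr0//.
  by apply/negbTE; rewrite -ltnNge ltnS; have := ltn_ord j0; move: t0s; rewrite /t0; lia.
rewrite (_ : fh s a = fun w => lin (early s s.+1) a w * (lin (early s s) a w)^-1).
  by apply: measurable_funM => //; exact: (measurableT_comp measurable_invr).
by apply/funext => w; rewrite /fhat !sum_claimsE.
Qed.

Lemma diagonal_ladder_independent (Y : R -> Omega -> R) :
  (forall a, 0 <= a -> cond_exp_version P (obs_sigma M D Z T a)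
    (fun w => claims M D Z j0.+1 T a w -
       claims M D Z j0.+1 t0 a w * \prod_(t0 <= s < T) f s) (Y a)) ->
  independent P (sigma_real [set a : R | 0 <= a] (fun a w => (Num.sqrt a)^-1 * Y a w))
    (sigma_real [set a : R | 0 <= a] (fun a w => Num.sqrt a *
       (\prod_(t0 <= s < T) f s - \prod_(t0 <= s < T) fh s a w))).
Proof.
move=> condY.
have om := g_sigma_measurable _ (other_years_measurable j0).
have ym := year_measurable _ (ord_year j0).
have ladm : sigma_real [set a : R | 0 <= a] (fun a w => Num.sqrt a *
    (\prod_(t0 <= s < T) f s - \prod_(t0 <= s < T) fh s a w)) `<=` <<s other_years j0 >>.
  apply: smallest_sub; first exact: smallest_sigma_algebra.
  move=> A [a/= a0 [B mB <-]].
  suff m : measurable_fun setT ((fun w => \prod_(t0 <= s < T) fh s a w) :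
      g_sigma_algebraType (other_years j0) -> R).
    have m' : measurable_fun setT ((fun w => Num.sqrt a * (\prod_(t0 <= s < T) f s -
        \prod_(t0 <= s < T) fh s a w)) : g_sigma_algebraType (other_years j0) -> R).
      by apply: measurable_funM => //; apply: measurable_funB.
    by have := m' measurableT B mB; rewrite setTI.
  (* The factors outside the range are replaced by 1, so that every factor is measurable. *)
  rewrite (_ : (fun w => _) = fun w => \prod_(t0 <= s < T) (if (t0 <= s)%N then fh s a w else 1)).
    apply: measurable_prod => s _; case: (leqP t0 s) => h; last exact: measurable_cst.
    exact: measurable_fhat_other_years.
  by apply/funext => w; apply: eq_big_nat => s /andP[->].
suff H : independent P (sigma_real [set a : R | 0 <= a] (fun a w => (Num.sqrt a)^-1 * Y a w))
    <<s other_years j0 >>.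
  by move=> A B sA /ladm sB; exact: H.
apply: independent_almost ym om _ (year_other_years_independent j0).
move=> A [a/= a0 [B mB <-]].
have mY : measurable_fun setT (Y a).
  by have [_ [iY _]] := condY a a0; exact: rint_measurable iY.
have mp : measurable_fun setT ((fun w => (Num.sqrt a)^-1 * pred a w) :
    g_sigma_algebraType (year j0.+1) -> R).
  apply: measurable_funM => //; apply: measurable_funM => //; apply: measurable_funB => //.
  by apply: (measurable_wclaims_year (upto t0)) => //; exact: ord_year.
split.
  by rewrite -[X in measurable X]setTI; apply: measurable_funM.
exists ((fun w => (Num.sqrt a)^-1 * pred a w) @^-1` B).
  by have := mp measurableT B mB; rewrite setTI.
(* At [a = 0] the prefactor is 0 because the inverse of 0 is 0, so both functions vanish whatever
   the chosen version. *)
move: a0; rewrite le_eqVlt => /predU1P[<-|a0].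
  by apply: aeW => w; rewrite /= sqrtr0 invr0 !mul0r.
have := prediction_residual a (Y a) a0 (condY a (ltW a0)).
by apply: filterS => w /= ->.
Qed.

Lemma error_terms (Y : R -> Omega -> R) : (t0 < T)%N ->
  (forall a, 0 <= a -> cond_exp_version P (obs_sigma M D Z T a)
    (fun w => claims M D Z j0.+1 T a w -
       claims M D Z j0.+1 t0 a w * \prod_(t0 <= s < T) f s) (Y a)) ->
  let A1 := fun a w => (Num.sqrt a)^-1 * Y a w in
  let A2 := fun a w => Num.sqrt a *
     (\prod_(t0 <= s < T) f s - \prod_(t0 <= s < T) fh s a w) in
  [/\ independent P (sigma_real [set a : R | 0 <= a] A1)
                    (sigma_real [set a : R | 0 <= a] A2),
      exists2 s : R, 0 < s & cvg_in_law P A1 (normal_prob 0 s),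
      exists2 s : R, 0 < s & cvg_in_law P A2 (normal_prob 0 s)
    & exists mu : probability (measurableTypeR R) R,
        [/\ mu.-integrable setT EFin,
            (\int[mu]_x x%:E = 0)%E
          & cvg_in_law P (fun a w => A1 a w * A2 a w) mu]].
Proof.
move=> t0T condY A1 A2.
have ind := diagonal_ladder_independent Y condY.
have [mA1 tA1 [s1 s10 c1]] := diagonal_clt Y t0T condY.
have kT : (t0 + (T - t0).-1.+1 = T)%N by rewrite prednK ?subn_gt0// subnKC// ltnW.
have := ladder_error t0 t0_ge1 (T - t0).-1 kT; rewrite kT => -[mA2 tA2 [s2 s20 c2]].
split.
- exact: ind.
- by exists s1; [exact: s10|exact: c1].
- by exists s2; [exact: s20|exact: c2].
have [i1 _] := normal_prob_mean s1 s10; have [i2 m2] := normal_prob_mean s2 s20.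
have [mu [imu mu0 Emu]] := product_law _ _ i1 i2 m2.
exists mu; split; [exact: imu|exact: mu0|].
apply: (cvg_in_law_mul P A1 A2 _ _ mA1 mA2 tA1 tA2 c1 c2) => // a a0 g cg [K gK]; split.
  by apply: (measurable_mul_expectation P g K) => //; exact: mA2.
(* Independence of the whole families is restricted to the two variables at a single [a]. *)
have sub (X : R -> Omega -> R) : <<s events_real (X a) >> `<=` sigma_real [set a : R | 0 <= a] X.
  apply: sub_smallest2r; first exact: smallest_sigma_algebra.
  by move=> A XA; exists a => //; exact: ltW.
have em (X : Omega -> R) : measurable_fun setT X -> events_real X `<=` measurable.
  by move=> mX A [B mB <-]; rewrite -[X in measurable X]setTI; exact: mX.
have eX (X : Omega -> R) : measurable_fun setT (X : g_sigma_algebraType (events_real X) -> R).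
  by move=> _ B mB; rewrite setTI; apply: sub_sigma_algebra; exists B.
apply: (decoupling_mul P g K cg gK (events_real (A1 a)) (events_real (A2 a))) => //.
- exact: em (mA1 a a0).
- exact: em (mA2 a a0).
- by move=> A B /sub sA /sub sB; exact: ind.
Qed.

End latest_diagonal.

End special_model.

Theorem theorem4 (R : realType) (d : measure_display) (Omega : measurableType d)
  (P : probability Omega R) (T : nat) (lam : nat -> R)
  (M : nat -> R -> Omega -> nat) (D : nat -> nat -> Omega -> nat)
  (Z : nat -> nat -> Omega -> R) (D0 : Omega -> nat) (Z0 : Omega -> R)
  (i : nat) :
  (2 <= T)%N ->
  (* intensities and Poisson processes *)
  (forall j, (1 <= j <= T)%N -> 0 < lam j) ->
  (forall j, (1 <= j <= T)%N -> poisson_process P (M j) (lam j)) ->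
  (* the marks and the generic pair (D, Z) are random variables *)
  (forall j k n, (1 <= j <= T)%N -> (1 <= k)%N -> measurable (D j k @^-1` [set n])) ->
  (forall j k, (1 <= j <= T)%N -> (1 <= k)%N -> measurable_fun setT (Z j k)) ->
  (forall n, measurable (D0 @^-1` [set n])) ->
  measurable_fun setT Z0 ->
  (* D_{j,k} and D take values in {1,...,T} *)
  (forall j k w, (1 <= j <= T)%N -> (1 <= k)%N -> (1 <= D j k w <= T)%N) ->
  (forall w, (1 <= D0 w <= T)%N) ->
  (* D and Z independent, E[Z^2] < oo, E[Z 1{D = t}] > 0 *)
  independent P (events_nat D0) (events_real Z0) ->
  P.-integrable setT (fun w => (Z0 w ^+ 2)%:E) ->
  (forall t, (1 <= t <= T)%N ->
     (0 < 'E_P[(fun w => Z0 w * (D0 w == t)%:R)%R])%E) ->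
  (* each (D_{j,k}, Z_{j,k}) has the distribution of (D, Z) *)
  (forall j k, (1 <= j <= T)%N -> (1 <= k)%N ->
     forall t B, measurable B ->
       P (D j k @^-1` [set t] `&` Z j k @^-1` B)
       = P (D0 @^-1` [set t] `&` Z0 @^-1` B)) ->
  (* for each j, the pairs (D_{j,k}, Z_{j,k}), k >= 1, are independent *)
  (forall j, (1 <= j <= T)%N ->
     mutually_independent P (fun k : nat =>
       <<s events_nat (D j k.+1) `|` events_real (Z j k.+1) >>)) ->
  (* for each j, the marks are independent of the Poisson process M_j *)
  (forall j, (1 <= j <= T)%N ->
     independent P
       (<<s \bigcup_(k in [set k : nat | (1 <= k)%N])
              (events_nat (D j k) `|` events_real (Z j k)) >>)
       (<<s \bigcup_(a in [set a : R | 0 <= a]) events_nat (M j a) >>)) ->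
  (* the T families {M_j, (D_{j,k}, Z_{j,k})_k} are independent *)
  mutually_independent P (fun j : 'I_T =>
    <<s (\bigcup_(a in [set a : R | 0 <= a]) events_nat (M j.+1 a)) `|`
        (\bigcup_(k in [set k : nat | (1 <= k)%N])
              (events_nat (D j.+1 k) `|` events_real (Z j.+1 k))) >>) ->
  (2 <= i <= T)%N ->
  (* Y alpha: a version of E[C_{i,T} - C_{i,T-i+1} prod f_s | D^alpha] *)
  forall Y : R -> Omega -> R,
  (forall a, 0 <= a ->
     cond_exp_version P (obs_sigma M D Z T a)
       (fun w => claims M D Z i T a w
          - claims M D Z i (T - i + 1) a w
            * \prod_(T - i + 1 <= s < T) dev_factor P D0 Z0 s)
       (Y a)) ->
  let A1 := fun a w => (Num.sqrt a)^-1 * Y a w in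
  let A2 := fun a w => Num.sqrt a *
     (\prod_(T - i + 1 <= s < T) dev_factor P D0 Z0 s
      - \prod_(T - i + 1 <= s < T) fhat M D Z T s a w) in
  [/\ independent P (sigma_real [set a : R | 0 <= a] A1)
                    (sigma_real [set a : R | 0 <= a] A2),
      exists2 s : R, 0 < s & cvg_in_law P A1 (normal_prob 0 s),
      exists2 s : R, 0 < s & cvg_in_law P A2 (normal_prob 0 s)
    & exists mu : probability (measurableTypeR R) R,
        [/\ mu.-integrable setT EFin,
            (\int[mu]_x x%:E = 0)%E
          & cvg_in_law P (fun a w => A1 a w * A2 a w) mu]].
Proof.
case: i => [|i'] // T2 lam0 poisM mD mZ mD0 mZ0 DT D0T DZ_ind iZ2 EZD DZ_law marks_ind marks_M_ind
  years_ind iT Y condY.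
have /andP[i1 iT'] := iT.
have -> : (T - i'.+1 + 1)%N = (T - Ordinal iT')%N by rewrite /= addn1 subnSK.
move: condY; have -> : (T - i'.+1 + 1)%N = (T - Ordinal iT')%N by rewrite /= addn1 subnSK.
move=> condY A1 A2.
apply: (error_terms P T lam M D Z D0 Z0 lam0 poisM mD mZ mD0 mZ0 D0T iZ2 DZ_law marks_ind
  marks_M_ind years_ind EZD (Ordinal iT') Y _ condY).
(* The product over [s] is nonempty, [t0 < T], exactly because the year is at least 2. *)
by rewrite /= -subn_gt0 subKn// ltnW.
Qed.
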